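(* Let $m>1$. Given $\alpha \in [0,1/2)$, there exist a bounded open convex set $\Omega \subset \mathbb{R}^2$ with smooth boundary and $v_0 \in C^{\infty}(\overline{\Omega})$ which is strictly positive on $\Omega$ and vanishes on $\partial \Omega$ with the following properties: (i) $v_0$ is $\alpha$-concave on $\Omega$. (ii) $\nabla v_0$ does not vanish at any point of $\partial \Omega$. (iii) Let $v(x,t)$ be the solution of the porous medium equation (in pressure form) $\frac{\partial v}{\partial t} = (m-1)v\Delta v+|\nabla v|^2$ on $\mathbb{R}^2$ starting at $v_0$ (extended by $0$ outside $\overline{\Omega}$), and write $\Omega_t = \{ x \in \mathbb{R}^2 \mid v(x,t)>0\}$. Then there exists $\delta>0$ such that $\Omega_t$ is not convex for any $t \in (0,\delta)$, and thus $v(\cdot,t)|_{\Omega_t}$ is not $\alpha$-concave for any $t\in (0,\delta)$.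
   Context: $C^\infty(\overline{\Omega})$ denotes functions smooth up to the boundary; $\nabla v_0$ on $\partial \Omega$ is the continuous extension of the gradient from $\Omega$. $\alpha$-concavity: a positive function $f$ on a set is $\alpha$-concave, for $\alpha>0$, if $f^\alpha$ is concave; it is $0$-concave if $\log f$ is concave. Concavity of a function on a set includes the requirement that the set be convex. Solution of the porous medium equation (PME) on $\mathbb{R}^n$: fix $m>1$. For $u_0\ge 0$ in $L^1(\mathbb{R}^n)$, the solution (strong $L^1$ solution) of $u_t=\Delta(u^m)$ with initial data $u_0$ is the unique nonnegative $u\in C([0,\infty):L^1(\mathbb{R}^n))$ such that $u^m\in L^1_{\mathrm{loc}}([0,\infty):L^1(\mathbb{R}^n))$, $u_t,\Delta u^m\in L^1_{\mathrm{loc}}(\mathbb{R}^n\times(0,\infty))$, $u_t=\Delta u^m$ a.e. in $\mathbb{R}^n\times(0,\infty)$, and $u(t)\to u_0$ in $L^1(\mathbb{R}^n)$ as $t\to0$. If $u_0$ is compactly supported and Hölder continuous, then $u$ is (has a representative that is) continuous on $\mathbb{R}^n\times[0,\infty)$, and this representative is used. The solution of the pressure equation $v_t=(m-1)v\Delta v+|\nabla v|^2$ starting at $v_0$ means $v=\frac{m}{m-1}u^{m-1}$, where $u$ is the solution just described with initial data $u_0$ determined by $v_0=\frac{m}{m-1}u_0^{m-1}$. *)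

(* Defs.v *)
From HB Require Import structures.
From mathcomp Require Import all_boot all_order all_algebra.
From mathcomp Require Import all_classical all_reals all_analysis.

Set Implicit Arguments.
Unset Strict Implicit.
Unset Printing Implicit Defensive.

Import Order.TTheory GRing.Theory Num.Theory.
Import numFieldNormedType.Exports.

Local Open Scope classical_set_scope.
Local Open Scope ring_scope.

(* Points of the plane have type [R * R]; points (x, t) of space-time have type
   [(R * R) * R]. *)

Section Smoothness.
Context {R : realType}.

Definition iter_derive {V : normedModType R} (vs : seq V) (f : V -> R) : V -> R :=
  foldr (fun v g => 'D_v g) f vs.

(* For [A] open this is C^oo on [A]: differentiability of all iterated
   directional derivatives makes every one of them continuous. *)
Definition smooth_on {V : normedModType R} (A : set V) (f : V -> R) :=
  forall (vs : seq V) x, A x -> differentiable (iter_derive vs f) x.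

(* C^oo(closure Omega) for [Omega] open; the values of [f] outside
   [closure Omega] are irrelevant. *)
Definition smooth_upto_boundary {V : normedModType R} (Omega : set V)
    (f : V -> R) :=
  [/\ smooth_on Omega f,
      {within closure Omega, continuous f} &
      forall vs : seq V, exists2 g : V -> R,
        {within closure Omega, continuous g} &
        forall x, Omega x -> g x = iter_derive vs f x].

Definition boundary {V : normedModType R} (A : set V) : set V :=
  closure A `\` interior A.

Definition gradient (f : R * R -> R) (x : R * R) : R * R :=
  ('D_(1, 0) f x, 'D_(0, 1) f x).

(* For [Omega] open, such a [G] is unique on [closure Omega]. *)
Definition extends_gradient (Omega : set (R * R)) (f : R * R -> R)
    (G : R * R -> R * R) :=
  {within closure Omega, continuous G} /\
  forall x, Omega x -> G x = gradient f x.

(* Smoothness through local defining functions: by the implicit function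
   theorem this says that [Omega] is locally, up to a change of axes, the open
   region below a C^oo graph. *)
Definition has_smooth_boundary (Omega : set (R * R)) :=
  forall p, boundary Omega p ->
    exists (U : set (R * R)) (rho : R * R -> R),
      [/\ open U, U p, smooth_on U rho,
          forall x, U x -> gradient rho x != 0 &
          forall x, U x -> (Omega x <-> rho x < 0)].

End Smoothness.

Section Concavity.
Context {R : realType}.

Definition concave_on (A : set (R * R)) (f : R * R -> R) :=
  @convex_set R (R * R)%type A /\
  @convex_function R (R * R)%type A (fun x => - f x).

Definition alpha_concave (alpha : R) (A : set (R * R)) (f : R * R -> R) :=
  (forall x, A x -> 0 < f x) /\
  concave_on A (fun x => if alpha == 0 then ln (f x) else f x `^ alpha).

End Concavity.

Section PorousMedium.
Context {R : realType}.

Definition plane_measure :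
    set (measurableTypeR R * measurableTypeR R) -> \bar R :=
  (lebesgue_measure \x lebesgue_measure)%E.
HB.instance Definition _ := Measure.on plane_measure.

Definition spacetime_measure :
    set (measurableTypeR R * measurableTypeR R * measurableTypeR R) -> \bar R :=
  (plane_measure \x lebesgue_measure)%E.
HB.instance Definition _ := Measure.on spacetime_measure.

Definition positive_time : set (R * R * R) := [set z | 0 < z.2].

Definition L1_loc (D : set (R * R * R)) (g : R * R * R -> R) :=
  forall K : set (R * R * R), compact K -> K `<=` D ->
    spacetime_measure.-integrable K (EFin \o g).

Definition test_function (phi : R * R * R -> R) :=
  smooth_on setT phi /\
  exists2 K : set (R * R * R), compact K /\ K `<=` positive_time &
    forall z, ~ K z -> phi z = 0.

Definition time_derive (phi : R * R * R -> R) : R * R * R -> R :=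
  'D_((0, 0), 1) phi.

Definition space_laplacian (phi : R * R * R -> R) : R * R * R -> R :=
  fun z => 'D_((1, 0), 0) ('D_((1, 0), 0) phi) z
         + 'D_((0, 1), 0) ('D_((0, 1), 0) phi) z.

Definition weak_time_derivative (u g : R * R * R -> R) :=
  forall phi, test_function phi ->
    (\int[spacetime_measure]_(z in positive_time) (u z * time_derive phi z)%:E =
     - \int[spacetime_measure]_(z in positive_time) (g z * phi z)%:E)%E.

Definition weak_laplacian (w h : R * R * R -> R) :=
  forall phi, test_function phi ->
    (\int[spacetime_measure]_(z in positive_time)
        (w z * space_laplacian phi z)%:E =
     \int[spacetime_measure]_(z in positive_time) (h z * phi z)%:E)%E.

Definition L1_dist (f g : R * R -> R) : \bar R :=
  (\int[plane_measure]_x (`|f x - g x|)%:E)%E.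

(* Strong L^1 solutions of u_t = Delta (u^m); u_t and Delta (u^m) are taken in
   the sense of distributions on R^2 x (0, oo), and the values [u x t] with
   [t < 0] are irrelevant. *)
Record pme_solution (m : R) (u0 : R * R -> R) (u : R * R -> R -> R) : Prop := {
  pme_u0_ge0 : forall x, 0 <= u0 x ;
  pme_u0_L1 : plane_measure.-integrable setT (EFin \o u0) ;
  pme_ge0 : forall x t, 0 <= t -> 0 <= u x t ;
  pme_L1 : forall t, 0 <= t ->
    plane_measure.-integrable setT (EFin \o u ^~ t) ;
  pme_continuous_L1 : forall t, 0 <= t ->
    L1_dist (u ^~ s) (u ^~ t) @[s --> within [set s | 0 <= s] (nbhs t)]
      --> 0%E ;
  pme_power_L1 : forall T, 0 < T ->
    spacetime_measure.-integrable (setT `*` `[0, T])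
      (fun z => (u z.1 z.2 `^ m)%:E) ;
  pme_equation : exists ut lap : R * R * R -> R,
    [/\ L1_loc positive_time ut, L1_loc positive_time lap,
        weak_time_derivative (fun z => u z.1 z.2) ut,
        weak_laplacian (fun z => u z.1 z.2 `^ m) lap &
        {ae spacetime_measure, forall z, positive_time z -> ut z = lap z}] ;
  pme_initial : L1_dist (u ^~ t) u0 @[t --> 0^'+] --> 0%E
}.

Definition pressure (m a : R) : R := m / (m - 1) * a `^ (m - 1).

(* The solution of v_t = (m - 1) v Delta v + |grad v|^2 starting at [v0]; [u]
   is the representative that is continuous on R^2 x [0, oo). *)
Definition pressure_solution (m : R) (v0 : R * R -> R) (v : R * R -> R -> R) :=
  exists (u0 : R * R -> R) (u : R * R -> R -> R),
    [/\ forall x, v0 x = pressure m (u0 x),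
        pme_solution m u0 u,
        {within setT `*` [set t | 0 <= t],
          continuous (fun z : R * R * R => u z.1 z.2)} &
        forall x t, 0 <= t -> v x t = pressure m (u x t)].

Definition positivity_set (v : R * R -> R -> R) (t : R) : set (R * R) :=
  [set x | 0 < v x t].

End PorousMedium.

(* Main.v *)
Require Import Defs.
From HB Require Import structures.
From mathcomp Require Import all_boot all_order all_algebra.
From mathcomp Require Import all_classical all_reals all_analysis.
From mathcomp Require Import measurable_realfun.
From mathcomp Require Import ring lra.

Import Order.TTheory GRing.Theory Num.Theory.
Import numFieldNormedType.Exports.

Local Open Scope classical_set_scope.
Local Open Scope ring_scope.

(** Let W = y - y^2 - x^6 and h = 1 + x/2 + eps x^2 with eps = (1 - 2 alpha) / 64.
The domain is the cell where W > 0, and the initial pressure is v0 = W h.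

The support of a solution expands with normal speed |grad v|.  Near the origin
the boundary of the cell is y = x^6 up to higher order, and the speed there is
about h(x), a strictly convex function of x.  After a short time t the parts of
the front above x = s and x = -s have gone down by about h(s) t and h(-s) t,
with mean (1 + eps s^2) t, while the part above x = 0 has gone down by about t.
With s^2 = K t the gain eps s^2 t = eps K t^2 of the chord over the front in the
middle is larger than the errors of order t^2, whose size does not depend on K,
and larger than the height s^6 = K^3 t^3 of the initial boundary.  Hence the
midpoint of two points of the support at time t lies outside of the support
(midpoint_below_front, support_not_convex).

The power v0^alpha is concave although h is convex.  Along a line, W'' <= 0 and
h h'' <= (1 - 2 alpha) / (1 - alpha) h'^2, because the term x/2 keeps h' away
from 0 while h'' is of size eps; together these two conditions give
v0 v0'' <= (1 - alpha) v0'^2 (product_concavity, pressure_line_concave).  This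
is the place where alpha < 1/2 is needed.

The bounds on the front come from barriers (vanishing_below, positivity_above).
Since a solution is merely continuous, the equation is first integrated in time:
U(x, t), the integral of u^m over [0, t], satisfies Delta U = u(t) - u(0), that
is U_t = (Delta U + u(0))^m.  This form has a maximum principle, which is applied
to a mollification of U (potential_laplacian, comparison).  The barriers are
differences of powers of moving paraboloids (barrier_inequality).  From above
they give U = 0, hence u = 0; from below they give U > 0, hence u > 0 at some
earlier time nearby, and supports do not shrink (support_retained). *)

Set Implicit Arguments.
Unset Strict Implicit.
Unset Printing Implicit Defensive.

(** * Algebras of smooth functions *)

Section smooth_algebra.
Context {R : realType} {V : normedModType R}.

(** An inductive description of the algebra generated by [G] and the constants, so that
    closure under derivation is an induction. *)
Inductive smooth_alg (G : set (V -> R)) : (V -> R) -> Prop :=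
| smooth_alg_gen g : G g -> smooth_alg G g
| smooth_alg_cst c : smooth_alg G (cst c)
| smooth_alg_add f g : smooth_alg G f -> smooth_alg G g ->
    smooth_alg G (fun x => f x + g x)
| smooth_alg_mul f g : smooth_alg G f -> smooth_alg G g ->
    smooth_alg G (fun x => f x * g x).

Definition derivation_stable (G : set (V -> R)) := forall g, G g ->
  (forall x, differentiable g x) /\ forall v, smooth_alg G ('D_v g).

Lemma smooth_alg_derive G f : derivation_stable G -> smooth_alg G f ->
  (forall x, differentiable f x) /\ forall v, smooth_alg G ('D_v f).
Proof.
move=> sG; elim=> {f} [g /sG //|c|f g _ [df sf] _ [dg sg]|f g Sf [df sf] Sg [dg sg]].
- split=> [x|v]; first exact: differentiable_cst.
  rewrite (_ : 'D_v _ = cst 0); first exact: smooth_alg_cst.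
  by apply/funext => x; rewrite derive_cst.
- split=> [x|v]; first exact: differentiableD.
  rewrite (_ : 'D_v _ = fun x => 'D_v f x + 'D_v g x).
    exact: smooth_alg_add.
  by apply/funext => x; rewrite deriveD//; exact: diff_derivable.
- split=> [x|v]; first exact: differentiableM.
  rewrite (_ : 'D_v _ = fun x => f x * 'D_v g x + g x * 'D_v f x).
    by apply: smooth_alg_add; apply: smooth_alg_mul.
  by apply/funext => x; rewrite deriveM//; exact: diff_derivable.
Qed.

(** Smoothness involves all iterated derivatives in arbitrary directions; for an algebra that
    derivation maps to itself, one derivative is enough. *)
Lemma smooth_alg_smooth G f : derivation_stable G -> smooth_alg G f ->
  smooth_on setT f.
Proof.
move=> sG sf; suff H vs : smooth_alg G (iter_derive vs f).
  by move=> vs x _; exact: (smooth_alg_derive sG (H vs)).1.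
by elim: vs => //= v vs ih; exact: (smooth_alg_derive sG ih).2.
Qed.

End smooth_algebra.

Section smooth1.
Context {R : realType}.

Definition smooth1 (g : R -> R) := forall n x, derivable (derive1n n g) x 1.

Lemma smooth1_derivable g x : smooth1 g -> derivable g x 1.
Proof. by move=> /(_ 0%N x). Qed.

Lemma smooth1_derive g : smooth1 g -> smooth1 (derive1 g).
Proof. by move=> sg n x; rewrite -derive1Sn; exact: sg. Qed.

Lemma smooth1_continuous g : smooth1 g -> continuous g.
Proof.
move=> sg x; apply: differentiable_continuous; apply/derivable1_diffP.
exact: smooth1_derivable.
Qed.

Lemma derive_scale1 (g : R -> R) x v : derivable g x 1 ->
  'D_v g x = v * (derive1 g) x.
Proof.
move=> /derivable1_diffP dg; rewrite derive1E !deriveE//.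
by rewrite -[v in LHS]mulr1 -[LHS]/('d g x (v *: 1)) linearZ.
Qed.

Lemma smooth1_stable : derivation_stable smooth1.
Proof.
move=> g sg; split=> [x|v].
  by apply/derivable1_diffP; exact: smooth1_derivable.
rewrite (_ : 'D_v g = fun x => v * (derive1 g) x).
  apply: (smooth_alg_mul (f := cst v)); first exact: smooth_alg_cst.
  by apply: smooth_alg_gen; exact: smooth1_derive.
by apply/funext => x; rewrite derive_scale1//; exact: smooth1_derivable.
Qed.

Lemma smooth_alg_smooth1 (G : set (R -> R)) f : derivation_stable G ->
  smooth_alg G f -> smooth1 f.
Proof.
move=> sG sf n x; suff H : smooth_alg G (derive1n n f).
  by apply/derivable1_diffP; exact: (smooth_alg_derive sG H).1.
elim: n => [|n ih]; first by rewrite derive1n0.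
rewrite derive1nS (_ : derive1 _ = 'D_1 (derive1n n f)); first exact: (smooth_alg_derive sG ih).2.
by apply/funext => y; rewrite derive1E.
Qed.

Lemma smooth1_cst c : smooth1 (cst c).
Proof. exact: smooth_alg_smooth1 smooth1_stable (smooth_alg_cst _ _). Qed.

Lemma smooth1D f g : smooth1 f -> smooth1 g -> smooth1 (fun x => f x + g x).
Proof.
move=> sf sg; apply: (smooth_alg_smooth1 smooth1_stable).
by apply: smooth_alg_add; exact: smooth_alg_gen.
Qed.

Lemma smooth1M f g : smooth1 f -> smooth1 g -> smooth1 (fun x => f x * g x).
Proof.
move=> sf sg; apply: (smooth_alg_smooth1 smooth1_stable).
by apply: smooth_alg_mul; exact: smooth_alg_gen.
Qed.

Lemma smooth1_primitive (f f' : R -> R) : smooth1 f' -> (forall x : R, is_derive x (1 : R) f (f' x)) ->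
  smooth1 f.
Proof.
move=> sf' df; have fE : (derive1 f) = f'.
  by apply/funext => x; rewrite derive1E derive_val.
case=> [|n] x; first by rewrite derive1n0.
by rewrite derive1Sn fE; exact: sf'.
Qed.

Lemma is_derive_affine (f : R -> R) (a b x df : R) :
  is_derive (a * x + b) 1 f df ->
  is_derive x 1 (fun t => f (a * t + b)) (a * df).
Proof.
move=> h; rewrite mulrC.
have da : is_derive x 1 (fun t : R => a * t + b) a.
  rewrite (_ : (fun t : R => _) = (a *: id) + cst b); last exact/funext.
  by apply: is_derive_eq; rewrite addr0 scaler1.
exact: (is_derive1_comp (f := f)).
Qed.

Lemma smooth1_affine f a b : smooth1 f -> smooth1 (fun t => f (a * t + b)).
Proof.
move=> sf; pose G := [set g | exists2 f0, smooth1 f0 & g = fun t => f0 (a * t + b)].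
apply: (smooth_alg_smooth1 (G := G)); last by apply: smooth_alg_gen; exists f.
move=> _ [f0 sf0 ->].
have D (x : R) : is_derive x (1 : R) (fun t => f0 (a * t + b)) (a * (derive1 f0) (a * x + b)).
  apply: is_derive_affine; rewrite derive1E; apply: derivableP.
  exact: smooth1_derivable.
split=> [x|v].
  apply/derivable1_diffP; exact: ex_derive.
rewrite (_ : 'D_v _ = fun x => (v * a) * (derive1 f0) (a * x + b)).
  apply: (smooth_alg_mul (f := cst (v * a))); first exact: smooth_alg_cst.
  apply: smooth_alg_gen; exists (derive1 f0); [exact: smooth1_derive|by []].
apply/funext => x; rewrite derive_scale1; last exact: ex_derive.
by rewrite derive1E derive_val mulrA.
Qed.

Lemma smooth1_expR : smooth1 (@expR R).
Proof.
apply: (smooth_alg_smooth1 (G := [set @expR R])); last exact: smooth_alg_gen.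
move=> _ ->; split=> [x|v].
  by apply/derivable1_diffP; exact: derivable_expR.
rewrite (_ : 'D_v _ = fun x => v * expR x).
  by apply: (smooth_alg_mul (f := cst v)); [exact: smooth_alg_cst|exact: smooth_alg_gen].
apply/funext => x; rewrite derive_scale1; last exact: derivable_expR.
by rewrite derive1E derive_val.
Qed.

End smooth1.

Section flat.
Context {R : realType}.

(** The factors [s^-1 ^+ k] make the family stable under derivation; [k = 0] is the usual flat
    function. *)
Definition flat (k : nat) (s : R) : R :=
  if 0 < s then s^-1 ^+ k * expR (- s^-1) else 0.

Lemma flat_gt0 k s : 0 < s -> 0 < flat k s.
Proof. by move=> s0; rewrite /flat s0 mulr_gt0// ?expR_gt0// exprn_gt0// invr_gt0. Qed.

Lemma flat_ge0 k s : 0 <= flat k s.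
Proof. by have [s0|s0] := ltP 0 s; [exact/ltW/flat_gt0|rewrite /flat ltNge s0]. Qed.

Lemma flat_le0 k s : s <= 0 -> flat k s = 0.
Proof. by move=> s0; rewrite /flat ltNge s0. Qed.

(** The exponential series gives [s^-1 ^+ k.+2 <= k.+2! exp (1/s)]; this quadratic bound yields the
    derivative at 0. *)
Lemma flat_bound k s : `|flat k s| <= (k.+2)`!%:R * s ^+ 2.
Proof.
rewrite ger0_norm ?flat_ge0//; have [s0|s0] := ltP 0 s; last first.
  by rewrite flat_le0// mulr_ge0// ?sqr_ge0.
rewrite /flat s0 expRN ler_pdivrMr ?expR_gt0//.
have si : 0 <= s^-1 by rewrite invr_ge0 ltW.
have := expR_ge1Dxn (k.+1) si => h.
have {h}h : s^-1 ^+ k.+2 <= (k.+2)`!%:R * expR s^-1.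
  rewrite mulrC -ler_pdivrMr ?ltr0n ?fact_gt0//; apply: le_trans h.
  by rewrite lerDr.
rewrite mulrAC -ler_pdivrMr ?exprn_gt0// -exprVn -exprD addn2.
exact: h.
Qed.

Lemma is_derive_quadratic (f : R -> R) (x df C : R) :
  (forall h : R, `|f (h + x) - f x - h * df| <= C * h ^+ 2) ->
  is_derive x (1 : R) f df.
Proof.
move=> H.
have C0 : 0 <= C.
  by have := H 1; rewrite expr1n mulr1; apply: le_trans; exact: normr_ge0.
have lim : h^-1 *: ((f \o shift x) (h *: (1 : R)) - f x) @[h --> 0^'] --> df.
  apply/cvgrPdist_le => e e0.
  have d0 : 0 < e / (C + 1) by rewrite divr_gt0// ltr_wpDl.
  near=> h.
  have h0 : h != 0 by near: h; exact: nbhs_dnbhs_neq.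
  have he : `|h| < e / (C + 1) by near: h; exact: dnbhs0_lt.
  rewrite /= [h *: (1 : R)]mulr1 distrC -[h^-1 *: _]/(h^-1 * _).
  have -> : h^-1 * (f (h + x) - f x) - df = h^-1 * (f (h + x) - f x - h * df).
    by rewrite [in RHS]mulrBr mulrA mulVf// mul1r.
  rewrite normrM normfV ler_pdivrMl ?normr_gt0//.
  apply: (le_trans (H h)); rewrite -real_normK ?num_real// expr2 mulrCA.
  apply: ler_wpM2l; first exact: normr_ge0.
  apply: (@le_trans _ _ ((C + 1) * `|h|)); first by rewrite ler_wpM2r// lerDl.
  by rewrite mulrC -ler_pdivlMr ?ltW// ltr_wpDl.
apply: DeriveDef; last exact: cvg_lim lim.
by apply/cvg_ex; exists df.
Unshelve. all: end_near. Qed.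

Lemma is_derive_flat k (s : R) :
  is_derive s (1 : R) (flat k) (- k%:R * flat k.+1 s + flat k.+2 s).
Proof.
have [s0|s0|->] := ltgtP s 0.
- rewrite !flat_le0 ?ltW// mulr0 addr0.
  apply: (@near_eq_is_derive _ _ _ (cst 0)).
  near=> x; rewrite flat_le0//; apply: ltW; near: x; exact: lt_nbhsl.
- pose f := fun x : R => x^-1 ^+ k * expR (- x^-1).
  apply: (@near_eq_is_derive _ _ _ f).
    by near=> x; rewrite /flat ifT//; near: x; exact: lt_nbhsr.
  have sn0 : s != 0 by rewrite gt_eqF.
  have dV : is_derive s (1 : R) (fun x : R => x^-1) (- s^-1 ^+ 2).
    apply: DeriveDef; first by apply: (derivableV (f := id)).
    by rewrite (deriveV (f := id))// derive_id exprVn -[_ *: _]/(_ * _) mulr1.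
  have dE : is_derive s (1 : R) (fun x : R => expR (- x^-1)) (expR (- s^-1) * s^-1 ^+ 2).
    apply: (is_derive1_comp (f := @expR R) (g := fun x : R => - x^-1)).
    rewrite -[s^-1 ^+ 2]opprK; exact: (is_deriveN (f := fun x : R => x^-1)).
  have dX : is_derive s (1 : R) (fun x : R => x^-1 ^+ k)
      ((k%:R * s^-1 ^+ k.-1) * - s^-1 ^+ 2).
    have := is_deriveX (f := fun x : R => x^-1) k dV.
    rewrite exprfctE => D; exact: (is_derive_eq D).
  have := is_deriveM (f := fun x : R => x^-1 ^+ k) (g := fun x : R => expR (- x^-1)).
  move=> /(_ _ _ _ _ dX dE) D; apply: (is_derive_eq D).
  rewrite /flat s0 -![_ *: _]/(_ * _).
  case: k {f D dX} => [|k] /=; first by rewrite !expr0; ring.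
  by rewrite !exprS; ring.
- rewrite !flat_le0// mulr0 addr0.
  apply: (@is_derive_quadratic _ _ _ (k.+2)`!%:R) => h.
  by rewrite addr0 mulr0 subr0 (flat_le0 k (lexx 0)) subr0 flat_bound.
Unshelve. all: end_near. Qed.

Lemma smooth1_flat k : smooth1 (flat k).
Proof.
apply: (smooth_alg_smooth1 (G := range flat)); last first.
  by apply: smooth_alg_gen; exists k.
move=> _ [n _ <-]; split=> [x|v].
  by apply/derivable1_diffP; apply: ex_derive; exact: is_derive_flat.
rewrite (_ : 'D_v _ = fun x => v * (- n%:R * flat n.+1 x + flat n.+2 x)).
  apply: (smooth_alg_mul (f := cst v)); first exact: smooth_alg_cst.
  apply: smooth_alg_add; last by apply: smooth_alg_gen; exists n.+2.
  apply: (smooth_alg_mul (f := cst (- n%:R))); first exact: smooth_alg_cst.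
  by apply: smooth_alg_gen; exists n.+1.
apply/funext => x; rewrite derive_scale1.
  by rewrite derive1E; have [_ ->] := is_derive_flat n x.
by have [] := is_derive_flat n x.
Qed.

End flat.

(** * A bump function and its mollifiers *)

Section bump.
Context {R : realType}.
Notation mu := (@lebesgue_measure R).

Definition bump0 (s : R) : R := flat 0 (1 - s) * flat 0 (1 + s).

Lemma smooth1_bump0 : smooth1 bump0.
Proof.
apply: smooth1M.
  rewrite (_ : (fun x => _) = fun t : R => flat 0 (-1 * t + 1)).
    exact/smooth1_affine/smooth1_flat.
  by apply/funext => x; rewrite mulN1r addrC.
rewrite (_ : (fun x => _) = fun t : R => flat 0 (1 * t + 1)).
  exact/smooth1_affine/smooth1_flat.
by apply/funext => x; rewrite mul1r addrC.
Qed.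

Lemma bump0_ge0 s : 0 <= bump0 s.
Proof. by rewrite mulr_ge0// flat_ge0. Qed.

Lemma bump0_gt0 s : -1 < s < 1 -> 0 < bump0 s.
Proof. by move=> /andP[s1 s2]; rewrite mulr_gt0// flat_gt0//; lra. Qed.

Lemma bump0_out s : 1 <= `|s| -> bump0 s = 0.
Proof.
rewrite ler_normr /bump0 => /orP[s1|s1]; first by rewrite flat_le0 ?mul0r//; lra.
by rewrite mulrC flat_le0 ?mul0r//; lra.
Qed.

Lemma continuous_bump0 : continuous bump0.
Proof. exact/smooth1_continuous/smooth1_bump0. Qed.

Lemma integrable_bump0 (D : set R) : measurable D ->
  mu.-integrable D (EFin \o bump0).
Proof.
move=> mD; apply: (integrableS measurableT) => //.
rewrite (_ : EFin \o bump0 = (EFin \o bump0) \_ `[-1, 1]); last first.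
  apply/funext => x; rewrite patchE; case: ifPn => //.
  rewrite notin_setE/= in_itv/= => /negP; rewrite -ler_norml -ltNge => x1.
  by rewrite /= bump0_out// ltW.
apply/integrable_restrict => //=; rewrite setTI.
apply: continuous_compact_integrable; first exact: segment_compact.
by apply: continuous_subspaceT => x; exact: continuous_bump0.
Qed.

Definition bump_primitive (x : R) : R := (\int[mu]_(t in `]-oo, x]) bump0 t)%R.

Lemma is_derive_bump_primitive (x : R) :
  is_derive x (1 : R) bump_primitive (bump0 x).
Proof.
have x1 : x < x + 1 by lra.
have [||d1 d2] := @continuous_FTC1 R bump0 -oo%O x (x + 1)
   x1 (integrable_bump0 (measurable_itv _)).
- exact: ltNyr.
- exact: continuous_bump0.
by apply: (DeriveDef d1); rewrite -derive1E d2.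
Qed.

Lemma bump_primitive_le x : x <= -1 -> bump_primitive x = 0.
Proof.
move=> x1; rewrite /bump_primitive /Rintegral integral0_eq// => y /=.
rewrite in_itv/= => yx; rewrite bump0_out// ler_normr; apply/orP; right; lra.
Qed.

Lemma bump_primitive_MVT a b : a < b ->
  exists2 c, a < c < b & bump_primitive b - bump_primitive a = bump0 c * (b - a).
Proof.
move=> ab; have [|c cab E] := @MVT R bump_primitive bump0 a b ab
  (fun x _ => is_derive_bump_primitive x); last first.
  by exists c => //; move: cab; rewrite in_itv.
apply: continuous_subspaceT => x; apply: differentiable_continuous.
by apply/derivable1_diffP; have [] := is_derive_bump_primitive x.
Qed.

Definition bump_mass := bump_primitive 1.

Lemma bump_mass_gt0 : 0 < bump_mass.
Proof.
have m11 : (-1 : R) < 1 by lra.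
have [c c1] := bump_primitive_MVT m11.
rewrite (bump_primitive_le (lexx _)) subr0 /bump_mass => ->.
by apply: mulr_gt0; [exact: bump0_gt0|lra].
Qed.

Lemma bump_primitive_ge x : 1 <= x -> bump_primitive x = bump_mass.
Proof.
rewrite le_eqVlt => /predU1P[<-//|x1].
have [c /andP[c1 _] /eqP] := bump_primitive_MVT x1.
by rewrite bump0_out ?mul0r ?subr_eq0 => [/eqP//|]; rewrite ler_normr ltW.
Qed.

Lemma bump_primitive_homo x y : x <= y -> bump_primitive x <= bump_primitive y.
Proof.
rewrite le_eqVlt => /predU1P[<-//|xy].
have [c _ E] := bump_primitive_MVT xy.
by rewrite -subr_ge0 E mulr_ge0 ?bump0_ge0// subr_ge0 ltW.
Qed.

(** With [p = (1 - s)^-1] and [q = (1 + s)^-1], so that [p + q = 2 p q], the second derivative is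
    [bump0] times [u^2 (u - 1) (u - 3)] for [u = p + q >= 2], and this polynomial is at least -18.
    The one-sided bound by [bump0] itself is what keeps averages of a solution from vanishing. *)
Lemma bump0_derive2 (s : R) : - 18 * bump0 s <= derive1 (derive1 bump0) s.
Proof.
pose F k x := flat k (-1 * x + 1 : R); pose G k x := flat k (1 * x + 1 : R).
have dF k (x : R) : is_derive x (1 : R) (F k) (-1 * (- k%:R * F k.+1 x + F k.+2 x)).
  by apply: is_derive_affine; exact: is_derive_flat.
have dG k (x : R) : is_derive x (1 : R) (G k) (1 * (- k%:R * G k.+1 x + G k.+2 x)).
  by apply: is_derive_affine; exact: is_derive_flat.
have dM (f g : R -> R) (x df dg : R) : is_derive x (1 : R) f df -> is_derive x (1 : R) g dg ->
    is_derive x (1 : R) (fun y => f y * g y) (df * g x + f x * dg).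
  move=> h1 h2; have D := is_deriveM (f := f) (g := g) h1 h2.
  apply: (is_derive_eq D); rewrite -![_ *: _]/(_ * _); ring.
have -> : derive1 bump0 = fun x => - F 2 x * G 0 x + F 0 x * G 2 x.
  apply/funext => x; rewrite derive1E.
  have -> : bump0 = fun y => F 0 y * G 0 y.
    by apply/funext => y; rewrite /bump0 /F /G mulN1r mul1r ![_ + 1]addrC.
  have [_ ->] := dM _ _ _ _ _ (dF 0 x) (dG 0 x); ring.
have -> : derive1 (fun x => - F 2 x * G 0 x + F 0 x * G 2 x) s =
   (F 4 s - 2 * F 3 s) * G 0 s - 2 * F 2 s * G 2 s + F 0 s * (G 4 s - 2 * G 3 s).
  have D1 := dM _ _ _ _ _ (is_deriveN (dF 2 s)) (dG 0 s).
  have D2 := dM _ _ _ _ _ (dF 0 s) (dG 2 s).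
  have [_ D] := is_deriveD D1 D2.
  rewrite derive1E D -[(- F 2) s]/(- F 2 s); ring.
have -> : bump0 s = F 0 s * G 0 s.
  by rewrite /bump0 /F /G mulN1r mul1r ![_ + 1]addrC.
have [s1|s1] := leP s (-1).
  have z k : G k s = 0 by apply: flat_le0; lra.
  by rewrite !z !(mulr0, subr0, addr0).
have [s2|s2] := leP 1 s.
  have z k : F k s = 0 by apply: flat_le0; lra.
  by rewrite !z !(mulr0, mul0r, subr0, addr0).
set p := (-1 * s + 1)^-1; set q := (1 * s + 1)^-1.
have s3 : 0 < -1 * s + 1 by lra.
have s4 : 0 < 1 * s + 1 by lra.
have FE k : F k s = p ^+ k * F 0 s by rewrite /F /flat s3 expr0 mul1r.
have GE k : G k s = q ^+ k * G 0 s by rewrite /G /flat s4 expr0 [1 * expR _]mul1r.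
rewrite (FE 2) (FE 3) (FE 4) (GE 2) (GE 3) (GE 4).
have F0 : 0 <= F 0 s by exact: flat_ge0.
have G0 : 0 <= G 0 s by exact: flat_ge0.
have p0 : 0 < p by rewrite invr_gt0; lra.
have q0 : 0 < q by rewrite invr_gt0; lra.
have pq : p + q = 2 * (p * q).
  rewrite /p /q; field; apply/andP; split; apply/eqP; lra.
have s2' : 2 <= p + q.
  rewrite -(ler_pM2l (addr_gt0 p0 q0)); have := sqr_ge0 (p - q); nra.
rewrite -subr_ge0.
have -> : (p ^+ 4 * F 0 s - 2 * (p ^+ 3 * F 0 s)) * G 0 s -
   2 * (p ^+ 2 * F 0 s) * (q ^+ 2 * G 0 s) +
   F 0 s * (q ^+ 4 * G 0 s - 2 * (q ^+ 3 * G 0 s)) - -18 * (F 0 s * G 0 s) =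
   (F 0 s * G 0 s) * ((p + q) ^+ 2 * ((p + q) ^+ 2 - 4 * (p * q)) -
     2 * ((p + q) ^+ 3 - 3 * (p * q) * (p + q)) + 18) by ring.
have -> : p * q = (p + q) / 2 by lra.
rewrite mulr_ge0//; first exact: mulr_ge0.
set u := p + q in s2' *.
have -> : u ^+ 2 * (u ^+ 2 - 4 * (u / 2)) - 2 * (u ^+ 3 - 3 * (u / 2) * u) + 18 =
  u ^+ 2 * (u - 1) * (u - 3) + 18 by field.
have [u3|u3] := leP 3 u.
  by rewrite addr_ge0// !mulr_ge0// ?sqr_ge0//; lra.
have h1 : u ^+ 2 <= 9 by nra.
have h2 : 0 <= (u - 1) * (3 - u) <= 1 by nra.
nra.
Qed.

End bump.

Section mollifier.
Context {R : realType}.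
Implicit Types r s : R.

(** The summand 0 puts the argument into the affine form for which derivatives are stated. *)
Definition moll r s := (r * bump_mass)^-1 * bump0 (r^-1 * s + 0).
Definition ramp r s := bump_mass^-1 * bump_primitive (r^-1 * s + 0).

Lemma smooth1_moll r : smooth1 (moll r).
Proof.
by apply: smooth1M; [exact: smooth1_cst|exact/smooth1_affine/smooth1_bump0].
Qed.

Lemma is_derive_ramp r s : 0 < r -> is_derive s (1 : R) (ramp r) (moll r s).
Proof.
move=> r0; have D := is_derive_affine (is_derive_bump_primitive (r^-1 * s + 0)).
have := is_deriveZ (f := fun t => bump_primitive (r^-1 * t + 0)) bump_mass^-1 D.
move=> /is_derive_eq; apply.
by rewrite /moll -[_ *: _]/(_ * _) invfM mulrCA mulrA.
Qed.

Lemma smooth1_ramp r : 0 < r -> smooth1 (ramp r).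
Proof.
move=> r0; apply: (smooth1_primitive (f := ramp r) (@smooth1_moll r)) => s.
exact: is_derive_ramp.
Qed.

Lemma moll_ge0 r s : 0 < r -> 0 <= moll r s.
Proof.
by move=> r0; rewrite mulr_ge0 ?bump0_ge0// invr_ge0 mulr_ge0 ?ltW// bump_mass_gt0.
Qed.

Lemma moll_out r s : 0 < r -> r <= `|s| -> moll r s = 0.
Proof.
move=> r0 rs; rewrite /moll bump0_out ?mulr0// addr0 normrM gtr0_norm ?invr_gt0//.
by rewrite mulrC ler_pdivlMr// mul1r.
Qed.

Lemma ramp_le r s : 0 < r -> s <= - r -> ramp r s = 0.
Proof.
move=> r0 sr; rewrite /ramp bump_primitive_le ?mulr0// addr0.
by rewrite mulrC ler_pdivrMr// mulN1r.
Qed.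

Lemma ramp_ge r s : 0 < r -> r <= s -> ramp r s = 1.
Proof.
move=> r0 sr; rewrite /ramp bump_primitive_ge ?mulVf ?gt_eqF ?bump_mass_gt0// addr0.
by rewrite mulrC ler_pdivlMr// mul1r.
Qed.

Lemma ramp_homo r s s' : 0 < r -> s <= s' -> ramp r s <= ramp r s'.
Proof.
move=> r0 ss; apply: ler_wpM2l; first by rewrite invr_ge0 ltW// bump_mass_gt0.
by apply: bump_primitive_homo; rewrite lerD2r ler_wpM2l// invr_ge0 ltW.
Qed.

Lemma derive1_affine (f : R -> R) a b s : derivable f (a * s + b) 1 ->
  derive1 (fun t => f (a * t + b)) s = a * derive1 f (a * s + b).
Proof.
move=> df; rewrite derive1E.
have D : is_derive (a * s + b) (1 : R) f (derive1 f (a * s + b)).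
  by rewrite derive1E; exact: derivableP.
by have [_ ->] := is_derive_affine D.
Qed.

Lemma moll_derive2 r s : 0 < r ->
  - (18 / r ^+ 2) * moll r s <= derive1 (derive1 (moll r)) s.
Proof.
move=> r0; pose c := (r * bump_mass)^-1 : R.
have b0 : smooth1 (@bump0 R) by exact: smooth1_bump0.
have -> : derive1 (moll r) = fun t => c * r^-1 * derive1 bump0 (r^-1 * t + 0).
  apply/funext => t; rewrite /moll derive1Ml; last first.
    exact: smooth1_derivable (@smooth1_affine _ _ r^-1 0 b0).
  by rewrite derive1_affine ?mulrA//; exact: smooth1_derivable.
rewrite derive1Ml; last first.
  exact: smooth1_derivable (@smooth1_affine _ _ r^-1 0 (smooth1_derive b0)).
rewrite derive1_affine; last exact/smooth1_derivable/smooth1_derive.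
have := bump0_derive2 (r^-1 * s + 0) => h.
have c0 : 0 <= c by rewrite invr_ge0 mulr_ge0 ?ltW// bump_mass_gt0.
rewrite (_ : _ * moll r s = c * r^-1 * r^-1 * (- 18 * bump0 (r^-1 * s + 0))).
  rewrite [leRHS]mulrA.
  by rewrite ler_wpM2l// !mulr_ge0// invr_ge0 ltW.
by rewrite /moll -/c -exprVn; ring.
Qed.

Lemma moll_mass_itv r a : 0 < r ->
  (\int[lebesgue_measure]_(s in `[(a - r)%R, (a + r)%R]) (moll r (s - a))%:E)%E = 1%E.
Proof.
move=> r0; have ar : a - r < a + r by lra.
have dr s : is_derive s (1 : R) (fun t => ramp r (1 * t + - a)) (1 * moll r (1 * s + - a)).
  by apply: is_derive_affine; exact: is_derive_ramp.
rewrite (@continuous_FTC2 R _ (fun t => ramp r (1 * t + - a)) _ _ ar).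
- rewrite ramp_ge ?ramp_le//; [by rewrite sube0|lra|lra].
- apply: continuous_subspaceT => s.
  have C : continuous (fun t : R => moll r (1 * t + - a)).
    exact/smooth1_continuous/smooth1_affine/smooth1_moll.
  rewrite (_ : (fun t => moll r (t - a)) = fun t => moll r (1 * t + - a)); first exact: C.
  by apply/funext => t; rewrite mul1r.
- have cr : continuous (fun t : R => ramp r (1 * t + - a)).
    exact/smooth1_continuous/smooth1_affine/smooth1_ramp.
  split; first by move=> s _; have [] := dr s.
  - exact/cvg_at_right_filter/cr.
  - exact/cvg_at_left_filter/cr.
- by move=> s _; rewrite derive1E; have [_ ->] := dr s; rewrite !mul1r.
Qed.

Lemma moll_mass r a : 0 < r ->
  (\int[lebesgue_measure]_s (moll r (s - a))%:E)%E = 1%E.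
Proof.
move=> r0; rewrite -(moll_mass_itv a r0) [RHS]integral_mkcond; apply: eq_integral => s _.
rewrite patchE; case: ifPn => //; rewrite notin_setE/= in_itv/= => /negP ns.
rewrite moll_out// leNgt; apply: contraNN ns.
by rewrite ltr_norml => /andP[? ?]; apply/andP; split; lra.
Qed.

Lemma moll_even r s : moll r (- s) = moll r s.
Proof. by rewrite /moll /bump0 !addr0 mulrN opprK; congr (_ * _); rewrite mulrC. Qed.

End mollifier.

(** * Measurability of continuous functions on products *)

Section borel.
Context {R : realType}.

(** The product sigma-algebra and the product topology are defined independently; a countable
    base of measurable sets relates them, and such bases pass to products. *)
Definition measurable_base (T : Type) (nb : T -> set (set T)) (M : set (set T)) :=
  exists B : nat -> set T, (forall n, M (B n)) /\
    forall x (O : set T), nb x O -> exists2 n, B n x & B n `<=` O.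

Lemma measurable_base_R :
  @measurable_base (measurableTypeR R) (@nbhs R R) (@measurable _ (measurableTypeR R)).
Proof.
pose B n : set R := if @unpickle (rat * rat)%type n is Some p then
   `]ratr p.1, ratr p.2[%classic else set0.
exists B; split=> [n|x O /nbhs_ballP[e /= e0 xO]].
  by rewrite /B; case: unpickle => [p|//]; exact: measurable_itv.
have [|a /=] := @rat_in_itvoo R (x - e) x; first by rewrite ltrBlDr ltrDl.
rewrite in_itv/= => /andP[ea ax].
have [|b /=] := @rat_in_itvoo R x (x + e); first by rewrite ltrDl.
rewrite in_itv/= => /andP[xb be].
exists (pickle (a, b)); rewrite /B pickleK /=.
  by rewrite in_itv/= ax xb.
move=> y /=; rewrite in_itv/= => /andP[ay yb]; apply: xO.
by rewrite -ball_normE/= ltr_distlC; apply/andP; split; lra.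
Qed.

Lemma measurable_base_prod d1 d2 (T1 : measurableType d1) (T2 : measurableType d2)
    (nb1 : T1 -> set (set T1)) (nb2 : T2 -> set (set T2)) :
  measurable_base nb1 measurable -> measurable_base nb2 measurable ->
  measurable_base (fun x : T1 * T2 => filter_prod (nb1 x.1) (nb2 x.2)) measurable.
Proof.
move=> [B1 [mB1 b1]] [B2 [mB2 b2]].
exists (fun n => if @unpickle (nat * nat)%type n is Some p then
  B1 p.1 `*` B2 p.2 else set0); split=> [n|x O xO].
  by case: unpickle => [p|//]; exact: measurableX.
case: xO => P [x1 x2] O12.
have [n1 ? n1O] := b1 _ _ x1; have [n2 ? n2O] := b2 _ _ x2.
exists (pickle (n1, n2)); rewrite pickleK //= => y [y1 y2]; apply: O12.
by split; [exact: n1O|exact: n2O].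
Qed.

Lemma open_measurable_base d (T : measurableType d) (nb : T -> set (set T)) (O : set T) :
  measurable_base nb measurable -> (forall x, O x -> nb x O) -> measurable O.
Proof.
move=> [B [mB b]] oO.
rewrite (_ : O = \bigcup_n (if pselect (B n `<=` O) is left _ then B n else set0)).
  by apply: bigcupT_measurable => n; case: pselect.
apply/seteqP; split=> [x Ox|x [n _]]; last by case: pselect => // + Bx; exact.
by have [n Bn BO] := b _ _ (oO _ Ox); exists n => //; case: pselect.
Qed.

Lemma continuous_measurable_base d (T : measurableType d) (nb : T -> set (set T)) (f : T -> R) :
  measurable_base nb measurable ->
  (forall x (U : set R), nbhs (f x) U -> nb x (f @^-1` U)) ->
  measurable_fun setT (f : T -> measurableTypeR R).
Proof.
move=> bT cf; apply: (measurability _ (RGenOpens.measurableE R)).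
move=> _ [_ [a [b ->] <-]]; rewrite setTI.
apply: (open_measurable_base bT) => x fx.
by apply: cf; apply: open_nbhs_nbhs; split=> //; exact: interval_open.
Qed.

Lemma continuous_measurable_plane (f : R * R -> R) : continuous f ->
  measurable_fun setT (f : measurableTypeR R * measurableTypeR R -> measurableTypeR R).
Proof.
move=> cf; apply: (continuous_measurable_base
  (measurable_base_prod measurable_base_R measurable_base_R)) => x U.
exact: cf.
Qed.

Lemma continuous_measurable_spacetime (f : R * R * R -> R) : continuous f ->
  measurable_fun setT (f : measurableTypeR R * measurableTypeR R * measurableTypeR R
    -> measurableTypeR R).
Proof.
move=> cf; apply: (continuous_measurable_base (measurable_base_prod
  (measurable_base_prod measurable_base_R measurable_base_R) measurable_base_R)) => x U.
exact: cf.
Qed.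

End borel.

(** * Integrals over space-time *)

Section sigma_finite.
Context {R : realType}.

(** Tonelli's theorem on space-time rests on this instance. *)
Let plane_measure_sigma_finite : sigma_finite setT (@plane_measure R).
Proof.
have /sigma_finiteP[F [TF ndF Foo]] := sigma_finiteT (@lebesgue_measure R).
exists (fun n => F n `*` F n).
  rewrite -setXTT TF predeqE => -[x y]; split.
    move=> [/= [n _ Fnx] [k _ Fky]]; exists (maxn n k) => //; split.
    - by move: x Fnx; exact/subsetPset/ndF/leq_maxl.
    - by move: y Fky; exact/subsetPset/ndF/leq_maxr.
  by move=> [n _ []/= ? ?]; split; exists n.
move=> k; have [mF Fk] := Foo k; split; first exact: measurableX.
have -> : @plane_measure R (F k `*` F k) = (lebesgue_measure (F k) * lebesgue_measure (F k))%E.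
  exact: (product_measure1E (@lebesgue_measure R) (@lebesgue_measure R)).
by rewrite lte_mul_pinfty// ge0_fin_numE.
Qed.

HB.instance Definition _ := @Measure_isSigmaFinite.Build _ _ _
  (@plane_measure R) plane_measure_sigma_finite.

End sigma_finite.

Section integral.
Context {R : realType}.
Notation leb := (@lebesgue_measure R).
Notation ST := (@spacetime_measure R).
Implicit Types f g : R * R * R -> R.

Definition box (N : R) : set (R * R * R) := [set z | `|z| <= N].

Lemma norm_spacetime (z : R * R * R) (N : R) :
  `|z| <= N <-> [/\ `|z.1.1| <= N, `|z.1.2| <= N & `|z.2| <= N].
Proof.
by rewrite /Num.norm/= !ge_max; split=> [/andP[/andP[-> ->] ->]|[-> -> ->]].
Qed.

Lemma boxE N : box N = (`[- N, N] `*` `[- N, N]) `*` `[- N, N].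
Proof.
apply/seteqP; split=> z /=; rewrite !in_itv/= -!ler_norml.
  by move/norm_spacetime => [-> -> ->].
by move=> [[? ?] ?]; apply/norm_spacetime.
Qed.

Lemma compact_box N : compact (box N).
Proof.
rewrite boxE; apply: compact_setX; last exact: segment_compact.
by apply: compact_setX; exact: segment_compact.
Qed.

Lemma measurable_box N :
  measurable (box N : set (measurableTypeR R * measurableTypeR R * measurableTypeR R)).
Proof.
rewrite boxE; apply: measurableX; last exact: measurable_itv.
by apply: measurableX; exact: measurable_itv.
Qed.

Lemma box_fin N : (ST (box N) < +oo)%E.
Proof.
pose S : set (measurableTypeR R) := `[- N, N]%classic.
have mS : measurable S by exact: measurable_itv.
have -> : ST (box N) = (plane_measure (S `*` S) * leb S)%E.
  rewrite boxE; apply: (product_measure1E plane_measure leb) => //.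
  exact: measurableX.
have -> : @plane_measure R (S `*` S) = (leb S * leb S)%E.
  exact: (product_measure1E leb leb).
rewrite !lebesgue_measure_itv/=; case: ifPn => _; last by rewrite !mule0.
by rewrite -!EFinB -!EFinM ltry.
Qed.

Lemma continuous_bounded_box f N : continuous f ->
  exists2 M, 0 <= M & forall z, `|z| <= N -> `|f z| <= M.
Proof.
move=> cf; have /compact_bounded[M [_ HM]] : compact (f @` box N).
  by apply: continuous_compact; [exact: continuous_subspaceT|exact: compact_box].
exists (`|M| + 1) => [|z zN]; first by rewrite addr_ge0.
by apply: HM; [rewrite (le_lt_trans (ler_norm M))// ltrDl|exists z].
Qed.

Definition compactly_supported f N := forall z, N < `|z| -> f z = 0.

(** Continuous functions with compact support: every integrand below is of this kind. *)
Definition cc f := continuous f /\ exists N, compactly_supported f N.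

(** Negative times are included: solutions are extended to them, and the kernels vanish there. *)
Definition I f : R := Rintegral ST setT f.

Lemma cc_integrable f : cc f -> ST.-integrable setT (EFin \o f).
Proof.
move=> [cf [N fN]].
rewrite (_ : EFin \o f = (EFin \o f) \_ (box N)); last first.
  apply/funext => x; rewrite patchE; case: ifPn => //.
  by rewrite notin_setE/= => /negP; rewrite -ltNge => /fN /= ->.
have /= h := (@integrable_restrict _ _ _ ST _ (measurable_box N) setT measurableT (EFin \o f)); apply/h; rewrite setTI.
apply: measurable_bounded_integrable.
- exact: measurable_box.
- exact: box_fin.
- by apply: measurable_funTS; exact: continuous_measurable_spacetime.
have [M _ fM] := continuous_bounded_box N cf.
exists M; split; [exact: num_real|move=> x Mx z zN /=].
exact: (le_trans (fM z zN) (ltW Mx)).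
Qed.

Lemma ccD f g : cc f -> cc g -> cc (fun z => f z + g z).
Proof.
move=> [cf [N fN]] [cg [M gM]]; split.
  by move=> z; apply: cvgD; [exact: cf|exact: cg].
exists (Num.max N M) => z; rewrite gt_max => /andP[/fN -> /gM ->].
by rewrite addr0.
Qed.

Lemma ccM f g : continuous f -> cc g -> cc (fun z => f z * g z).
Proof.
move=> cf [cg [M gM]]; split.
  by move=> z; apply: cvgM; [exact: cf|exact: cg].
by exists M => z /gM ->; rewrite mulr0.
Qed.

Lemma ccMl (c : R) f : cc f -> cc (fun z => c * f z).
Proof. by apply: (@ccM (cst c)) => z; exact: cvg_cst. Qed.

Lemma ID f g : cc f -> cc g -> I (fun z => f z + g z) = I f + I g.
Proof. by move=> /cc_integrable hf /cc_integrable hg; rewrite /I RintegralD. Qed.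

Lemma IM c f : cc f -> I (fun z => c * f z) = c * I f.
Proof. by move=> /cc_integrable hf; rewrite /I RintegralZl. Qed.

Lemma IN f : cc f -> I (fun z => - f z) = - I f.
Proof. by move=> cf; under eq_fun do rewrite -mulN1r; rewrite IM// mulN1r. Qed.

Lemma ccN f : cc f -> cc (fun z => - f z).
Proof. by move=> cf; under eq_fun do rewrite -mulN1r; exact: ccMl. Qed.

Lemma ccB f g : cc f -> cc g -> cc (fun z => f z - g z).
Proof. by move=> cf cg; apply: ccD => //; exact: ccN. Qed.

Lemma IB f g : cc f -> cc g -> I (fun z => f z - g z) = I f - I g.
Proof. by move=> cf cg; rewrite ID ?IN//; exact: ccN. Qed.

Lemma I_le f g : cc f -> cc g -> (forall z, f z <= g z) -> I f <= I g.
Proof. by move=> /cc_integrable hf /cc_integrable hg fg; rewrite /I le_Rintegral. Qed.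

Definition volume N : R := fine (ST (box N)).

Lemma I_bound f N M : continuous f -> compactly_supported f N ->
  (forall z, `|z| <= N -> `|f z| <= M) -> `|I f| <= M * volume N.
Proof.
move=> cf fN fM.
have -> : I f = Rintegral ST (box N) f.
  rewrite /I [RHS]Rintegral_mkcond; congr Rintegral; apply/funext => x.
  rewrite patchE; case: ifPn => //.
  by rewrite notin_setE/= => /negP; rewrite -ltNge => /fN /= ->.
have If : ST.-integrable (box N) (EFin \o f).
  apply: integrableS (cc_integrable _) => //; first exact: measurable_box.
  by split=> //; exists N.
apply: le_trans (le_normr_Rintegral (measurable_box N) If) _.
rewrite -Rintegral_cst; last exact: measurable_box.
apply: le_Rintegral.
- exact: measurable_box.
- by have := integrable_norm If.
- apply: measurable_bounded_integrable; [exact: measurable_box|exact: box_fin|exact: measurable_cst|].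
  by exists `|M|; split; [exact: num_real|move=> x Mx z zN /=; exact: ltW].
- exact: fM.
Qed.

Lemma continuous_coords (a b c : R -> R) : continuous a -> continuous b ->
  continuous c -> continuous (fun z : R * R * R => a z.1.1 * b z.1.2 * c z.2).
Proof.
move=> ca cb cc' z.
have c1 : continuous (fun z : R * R * R => z.1).
  by move=> y; exact: cvg_fst.
have c11 : continuous (fun z : R * R * R => z.1.1).
  by move=> y; apply: continuous_comp; [exact: c1|exact: cvg_fst].
have c12 : continuous (fun z : R * R * R => z.1.2).
  by move=> y; apply: continuous_comp; [exact: c1|exact: cvg_snd].
have c2 : continuous (fun z : R * R * R => z.2).
  by move=> y; exact: cvg_snd.
apply: cvgM; [apply: cvgM|].
- by apply: (continuous_comp (c11 z)); exact: ca.
- by apply: (continuous_comp (c12 z)); exact: cb.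
- by apply: (continuous_comp (c2 z)); exact: cc'.
Qed.

Lemma I_moll r e x y t : 0 < r -> 0 < e ->
  I (fun z => moll r (z.1.1 - x) * moll r (z.1.2 - y) * moll e (z.2 - t)) = 1.
Proof.
move=> r0 e0.
have sh s u : continuous (fun a : R => moll s (a - u)).
  have C : continuous (fun a : R => moll s (1 * a + - u)).
    exact/smooth1_continuous/smooth1_affine/smooth1_moll.
  rewrite (_ : (fun a => _) = fun a : R => moll s (1 * a + - u)) => //.
  by apply/funext => b; rewrite mul1r.
have mm s u : measurable_fun setT (fun a : measurableTypeR R => (moll s (a - u))%:E).
  by apply/measurable_EFinP; apply: continuous_measurable_fun; exact: sh.
have g0 s u a : 0 < s -> (0 <= (moll s (a - u))%:E)%E.
  by move=> s0; rewrite lee_fin moll_ge0.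
have plane : (\int[plane_measure]_p (moll r (p.1 - x) * moll r (p.2 - y))%:E)%E = 1%E.
  have := @fubini_tonelli1 _ _ (measurableTypeR R) (measurableTypeR R) R leb leb
     (fun p => (moll r (p.1 - x) * moll r (p.2 - y))%:E).
  move=> /(_ _ _)/wrap[].
  - apply/measurable_EFinP; apply: continuous_measurable_plane => z.
    have c1 : continuous (fun z : R * R => z.1) by move=> p; exact: cvg_fst.
    have c2 : continuous (fun z : R * R => z.2) by move=> p; exact: cvg_snd.
    apply: cvgM.
      by apply: (@continuous_comp _ _ _ _ (fun a => moll r (a - x)) z (c1 z)); exact: sh.
    by apply: (@continuous_comp _ _ _ _ (fun a => moll r (a - y)) z (c2 z)); exact: sh.
  - by move=> p; rewrite lee_fin mulr_ge0// moll_ge0.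
  move=> ->; rewrite /fubini_F -[RHS](moll_mass x r0).
  apply: eq_integral => a _ /=; under eq_integral do rewrite EFinM.
  rewrite ge0_integralZl_EFin ?moll_mass ?mule1 ?moll_ge0//.
  by move=> b _; exact: g0.
rewrite /I /Rintegral.
suff -> : (\int[ST]_z (moll r (z.1.1 - x) * moll r (z.1.2 - y) * moll e (z.2 - t))%:E)%E = 1%E by [].
have := @fubini_tonelli1 _ _ (measurableTypeR R * measurableTypeR R)%type (measurableTypeR R) R plane_measure leb
  (fun z => (moll r (z.1.1 - x) * moll r (z.1.2 - y) * moll e (z.2 - t))%:E).
move=> /(_ _ _)/wrap[].
- apply/measurable_EFinP; apply: continuous_measurable_spacetime.
  exact: (continuous_coords (@sh r x) (@sh r y) (@sh e t)).
- move=> p; rewrite lee_fin; apply: mulr_ge0; last exact: moll_ge0.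
  by apply: mulr_ge0; exact: moll_ge0.
move=> ->; rewrite /fubini_F -[RHS]plane.
apply: eq_integral => a _ /=; under eq_integral do rewrite EFinM.
have m0 : 0 <= moll r (a.1 - x) * moll r (a.2 - y).
  by apply: mulr_ge0; exact: moll_ge0.
rewrite ge0_integralZl_EFin ?moll_mass ?mule1//.
by move=> b _; exact: g0.
Qed.

(** The common support and the bound [M] provide the dominating function. *)
Lemma is_derive_integral (f f' : R -> R * R * R -> R) (a b s N M : R) :
  a < s < b ->
  (forall x, a < x < b -> continuous (f x)) ->
  (forall x z, a < x < b -> is_derive x (1 : R) (f ^~ z) (f' x z)) ->
  (forall x, a < x < b -> compactly_supported (f x) N) ->
  (forall x z, a < x < b -> `|z| <= N -> `|f' x z| <= M) ->
  is_derive s (1 : R) (fun x => I (f x)) (I (f' s)).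
Proof.
move=> asb cf df sf bf.
have sI : `]a, b[%classic s by rewrite /= in_itv.
have ff x : a < x < b -> cc (f x) by move=> xab; split; [exact: cf|exists N; exact: sf].
have d1 x z : a < x < b -> partial1of2 f x z = f' x z.
  by move=> xab; rewrite partial1of2E; have [_ ->] := df x z xab.
pose G := fun z : R * R * R => if `|z| <= N then `|M| else 0 : R.
have h1 : forall x, `]a, b[%classic x -> ST.-integrable setT (EFin \o f x).
  by move=> x /=; rewrite in_itv/= => xab; exact/cc_integrable/ff.
have h2 : forall x z, `]a, b[%classic x -> setT z -> derivable (f ^~ z) x 1.
  by move=> x z /=; rewrite in_itv/= => xab _; have [] := df x z xab.
have h3 z : 0 <= G z by rewrite /G; case: ifP.
have h4 : ST.-integrable setT (EFin \o G).
  rewrite (_ : EFin \o G = (EFin \o (cst `|M|)) \_ (box N)); last first.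
    apply/funext => x; rewrite patchE /G /=; case: ifPn => [xN|xN].
      by rewrite ifT// mem_set.
    by rewrite ifF//; apply: memNset => /=; exact/negP.
  have /= h := (@integrable_restrict _ _ _ ST _ (measurable_box N) setT measurableT
    (EFin \o (cst `|M|))).
  apply/h; rewrite setTI.
  apply: measurable_bounded_integrable; [exact: measurable_box|exact: box_fin|exact: measurable_cst|].
  exists `|M|; split; [exact: num_real|move=> x Mx z zN /=].
  by rewrite normr_id ltW.
have h5 x z : `]a, b[%classic x -> setT z -> `|partial1of2 f x z| <= G z.
  move=> /= + _; rewrite in_itv/= => xab; rewrite /G; case: ifPn => zN.
    by rewrite d1// (le_trans (bf x z xab zN))// ler_norm.
  rewrite partial1of2E (_ : 'D_1 (f ^~ z) x = 0) ?normr0//.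
  rewrite (@near_eq_derive R R R (f ^~ z) (cst 0) x 1); first by rewrite derive_cst.
  near=> y; apply: sf; last by rewrite ltNge.
  have : y \in `]a, b[ by near: y; apply: near_in_itvoo; rewrite in_itv.
  by rewrite in_itv.
have D := derivable_under_integral measurableT sI h1 h2 h3 h4 h5.
have E := differentiation_under_integral measurableT sI h1 h2 h3 h4 h5.
apply: (DeriveDef D); rewrite -derive1E E.
by congr Rintegral; apply/funext => z; exact: d1.
Unshelve. all: end_near. Qed.

End integral.

(** * Test functions of product form *)

Section coordinates.
Context {R : realType} {V : normedModType R}.

(** Linearity in the form in which it enters a difference quotient. *)
Definition coordinate (l : V -> R) :=
  (forall x, differentiable l x) /\
  forall (h : R) (v x : V), l (h *: v + x) = h * l v + l x.

Lemma coordinate_derive (l : V -> R) (k : R -> R) (x v : V) : coordinate l ->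
  derivable k (l x) 1 -> 'D_v (fun y => k (l y)) x = l v * derive1 k (l x).
Proof.
move=> [_ ll] dk; rewrite -derive_scale1// /derive.
rewrite [X in lim (X @ _) = _](_ : _ = fun h : R =>
  h^-1 *: ((k \o shift (l x)) (h *: l v) - k (l x))) //.
by apply/funext => h /=; rewrite ll.
Qed.

(** Generators for which products of functions of one coordinate, and in particular polynomials,
    form an algebra. *)
Definition smooth_coordinates (g : V -> R) :=
  exists l k, [/\ coordinate l, smooth1 k & g = fun y => k (l y)].

Lemma smooth_coordinates_stable : derivation_stable smooth_coordinates.
Proof.
move=> _ [l [k [cl sk ->]]].
split=> [x|v].
  apply: (differentiable_comp (f := l)); first exact: cl.1.
  by apply/derivable1_diffP; exact: smooth1_derivable.
rewrite (_ : 'D_v _ = fun x => l v * derive1 k (l x)).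
  apply: (smooth_alg_mul (f := cst (l v))); first exact: smooth_alg_cst.
  apply: smooth_alg_gen; exists l, (derive1 k).
  by split; [exact: cl|exact: smooth1_derive|].
by apply/funext => y; apply: (coordinate_derive v cl); exact: smooth1_derivable.
Qed.

End coordinates.

Section coordinate_instances.
Context {R : realType}.

Lemma differentiable_fst (V W : normedModType R) (x : V * W) :
  differentiable (fst : V * W -> V) x.
Proof. by apply: linear_differentiable => y; exact: cvg_fst. Qed.

Lemma differentiable_snd (V W : normedModType R) (x : V * W) :
  differentiable (snd : V * W -> W) x.
Proof. by apply: linear_differentiable => y; exact: cvg_snd. Qed.

Lemma coordinate_fst : coordinate (fun z : R * R => z.1).
Proof. by split=> // x; exact: differentiable_fst. Qed.

Lemma coordinate_snd : coordinate (fun z : R * R => z.2).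
Proof. by split=> // x; exact: differentiable_snd. Qed.

Lemma coordinate_x : coordinate (fun z : R * R * R => z.1.1).
Proof.
split=> // x; apply: (differentiable_comp (f := fst)); exact: differentiable_fst.
Qed.

Lemma coordinate_y : coordinate (fun z : R * R * R => z.1.2).
Proof.
split=> // x; apply: (differentiable_comp (f := fst)); first exact: differentiable_fst.
exact: differentiable_snd.
Qed.

Lemma coordinate_t : coordinate (fun z : R * R * R => z.2).
Proof. by split=> // x; exact: differentiable_snd. Qed.

End coordinate_instances.

Section product_test.
Context {R : realType}.
Variables k1 k2 th : R -> R.
Hypotheses (s1 : smooth1 k1) (s2 : smooth1 k2) (s3 : smooth1 th).

Definition product_test (z : R * R * R) := k1 z.1.1 * k2 z.1.2 * th z.2.

Let sm l (k : R -> R) : coordinate l -> smooth1 k ->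
  smooth_alg (@smooth_coordinates R (R * R * R)%type) (fun z => k (l z)).
Proof. by move=> cl sk; apply: smooth_alg_gen; exists l, k. Qed.

Lemma smooth_product_test : smooth_on setT product_test.
Proof.
apply: (smooth_alg_smooth (@smooth_coordinates_stable _ _)).
apply: smooth_alg_mul; last by apply: sm; [exact: coordinate_t|].
by apply: smooth_alg_mul; apply: sm => //; [exact: coordinate_x|exact: coordinate_y].
Qed.

Let dc l k (z v : R * R * R) : coordinate l -> smooth1 k ->
  is_derive z v (fun y => k (l y)) (l v * derive1 k (l z)).
Proof.
move=> cl sk; apply: DeriveDef; last by apply: coordinate_derive => //; exact: smooth1_derivable.
apply: diff_derivable.
exact: (smooth_coordinates_stable (ex_intro _ l (ex_intro _ k (And3 cl sk erefl)))).1.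
Qed.

Let dM (f g : R * R * R -> R) (z v : R * R * R) df dg : is_derive z v f df -> is_derive z v g dg ->
  is_derive z v (fun y => f y * g y) (df * g z + f z * dg).
Proof.
move=> h1 h2; have D := is_deriveM (f := f) (g := g) h1 h2.
by apply: (is_derive_eq D); rewrite -![_ *: _]/(_ * _) addrC mulrC.
Qed.

Lemma derive_product_test (v z : R * R * R) : 'D_v product_test z =
  v.1.1 * (derive1 k1 z.1.1 * k2 z.1.2 * th z.2) +
  v.1.2 * (k1 z.1.1 * derive1 k2 z.1.2 * th z.2) +
  v.2 * (k1 z.1.1 * k2 z.1.2 * derive1 th z.2).
Proof.
have [_ ->] := dM (dM (dc z v coordinate_x s1) (dc z v coordinate_y s2)) (dc z v coordinate_t s3).
by ring.
Qed.

End product_test.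

Section product_test2.
Context {R : realType}.
Variables k1 k2 th : R -> R.
Hypotheses (s1 : smooth1 k1) (s2 : smooth1 k2) (s3 : smooth1 th).

Lemma time_derive_product_test z : time_derive (product_test k1 k2 th) z =
  product_test k1 k2 (derive1 th) z.
Proof. by rewrite /time_derive derive_product_test//= !mul0r !add0r mul1r. Qed.

Lemma space_laplacian_product_test z : space_laplacian (product_test k1 k2 th) z =
  product_test (derive1 (derive1 k1)) k2 th z + product_test k1 (derive1 (derive1 k2)) th z.
Proof.
rewrite /space_laplacian; congr (_ + _).
- rewrite (_ : 'D_((1, 0), 0) (product_test k1 k2 th) = product_test (derive1 k1) k2 th); last first.
    by apply/funext => y; rewrite derive_product_test//= !mul0r !addr0 mul1r.
  rewrite (derive_product_test (smooth1_derive s1) s2 s3).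
  by rewrite /= !mul0r !addr0 mul1r.
- rewrite (_ : 'D_((0, 1), 0) (product_test k1 k2 th) = product_test k1 (derive1 k2) th); last first.
    by apply/funext => y; rewrite derive_product_test//= !mul0r add0r addr0 mul1r.
  rewrite (derive_product_test s1 (smooth1_derive s2) s3).
  by rewrite /= !mul0r add0r addr0 mul1r.
Qed.

End product_test2.

(** * Powers of the positive part *)

Section positive_part.
Context {R : realType}.

(** Total in [s], so that barriers can be differentiated across their free boundary. *)
Definition ppow (p s : R) : R := (Num.max 0 s) `^ p.

Lemma ppow_ge0 p s : 0 <= ppow p s.
Proof. exact: powR_ge0. Qed.

Lemma ppow_le0 p s : p != 0 -> s <= 0 -> ppow p s = 0.
Proof. by move=> p0 s0; rewrite /ppow max_l// powR0. Qed.

Lemma ppow_gt0E p s : 0 <= s -> ppow p s = s `^ p.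
Proof. by move=> s0; rewrite /ppow max_r. Qed.

Lemma ppow_homo p s s' : 0 <= p -> s <= s' -> ppow p s <= ppow p s'.
Proof.
move=> p0 ss; apply: ge0_ler_powR => //.
- by rewrite nnegrE le_max lexx.
- by rewrite nnegrE le_max lexx.
- by rewrite ge_max !le_max lexx ss orbT.
Qed.

Lemma is_derive_ppow_gt0 (p s : R) : 0 < s ->
  is_derive s (1 : R) (ppow p) (p * ppow (p - 1) s).
Proof.
move=> s0; rewrite (ppow_gt0E _ (ltW s0)).
apply: (@near_eq_is_derive R R R (fun x => x `^ p)).
  near=> x; rewrite ppow_gt0E//; apply: ltW; near: x; exact: lt_nbhsr.
exact: is_derive1_powR.
Unshelve. all: end_near. Qed.

Lemma is_derive_ppow_lt0 (p s : R) : s < 0 -> p != 0 -> is_derive s (1 : R) (ppow p) 0.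
Proof.
move=> s0 p0; apply: (@near_eq_is_derive R R R (cst 0)).
near=> x; rewrite ppow_le0//; apply: ltW; near: x; exact: lt_nbhsl.
Unshelve. all: end_near. Qed.

Lemma continuous_ppow (p : R) : 0 < p -> continuous (ppow p).
Proof.
move=> p0 s; have pn0 : p != 0 by rewrite gt_eqF.
have [s0|s0|->] := ltgtP s 0.
- apply: differentiable_continuous; apply/derivable1_diffP.
  by have [] := is_derive_ppow_lt0 s0 pn0.
- apply: differentiable_continuous; apply/derivable1_diffP.
  by have [] := is_derive_ppow_gt0 p s0.
- rewrite /continuous_at (ppow_le0 pn0 (lexx _)); apply/cvgrPdist_lt => e e0.
  near=> x; rewrite sub0r normrN ger0_norm ?ppow_ge0//.
  have xe : x < e `^ p^-1.
    by near: x; apply: lt_nbhsl; exact: powR_gt0.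
  have [x0|x0] := leP x 0; first by rewrite ppow_le0.
  rewrite ppow_gt0E ?ltW//.
  rewrite [ltRHS](_ : e = (e `^ p^-1) `^ p); last first.
    by rewrite -powRrM mulVf// powRr1// ltW.
  by apply: gt0_ltr_powR => //; rewrite nnegrE ltW// powR_gt0.
Unshelve. all: end_near. Qed.

(** At 0 the difference quotient is at most [ppow (p - 1)], which tends to 0 because [1 < p]. *)
Lemma is_derive_ppow (p s : R) : 1 < p -> is_derive s (1 : R) (ppow p) (p * ppow (p - 1) s).
Proof.
move=> p1; have p0 : p != 0 by rewrite gt_eqF// (lt_trans _ p1).
have p10 : p - 1 != 0 by rewrite gt_eqF// subr_gt0.
have [s0|s0|->] := ltgtP s 0.
- rewrite ppow_le0 ?ltW// mulr0; exact: is_derive_ppow_lt0.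
- exact: is_derive_ppow_gt0.
rewrite (ppow_le0 p10 (lexx _)) mulr0.
have lim : h^-1 *: ((ppow p \o shift 0) (h *: (1 : R)) - ppow p 0) @[h --> 0^'] --> (0 : R).
  apply/cvgrPdist_lt => e e0; near=> h.
  have h0 : h != 0 by near: h; exact: nbhs_dnbhs_neq.
  rewrite /= [h *: (1 : R)]mulr1 addr0 (ppow_le0 p0 (lexx _)) subr0 sub0r normrN.
  rewrite -[_ *: _]/(_ * _) normrM normfV (ger0_norm (ppow_ge0 _ _)).
  have he : ppow (p - 1) h < e.
    near: h; apply: nbhs_dnbhs.
    have := @continuous_ppow (p - 1) _ 0; rewrite subr_gt0 => /(_ p1).
    rewrite /continuous_at (ppow_le0 p10 (lexx _)) => /cvgrPdist_lt/(_ e e0).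
    by apply: filterS => x; rewrite sub0r normrN ger0_norm// ppow_ge0.
  have [hl|hg] := leP h 0; first by rewrite ppow_le0// mulr0.
  rewrite gtr0_norm// (ppow_gt0E _ (ltW hg)) -(mulr_powRB1 (ltW hg)) ?(lt_trans _ p1)//.
  by rewrite mulKf// -(ppow_gt0E _ (ltW hg)).
apply: DeriveDef; last exact: cvg_lim lim.
by apply/cvg_ex; exists 0.
Unshelve. all: end_near. Qed.

End positive_part.

(** * The weak form of the equation *)

Section derive_support.
Context {R : realType}.

Lemma derive1_out (k : R -> R) (U : set R) s : open U -> U s ->
  (forall x, U x -> k x = 0) -> derive1 k s = 0.
Proof.
move=> oU Us kU; rewrite derive1E (@near_eq_derive R R R k (cst 0) s 1) ?derive_cst//.
by near=> x; apply: kU; near: x; exact: open_nbhs_nbhs.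
Unshelve. all: end_near. Qed.

Lemma derive1_norm_out (k : R -> R) N :
  (forall s, N < `|s| -> k s = 0) -> forall s, N < `|s| -> derive1 k s = 0.
Proof.
move=> kN s Ns; apply: (@derive1_out _ [set x | N < `|x|]) => //.
have /(_ _ (@open_gt R N)) := (@continuousP R R (fun x => `|x|)).1 (@norm_continuous R R).
by [].
Qed.

Lemma derive1_itv_out (k : R -> R) a b :
  (forall s, ~ (a <= s <= b) -> k s = 0) -> forall s, ~ (a <= s <= b) -> derive1 k s = 0.
Proof.
move=> kab s sab; apply: (@derive1_out _ (~` `[a, b]%classic)).
- apply: closed_openC; exact: itv_closed.
- by rewrite /= in_itv.
- by move=> x; rewrite /= in_itv/=; exact: kab.
Qed.

End derive_support.

Section solution.
Context {R : realType}.
Notation leb := (@lebesgue_measure R).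
Notation ST := (@spacetime_measure R).
Variables (m : R) (u0 : R * R -> R) (u : R * R -> R -> R).
Hypotheses (m1 : 1 < m) (usol : pme_solution m u0 u).
Hypothesis uc : {within setT `*` [set t : R | 0 <= t],
  continuous (fun z : R * R * R => u z.1 z.2)}.

(** Freezing [u] for negative times gives a continuous function on all of space-time. *)
Definition ubar (z : R * R * R) := u z.1 (Num.max 0 z.2).

Definition um (z : R * R * R) := ppow m (ubar z).

Lemma ubar_ge0 z : 0 <= ubar z.
Proof. by apply: (pme_ge0 usol); rewrite le_max lexx. Qed.

Lemma continuous_ubar : continuous ubar.
Proof.
move=> z; pose c (y : R * R * R) : R * R * R := (y.1, Num.max 0 y.2).
have c_cont : continuous c.
  move=> y.
  have c1 : (fun z : R * R * R => z.1) @ y --> y.1 by exact: cvg_fst.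
  have c2 : (fun z : R * R * R => Num.max 0 z.2) @ y --> Num.max 0 y.2.
    apply: (@continuous_max _ _ (fun=> 0) (fun z : R * R * R => z.2)).
      exact: cvg_cst.
    exact: cvg_snd.
  exact: (cvg_pair c1 c2).
have cA y : (setT `*` [set t : R | 0 <= t]) (c y).
  by split => //=; rewrite le_max lexx.
have /subspace_continuousP/(_ (c z) (cA z)) H := uc.
apply: (cvg_comp c (fun z : R * R * R => u z.1 z.2) _ H).
move=> B BB; have : nbhs z (c @^-1` [set x | (setT `*` [set t : R | 0 <= t]) x -> B x]).
  exact: (c_cont z _ BB).
by apply: filterS => y /(_ (cA y)).
Qed.

Lemma continuous_um : continuous um.
Proof.
move=> z; apply: (@continuous_comp _ _ _ ubar (ppow m)); first exact: continuous_ubar.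
by apply: continuous_ppow; exact: lt_trans m1.
Qed.

Lemma ubarE x t : 0 <= t -> ubar (x, t) = u x t.
Proof. by move=> t0; rewrite /ubar/= max_r. Qed.

Lemma umE x t : 0 <= t -> um (x, t) = u x t `^ m.
Proof. by move=> t0; rewrite /um ubarE// ppow_gt0E//; exact: (pme_ge0 usol). Qed.

Lemma continuous_product_test (k1 k2 th : R -> R) : smooth1 k1 -> smooth1 k2 ->
  smooth1 th -> continuous (product_test k1 k2 th).
Proof. by move=> *; apply: continuous_coords; exact: smooth1_continuous. Qed.

Lemma integral_positive_time (f g : R * R * R -> R) :
  (forall z, 0 < z.2 -> f z = g z) -> (forall z, z.2 <= 0 -> g z = 0) ->
  (\int[ST]_(z in positive_time) (f z)%:E = \int[ST]_z (g z)%:E)%E.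
Proof.
move=> fg g0; rewrite integral_mkcond; apply: eq_integral => z _.
rewrite patchE; case: ifPn; first by rewrite inE /positive_time/= => /fg ->.
by rewrite notin_setE /positive_time/= => /negP; rewrite -leNgt => /g0 ->.
Qed.

Lemma integral_cc (f : R * R * R -> R) : cc f -> (\int[ST]_z (f z)%:E)%E = (I f)%:E.
Proof.
move=> /cc_integrable h; rewrite /I /Rintegral fineK//.
exact: (integrable_fin_num _ h).
Qed.

(** Both distributional derivatives are locally integrable and agree almost everywhere, so that the
    test function can be moved from one to the other. *)
Lemma weak_form (k1 k2 th : R -> R) (N a b : R) :
  smooth1 k1 -> smooth1 k2 -> smooth1 th -> 0 < a ->
  (forall s, N < `|s| -> k1 s = 0) -> (forall s, N < `|s| -> k2 s = 0) ->
  (forall s, ~ (a <= s <= b) -> th s = 0) ->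
  I (fun z => um z * (product_test (derive1 (derive1 k1)) k2 th z +
                      product_test k1 (derive1 (derive1 k2)) th z)) =
  - I (fun z => ubar z * product_test k1 k2 (derive1 th) z).
Proof.
move=> s1 s2 s3 a0 z1 z2 z3.
pose phi := product_test k1 k2 th.
pose K : set (R * R * R) := (`[- N, N] `*` `[- N, N]) `*` `[a, b].
have cK : compact K.
  apply: compact_setX; last exact: segment_compact.
  by apply: compact_setX; exact: segment_compact.
have mK : measurable (K : set (measurableTypeR R * measurableTypeR R * measurableTypeR R)).
  apply: measurableX; last exact: measurable_itv.
  by apply: measurableX; exact: measurable_itv.
have outK (z : R * R * R) : ~ K z -> [\/ N < `|z.1.1|, N < `|z.1.2| | ~ (a <= z.2 <= b)].
  move=> nK; have [h|h] := ltP N `|z.1.1|; first exact: Or31.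
  have [h'|h'] := ltP N `|z.1.2|; first exact: Or32.
  apply: Or33 => h3; apply: nK; split; first by split; rewrite /= in_itv/= -ler_norml.
  by rewrite /= in_itv.
have pK (c1 c2 c3 : R -> R) (z : R * R * R) : (forall s, N < `|s| -> c1 s = 0) ->
    (forall s, N < `|s| -> c2 s = 0) -> (forall s, ~ (a <= s <= b) -> c3 s = 0) ->
    ~ K z -> product_test c1 c2 c3 z = 0.
  move=> h1 h2 h3 /outK[?|?|?]; rewrite /product_test.
  - by rewrite h1// !mul0r.
  - by rewrite h2// mulr0 mul0r.
  - by rewrite h3// mulr0.
have Kpos : K `<=` positive_time.
  by move=> z [_] /=; rewrite in_itv/= => /andP[az _]; exact: lt_le_trans az.
have posK (z : R * R * R) : z.2 <= 0 -> ~ K z.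
  by move=> z0 /Kpos; rewrite /positive_time/= ltNge z0.
have tphi : test_function phi.
  split; first exact: smooth_product_test.
  by exists K => // z; exact: pK.
have [ut [lap [Lu Ll wu wl ae]]] := pme_equation usol.
have E1 := wu _ tphi; have E2 := wl _ tphi.
have dK1 : forall s, N < `|s| -> derive1 (derive1 k1) s = 0.
  by apply: derive1_norm_out; exact: derive1_norm_out.
have dK2 : forall s, N < `|s| -> derive1 (derive1 k2) s = 0.
  by apply: derive1_norm_out; exact: derive1_norm_out.
have dK3 := derive1_itv_out z3.
have E3 : (\int[ST]_(z in positive_time) (ut z * phi z)%:E =
    \int[ST]_(z in positive_time) (lap z * phi z)%:E)%E.
  have red g : (\int[ST]_(z in positive_time) (g z * phi z)%:E =
      \int[ST]_(z in K) (g z * phi z)%:E)%E.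
    rewrite integral_mkcond [RHS]integral_mkcond; apply: eq_integral => z _.
    rewrite !patchE; have [Kz|nKz] := pselect (K z).
      by rewrite !mem_set//; exact: Kpos.
    rewrite (memNset nKz); case: ifPn => // _.
    by rewrite /phi (pK k1 k2 th)// mulr0.
  rewrite !red; apply: ae_eq_integral => //.
  - apply/measurable_EFinP; apply: measurable_funM.
      by have /integrableP[/measurable_EFinP] := Lu _ cK Kpos.
    apply: measurable_funTS; apply: continuous_measurable_spacetime.
    exact: continuous_product_test.
  - apply/measurable_EFinP; apply: measurable_funM.
      by have /integrableP[/measurable_EFinP] := Ll _ cK Kpos.
    apply: measurable_funTS; apply: continuous_measurable_spacetime.
    exact: continuous_product_test.
  - move: ae; apply: filterS; first exact: (ae_filter_ringOfSetsType ST).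
    by move=> z h Kz; rewrite h//; exact: Kpos.
have ccf (f : R * R * R -> R) (c1 c2 c3 : R -> R) : continuous f ->
    smooth1 c1 -> smooth1 c2 -> smooth1 c3 -> (forall s, N < `|s| -> c1 s = 0) ->
    (forall s, N < `|s| -> c2 s = 0) -> (forall s, ~ (a <= s <= b) -> c3 s = 0) ->
    cc (fun z => f z * product_test c1 c2 c3 z).
  move=> cf ? ? ? ? ? ?; apply: ccM => //; split; first exact: continuous_product_test.
  have [M [_ KM]] := compact_bounded cK.
  have MM : M < `|M| + 1 by rewrite (le_lt_trans (ler_norm M))// ltrDl.
  exists (`|M| + 1) => z Mz; apply: pK => // Kz.
  by have := KM _ MM z Kz; rewrite /= leNgt Mz.
have F1 : (\int[ST]_(z in positive_time) (u z.1 z.2 * time_derive phi z)%:E)%E =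
    (I (fun z => ubar z * product_test k1 k2 (derive1 th) z))%:E.
  rewrite -integral_cc; last first.
    exact: (ccf _ _ _ _ continuous_ubar s1 s2 (smooth1_derive s3) z1 z2 dK3).
  apply: integral_positive_time => z z0.
    rewrite time_derive_product_test//; congr (_ * _).
    by rewrite /ubar max_r// ltW.
  by rewrite (pK k1 k2)//?mulr0//; exact: posK.
have F2 : (\int[ST]_(z in positive_time) (u z.1 z.2 `^ m * space_laplacian phi z)%:E)%E =
    (I (fun z => um z * (product_test (derive1 (derive1 k1)) k2 th z +
                      product_test k1 (derive1 (derive1 k2)) th z)))%:E.
  rewrite -integral_cc; last first.
    under eq_fun do rewrite mulrDr.
    apply: ccD.
      exact: (ccf _ _ _ _ continuous_um (smooth1_derive (smooth1_derive s1)) s2 s3 dK1 z2 z3).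
    exact: (ccf _ _ _ _ continuous_um s1 (smooth1_derive (smooth1_derive s2)) s3 z1 dK2 z3).
  apply: integral_positive_time => z z0.
    rewrite space_laplacian_product_test//; congr (_ * _).
    by case: z z0 => x t /= t0; rewrite umE// ltW.
  rewrite (pK _ _ _ _ dK1 z2 z3 (posK _ z0)) (pK _ _ _ _ z1 dK2 z3 (posK _ z0)).
  by rewrite addr0 mulr0.
apply: EFin_inj; rewrite -F2 E2 -E3 EFinN -F1 E1 oppeK//.
Qed.

(** If the two values differed at [x], continuity would keep them apart by a fixed amount on a small
    cylinder, and the L^1 distance to [u0] could not tend to 0. *)
Lemma initial_value (x : R * R) : continuous u0 -> ubar (x, 0) = u0 x.
Proof.
move=> cu0; apply/eqP; apply: contraT => neq.
pose g (z : R * R * R) := `|ubar z - u0 z.1|.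
have cg : continuous g.
  move=> z; apply: (@continuous_comp _ _ _ (fun z => ubar z - u0 z.1) (fun a => `|a|)); last first.
    exact: norm_continuous.
  apply: cvgB; first exact: continuous_ubar.
  by apply: (@continuous_comp _ _ _ (fun z : R * R * R => z.1) u0); [exact: cvg_fst|exact: cu0].
have g0 : 0 < g (x, 0) by rewrite normr_gt0 subr_eq0.
set c := g (x, 0) in g0.
have /nbhs_ballP[e /= e0 ge] : nbhs (x, 0) (g @^-1` [set a | c / 2 < a]).
  apply: (cg (x, 0)); apply: open_nbhs_nbhs; split; first exact: open_gt.
  by rewrite /= ltr_pdivrMr// ltr_pMr// ltrDl.
pose s := e / 2; have s0 : 0 < s by rewrite divr_gt0.
pose S1 : set (measurableTypeR R) := `[x.1 - s, x.1 + s]%classic.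
pose S2 : set (measurableTypeR R) := `[x.2 - s, x.2 + s]%classic.
have mS1 : measurable S1 by exact: measurable_itv.
have mS2 : measurable S2 by exact: measurable_itv.
have mS : measurable (S1 `*` S2) by exact: measurableX.
have vS : @plane_measure R (S1 `*` S2) = ((s + s) * (s + s))%:E.
  have -> : @plane_measure R (S1 `*` S2) = (leb S1 * leb S2)%E.
    exact: (product_measure1E leb leb).
  rewrite /S1 /S2 !lebesgue_measure_itv/= !lte_fin.
  rewrite !ifT; [|lra..].
  by rewrite -!EFinB -EFinM; congr EFin; ring.
have key : \forall t \near 0^'+, ((c / 2 * ((s + s) * (s + s)))%:E <= L1_dist (u ^~ t) u0)%E.
  near=> t.
  have t0 : 0 < t by near: t; exact: nbhs_right_gt.
  have ts : t < e by near: t; exact: nbhs_right_lt.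
  rewrite EFinM -vS -integral_cst//.
  have mf : measurable_fun setT (fun y : measurableTypeR R * measurableTypeR R =>
      (`|u y t - u0 y|)%:E).
    apply/measurable_EFinP; apply: continuous_measurable_plane => y.
    rewrite (_ : (fun y => _) = fun y => g (y, t)); last first.
      by apply/funext => y'; rewrite /g/= ubarE// ltW.
    apply: (@continuous_comp _ _ _ (fun y : R * R => (y, t)) g); last exact: cg.
    have p1 : (fun y : R * R => y) @ y --> y by exact: cvg_id.
    have p2 : (fun=> t : R) @ y --> t by exact: cvg_cst.
    exact: (cvg_pair p1 p2).
  apply: (@le_trans _ _ (\int[plane_measure]_(y in S1 `*` S2) (`|u y t - u0 y|)%:E)%E).
    apply: ge0_le_integral => //.
    - by move=> y _; rewrite lee_fin divr_ge0// ltW.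
    - exact: measurable_funTS.
    move=> y [y1 y2]; have {}y1 : y.1 \in `[x.1 - s, x.1 + s] by exact: y1.
    have {}y2 : y.2 \in `[x.2 - s, x.2 + s] by exact: y2.
    move: y1 y2; rewrite !in_itv/= => /andP[y11 y12] /andP[y21 y22]; rewrite lee_fin ltW//.
    have -> : `|u y t - u0 y| = g (y, t) by rewrite /g/= ubarE// ltW.
    apply: ge; rewrite -ball_normE/=; apply: (@le_lt_trans _ _ (Num.max s t)).
      apply/norm_spacetime; split => /=; rewrite le_max.
      + by apply/orP; left; rewrite ler_distl; apply/andP; split; lra.
      + by apply/orP; left; rewrite ler_distl; apply/andP; split; lra.
      + by apply/orP; right; rewrite sub0r normrN ger0_norm// ltW.
    by rewrite gt_max ts andbT /s; lra.
  exact: ge0_subset_integral.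
have := cvge_to_ge (pme_initial usol) key.
have pos : 0 < c / 2 * ((s + s) * (s + s)).
  by apply: mulr_gt0; [exact: divr_gt0|apply: mulr_gt0; exact: addr_gt0].
by rewrite lee_fin leNgt pos => /(_ _)/wrap[].
Unshelve. all: end_near. Qed.

End solution.

(** * Calculus in one variable *)

Section calculus.
Context {R : realType}.

(** Only one of the two points has to lie in the compact set: mollification leaves it. *)
Lemma heine (V : normedModType R) (K : set V) (f : V -> R) (e : R) :
  compact K -> continuous f -> 0 < e ->
  exists2 d, 0 < d & forall x y, K x -> `|x - y| < d -> `|f x - f y| < e.
Proof.
move=> cK cf e0.
have e2 : 0 < e / 2 by rewrite divr_gt0.
have /compact_near_coveringP nc := cK.
have := nc R (0 : R)^'+ (fun d x => forall y, `|x - y| < d -> `|f x - f y| < e) _.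
case=> //.
  move=> x Kx.
  have /nbhs_ballP[s /= s0 sx] : nbhs x (f @^-1` ball (f x) (e / 2)).
    by apply: (cf x); apply: nbhsx_ballx.
  have s2 : 0 < s / 2 by rewrite divr_gt0.
  exists (ball x (s / 2), [set d : R | d < s / 2]).
    by split => /=; [exact: nbhsx_ballx|exact: nbhs_right_lt].
  move=> [x' d] /= [xx' ds] y x'y.
  have fx' : `|f x - f x'| < e / 2.
    by apply: sx; rewrite -ball_normE/= in xx' *; lra.
  have fy : `|f x - f y| < e / 2.
    apply: sx; rewrite -ball_normE/= in xx' *.
    rewrite -(subrKA x') (le_lt_trans (ler_normD _ _))//.
    by rewrite (splitr s) ltrD// (lt_trans x'y).
  rewrite -(subrKA (f x)) (le_lt_trans (ler_normD _ _))//.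
  by rewrite (splitr e) distrC ltrD.
move=> d /= d0 H.
have d2 : 0 < d / 2 by rewrite divr_gt0.
exists (d / 2) => // x y Kx xy; apply: (H (d / 2)) => //=.
by rewrite sub0r normrN gtr0_norm// ltr_pdivrMr// ltr_pMr// ltrDl.
Qed.

Lemma is_derive_quotient (f : R -> R) (x df e : R) :
  is_derive x (1 : R) f df -> 0 < e ->
  exists2 d, 0 < d & forall h, h != 0 -> `|h| < d -> `|(f (h + x) - f x) / h - df| < e.
Proof.
move=> [fx <-] e0; have /cvgrPdist_lt/(_ e e0) := fx.
move=> /nbhs_ballP[d /= d0 H]; exists d => // h h0 hd.
have := H h; rewrite -ball_normE/= sub0r normrN => /(_ hd h0).
by rewrite distrC /derive -[_ *: _]/(_ * _) [h *: (1 : R)]mulr1 mulrC.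
Qed.

Lemma derive_left_max (f : R -> R) (a x df : R) : is_derive x (1 : R) f df ->
  a < x -> (forall y, a <= y <= x -> f y <= f x) -> 0 <= df.
Proof.
move=> fd ax H; rewrite leNgt; apply/negP => d0.
have nd0 : 0 < - df by rewrite oppr_gt0.
have [d dp D] := is_derive_quotient fd nd0.
pose h := - (Num.min (d / 2) (x - a)).
have hm : 0 < Num.min (d / 2) (x - a) by rewrite lt_min divr_gt0// subr_gt0.
have h0 : h < 0 by rewrite oppr_lt0.
have hd : `|h| < d.
  rewrite normrN gtr0_norm// gt_min; apply/orP; left.
  by rewrite ltr_pdivrMr// ltr_pMr// ltrDl.
have := D h (ltr0_neq0 h0) hd; rewrite ltr_distl => /andP[_].
rewrite subrr ltr_ndivrMr// mul0r ltNge subr_le0 H//.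
have hm2 : Num.min (d / 2) (x - a) <= x - a by rewrite ge_min lexx orbT.
by apply/andP; split; rewrite /h; lra.
Qed.

Lemma second_derivative_max (f f' : R -> R) (x d f'' : R) : 0 < d ->
  (forall y, is_derive y (1 : R) f (f' y)) -> is_derive x (1 : R) f' f'' ->
  (forall y, `|y - x| < d -> f y <= f x) -> f'' <= 0.
Proof.
move=> d0 D1 D2 H; rewrite leNgt; apply/negP => fpos.
have fx0 : f' x = 0.
  have h1 : forall t, t \in `]x - d, x + d[ -> derivable f t 1.
    by move=> t _; have [] := D1 t.
  have h2 : x \in `]x - d, x + d[ by rewrite in_itv/=; lra.
  have h3 : forall t, t \in `]x - d, x + d[ -> f t <= f x.
    by move=> t; rewrite in_itv/= => tI; apply: H; rewrite ltr_distlC; lra.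
  have h4 : x - d <= x + d by lra.
  by have [_ E] := derive1_at_max h4 h1 h2 h3; have [_ <-] := D1 x.
have [e e0 De] := is_derive_quotient D2 fpos.
pose h := Num.min (e / 2) (d / 2).
have h0 : 0 < h by rewrite lt_min !divr_gt0.
have xh : x < x + h by lra.
have [|c] := @MVT R f f' x (x + h) xh (fun t _ => D1 t).
  apply: continuous_subspaceT => t; apply: differentiable_continuous.
  by apply/derivable1_diffP; have [] := D1 t.
rewrite in_itv/= => /andP[xc ch] E.
have cx : c - x != 0 by rewrite subr_eq0 gt_eqF.
have hle : h <= e / 2 by rewrite ge_min lexx.
have hld : h <= d / 2 by rewrite ge_min lexx orbT.
have ce : `|c - x| < e by rewrite gtr0_norm; lra.
have := De _ cx ce; rewrite subrK fx0 subr0 ltr_distl subrr => /andP[+ _].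
rewrite ltr_pdivlMr ?mul0r; last lra.
move=> fc; have := H (x + h); rewrite addrC addKr gtr0_norm//.
have : 0 < f' c * (x + h - x) by rewrite mulr_gt0//; lra.
rewrite -E; lra.
Qed.

Lemma smooth1_bounded (g : R -> R) N : smooth1 g ->
  exists2 B, 0 <= B & forall s, `|s| <= N -> `|g s| <= B.
Proof.
move=> sg; have /compact_bounded[M [_ HM]] : compact (g @` `[- N, N]).
  apply: continuous_compact; last exact: segment_compact.
  by apply: continuous_subspaceT => x; exact: smooth1_continuous.
exists (`|M| + 1) => [|s sN]; first by rewrite addr_ge0.
apply: HM; first by rewrite (le_lt_trans (ler_norm M))// ltrDl.
by exists s => //=; rewrite in_itv/= -ler_norml.
Qed.

Lemma lipschitz_of_derive (g : R -> R) B : smooth1 g ->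
  (forall s, `|derive1 g s| <= B) -> forall s t, `|g s - g t| <= B * `|s - t|.
Proof.
move=> sg gB s t; wlog st : s t / s < t => [hw|].
  have [st|ts|->] := ltgtP s t; first exact: hw.
    by rewrite distrC [`|s - t|]distrC; exact: hw.
  by rewrite !subrr normr0 mulr0.
have D (x : R) : is_derive x (1 : R) g (derive1 g x).
  by rewrite derive1E; apply: derivableP; exact: smooth1_derivable.
have [|c _ E] := @MVT R g (derive1 g) s t st (fun x _ => D x).
  by apply: continuous_subspaceT => x; exact: smooth1_continuous.
by rewrite distrC E normrM [`|s - t|]distrC ler_wpM2r.
Qed.

End calculus.

(** * Mollification kernels *)

Section kernels.
Context {R : realType}.

(** The common form of the derivatives in [x], [y] and [t] of the integrals below. *)
Lemma is_derive_integral_shift (A C : R * R * R -> R) (l : R * R * R -> R)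
    (g : R -> R) (s N : R) :
  continuous A -> continuous C -> continuous l -> smooth1 g ->
  (forall x, s - 1 < x < s + 1 ->
     compactly_supported (fun z => A z * (g (l z - x) + C z)) N) ->
  is_derive s (1 : R) (fun x => I (fun z => A z * (g (l z - x) + C z)))
    (I (fun z => A z * - derive1 g (l z - s))).
Proof.
move=> cA cC cl sg H.
have [MA MA0 bA] := continuous_bounded_box N cA.
have [Ml Ml0 bl] := continuous_bounded_box N cl.
have [B B0 bB] := smooth1_bounded (Ml + (`|s| + 1)) (smooth1_derive sg).
have D (x y : R) : is_derive x (1 : R) (fun x => g (y - x)) (- derive1 g (y - x)).
  have h : is_derive (-1 * x + y) (1 : R) g (derive1 g (-1 * x + y)).
    by rewrite derive1E; apply: derivableP; exact: smooth1_derivable.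
  have := is_derive_affine h; rewrite mulN1r.
  rewrite (_ : (fun t : R => g (-1 * t + y)) = fun t => g (y - t)); last first.
    by apply/funext => t; rewrite mulN1r addrC.
  by rewrite mulN1r [- x + y]addrC.
apply: (@is_derive_integral R (fun x z => A z * (g (l z - x) + C z))
  (fun x z => A z * - derive1 g (l z - x)) (s - 1) (s + 1) s N (MA * B)).
- by apply/andP; split; lra.
- move=> x _ z; apply: cvgM; first exact: cA.
  apply: cvgD; last exact: cC.
  apply: (@continuous_comp _ _ _ (fun z => l z - x) g).
    by apply: cvgB; [exact: cl|exact: cvg_cst].
  exact: smooth1_continuous.
- move=> x z _.
  have := is_deriveZ (f := fun x : R => g (l z - x) + C z) (A z)
    (is_deriveD (D x (l z)) (is_derive_cst (C z) x 1)).
  by rewrite addr0.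
- exact: H.
- move=> x z /andP[x1 x2] zN; rewrite normrM normrN ler_pM//; first exact: bA.
  apply: bB; rewrite (le_trans (ler_normB _ _))// lerD//; first exact: bl.
  rewrite -[x](subrK s) (le_trans (ler_normD _ _))// addrC lerD// ltW//.
  by rewrite ltr_distlC; lra.
Qed.

Lemma continuous_x : continuous (fun z : R * R * R => z.1.1).
Proof. by move=> z; apply: differentiable_continuous; exact: coordinate_x.1. Qed.

Lemma continuous_y : continuous (fun z : R * R * R => z.1.2).
Proof. by move=> z; apply: differentiable_continuous; exact: coordinate_y.1. Qed.

Lemma continuous_t : continuous (fun z : R * R * R => z.2).
Proof. by move=> z; apply: differentiable_continuous; exact: coordinate_t.1. Qed.

Lemma continuous_shift (g : R -> R) (l : R * R * R -> R) a : smooth1 g ->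
  continuous l -> continuous (fun z => g (l z - a)).
Proof.
move=> sg cl z; apply: (@continuous_comp _ _ _ (fun z => l z - a) g).
  by apply: cvgB; [exact: cl|exact: cvg_cst].
exact: smooth1_continuous.
Qed.

Lemma smooth1_shift (g : R -> R) a : smooth1 g -> smooth1 (fun s => g (s - a)).
Proof.
move=> sg; rewrite (_ : (fun s => _) = fun s => g (1 * s + - a)).
  exact: smooth1_affine.
by apply/funext => s; rewrite mul1r.
Qed.

Lemma derive1_shift (g : R -> R) a s : smooth1 g ->
  derive1 (fun s => g (s - a)) s = derive1 g (s - a).
Proof.
move=> sg; rewrite (_ : (fun s => g (s - a)) = fun s => g (1 * s + - a)).
  by rewrite derive1_affine ?mul1r//; exact: smooth1_derivable.
by apply/funext => t; rewrite mul1r.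
Qed.

(** A smooth step from 1 to 0; differences of two such steps are smooth indicators of intervals. *)
Definition down (r s : R) : R := ramp r (- s).

Lemma smooth1_down r : 0 < r -> smooth1 (down r).
Proof.
move=> r0; rewrite (_ : down r = fun s => ramp r (-1 * s + 0)).
  exact/smooth1_affine/smooth1_ramp.
by apply/funext => s; rewrite /down mulN1r addr0.
Qed.

Lemma derive1_down r s : 0 < r -> derive1 (down r) s = - moll r s.
Proof.
move=> r0; rewrite (_ : down r = fun s => ramp r (-1 * s + 0)).
  rewrite derive1_affine; last exact/smooth1_derivable/smooth1_ramp.
  have [_ E] := is_derive_ramp (-1 * s + 0) r0.
  by rewrite derive1E E mulN1r addr0 mulN1r moll_even.
by apply/funext => t; rewrite /down mulN1r addr0.
Qed.

Definition kern (r x y t : R) (z : R * R * R) :=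
  moll r (z.1.1 - x) * moll r (z.1.2 - y) * moll r (z.2 - t).

Lemma moll_shift_out (r s a N : R) : 0 < r -> `|a| + r <= N -> N < `|s| -> moll r (s - a) = 0.
Proof.
move=> r0 aN Ns; apply: moll_out => //.
have := ler_normB s (s - a); rewrite opprB addrCA subrr addr0 => h.
have := ler_normD (s - a) a; rewrite subrK; lra.
Qed.

Lemma down_diff_out (r s a b : R) : 0 < r ->
  ~ (Num.min a b - r <= s <= Num.max a b + r) -> down r (s - a) - down r (s - b) = 0.
Proof.
move=> r0 /negP; rewrite negb_and -!ltNge => /orP[].
  rewrite ltrBrDr lt_min => /andP[h1 h2].
  by rewrite /down !ramp_ge ?subrr//; lra.
rewrite -ltrBrDr gt_max => /andP[h1 h2].
by rewrite /down !ramp_le ?subrr//; lra.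
Qed.

Lemma kernel_ge0 r x y t z : 0 < r -> 0 <= kern r x y t z.
Proof.
move=> r0; apply: mulr_ge0; last exact: moll_ge0.
by apply: mulr_ge0; exact: moll_ge0.
Qed.

Lemma cc_moll_product (d r x y t : R) : 0 < d -> 0 < r ->
  cc (fun z : R * R * R => moll d (z.1.1 - x) * moll d (z.1.2 - y) * moll r (z.2 - t)).
Proof.
move=> d0 r0; split.
  move=> z; apply: cvgM; first apply: cvgM.
  - exact: (continuous_shift (@smooth1_moll _ d) continuous_x).
  - exact: (continuous_shift (@smooth1_moll _ d) continuous_y).
  - exact: (continuous_shift (@smooth1_moll _ r) continuous_t).
pose N := `|x| + `|y| + `|t| + (d + r).
have [n1 n2 n3] : [/\ 0 <= `|x|, 0 <= `|y| & 0 <= `|t|] by split.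
have xN : `|x| + d <= N by rewrite /N; lra.
have yN : `|y| + d <= N by rewrite /N; lra.
have tN : `|t| + r <= N by rewrite /N; lra.
exists N => z Nz.
have [h1|h1] := ltP N `|z.1.1|; first by rewrite (moll_shift_out d0 xN h1) ?mul0r.
have [h2|h2] := ltP N `|z.1.2|; first by rewrite (moll_shift_out d0 yN h2) mulr0 mul0r.
have [h3|h3] := ltP N `|z.2|; first by rewrite (moll_shift_out r0 tN h3) mulr0.
by move: Nz; rewrite ltNge => /negP; case; exact/norm_spacetime.
Qed.

Lemma cc_kernel r x y t : 0 < r -> cc (kern r x y t).
Proof. by move=> r0; exact: cc_moll_product. Qed.

Lemma I_kernel r x y t : 0 < r -> I (kern r x y t) = 1.
Proof. by move=> r0; exact: I_moll. Qed.

Lemma kernel_average (w : R * R * R -> R) (r x y t c e : R) : 0 < r -> continuous w ->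
  (forall z : R * R * R, `|z.1.1 - x| < r -> `|z.1.2 - y| < r -> `|z.2 - t| < r ->
     `|w z - c| <= e) ->
  `|I (fun z => w z * kern r x y t z) - c| <= e.
Proof.
move=> r0 cw H.
have ck := cc_kernel x y t r0.
have cwk : cc (fun z => w z * kern r x y t z) by exact: ccM.
have K z : `|w z - c| * kern r x y t z <= e * kern r x y t z.
  have [h1|h1] := ltP `|z.1.1 - x| r; last by rewrite /kern moll_out// !mul0r !mulr0.
  have [h2|h2] := ltP `|z.1.2 - y| r.
    have [h3|h3] := ltP `|z.2 - t| r.
      by rewrite ler_wpM2r// ?kernel_ge0// H.
    by rewrite /kern [moll r (z.2 - t)]moll_out// !mulr0.
  by rewrite /kern [moll r (z.1.2 - y)]moll_out// !(mulr0, mul0r).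
have cI : c = I (fun z => c * kern r x y t z) by rewrite IM// I_kernel// mulr1.
have eI : e = I (fun z => e * kern r x y t z) by rewrite IM// I_kernel// mulr1.
rewrite ler_distl; apply/andP; split.
  rewrite [in leLHS]cI [in leLHS]eI -IB; [|exact: ccMl..].
  apply: I_le => //; first by apply: ccB; exact: ccMl.
  move=> z; have := K z; have := kernel_ge0 x y t z r0.
  have := ler_norm (c - w z); rewrite distrC; nra.
rewrite [in leRHS]cI [in leRHS]eI -ID; [|exact: ccMl..].
apply: I_le => //; first by apply: ccD; exact: ccMl.
move=> z; have := K z; have := kernel_ge0 x y t z r0.
have := ler_norm (w z - c); nra.
Qed.

End kernels.

Section slabs.
Context {R : realType}.
Implicit Types (a b : R -> R) (r x y t : R).

Definition vanish (r : R) (a : R -> R) := forall s, r < `|s| -> a s = 0.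

(** A smooth indicator of the time interval from [t0] to [t] on the vertical line over [(x, y)]. The
    factors [a] and [b] stand for the mollifier and for its derivatives. *)
Definition gslab a b r (t0 : R) x y t (z : R * R * R) : R :=
  a (z.1.1 - x) * b (z.1.2 - y) * (down r (z.2 - t) - down r (z.2 - t0)).

Lemma vanish_moll r : 0 < r -> vanish r (moll r).
Proof. by move=> r0 s rs; apply: moll_out => //; exact: ltW. Qed.

Lemma vanish_derive r a : vanish r a -> vanish r (fun s => - derive1 a s).
Proof. by move=> va s rs; rewrite (derive1_norm_out va rs) oppr0. Qed.

Lemma smooth1_oppderive a : smooth1 a -> smooth1 (fun s => - derive1 a s).
Proof.
move=> sa; rewrite (_ : (fun s => _) = fun s => cst (-1) s * derive1 a s).
  by apply: smooth1M; [exact: smooth1_cst|exact: smooth1_derive].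
by apply/funext => s; rewrite /= mulN1r.
Qed.

Lemma vanish_shift r a s x (N : R) : vanish r a -> `|x| + r <= N -> N < `|s| -> a (s - x) = 0.
Proof.
move=> va xN Ns; apply: va.
by have := ler_normD (s - x) x; rewrite subrK; lra.
Qed.

Lemma gslab_out a b r (t0 : R) x y t N : 0 < r -> vanish r a -> vanish r b ->
  `|x| + r <= N -> `|y| + r <= N -> `|t| + r <= N -> `|t0| + r <= N ->
  compactly_supported (gslab a b r t0 x y t) N.
Proof.
move=> r0 va vb xN yN tN t0N z Nz; rewrite /gslab.
have [h1|h1] := ltP N `|z.1.1|; first by rewrite (vanish_shift va xN h1) !mul0r.
have [h2|h2] := ltP N `|z.1.2|; first by rewrite (vanish_shift vb yN h2) mulr0 mul0r.
have [h3|h3] := ltP N `|z.2|.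
  rewrite down_diff_out ?mulr0// => /andP[b1 b2].
  have {}b1 : (t <= z.2 + r) || (t0 <= z.2 + r) by move: b1; rewrite lerBlDr ge_min.
  have {}b2 : (z.2 - r <= t) || (z.2 - r <= t0) by move: b2; rewrite -lerBlDr le_max.
  have := ler_norm t; have := ler_norm t0; have := ler_norm (- t); have := ler_norm (- t0).
  rewrite !normrN => n1 n2 n3 n4.
  move: h3; rewrite ltNge => /negP; apply; rewrite ler_norml.
  by apply/andP; split; [case/orP: b1|case/orP: b2] => ?; lra.
by move: Nz; rewrite ltNge => /negP; case; exact/norm_spacetime.
Qed.

Lemma continuous_gslab a b r (t0 : R) x y t : 0 < r -> smooth1 a -> smooth1 b ->
  continuous (gslab a b r t0 x y t).
Proof.
move=> r0 sa sb z; have sd := smooth1_down r0.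
apply: cvgM; first apply: cvgM.
- exact: (continuous_shift sa continuous_x).
- exact: (continuous_shift sb continuous_y).
- by apply: cvgB; exact: (continuous_shift sd continuous_t).
Qed.

Lemma cc_gslab a b r (t0 : R) x y t : 0 < r -> smooth1 a -> smooth1 b -> vanish r a ->
  vanish r b -> cc (gslab a b r t0 x y t).
Proof.
move=> r0 sa sb va vb; split; first exact: continuous_gslab.
exists (`|x| + `|y| + `|t| + `|t0| + r).
have := normr_ge0 x; have := normr_ge0 y; have := normr_ge0 t; have := normr_ge0 t0.
by move=> ? ? ? ?; apply: gslab_out => //; lra.
Qed.

Section derivatives.
Variable wm : R * R * R -> R.
Hypothesis cwm : continuous wm.
Variables (a b : R -> R) (r t0 : R).
Hypotheses (r0 : 0 < r) (sa : smooth1 a) (sb : smooth1 b).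
Hypotheses (va : vanish r a) (vb : vanish r b).

Let near_norm (s x : R) : s - 1 < x < s + 1 -> `|x| <= `|s| + 1.
Proof.
move=> /andP[h1 h2]; have := ler_norm s; have := ler_norm (- s); rewrite normrN ler_norml.
by move=> ? ?; apply/andP; split; lra.
Qed.

Let c0 : continuous (fun _ : R * R * R => 0 : R).
Proof. by move=> z; exact: cvg_cst. Qed.

Let ctime t : continuous (fun z : R * R * R => down r (z.2 - t) - down r (z.2 - t0)).
Proof.
move=> z; have sd := smooth1_down r0.
by apply: cvgB; exact: (continuous_shift sd continuous_t).
Qed.

Lemma is_derive_gslab_x x y t :
  is_derive x (1 : R) (fun x => I (fun z => wm z * gslab a b r t0 x y t z))
    (I (fun z => wm z * gslab (fun s => - derive1 a s) b r t0 x y t z)).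
Proof.
pose A z := wm z * (b (z.1.2 - y) * (down r (z.2 - t) - down r (z.2 - t0))).
have cA : continuous A.
  move=> z; apply: cvgM; first exact: cwm.
  by apply: cvgM; [exact: (continuous_shift sb continuous_y)|exact: ctime].
have E c x' : (fun z => wm z * gslab c b r t0 x' y t z) = fun z => A z * c (z.1.1 - x').
  by apply/funext => z; rewrite /gslab /A; ring.
under eq_fun do rewrite E.
rewrite E.
have := @is_derive_integral_shift R A (fun _ => 0) (fun z => z.1.1) a x
  (`|x| + 1 + `|y| + `|t| + `|t0| + r) cA c0 continuous_x sa.
under eq_fun do under eq_fun do rewrite addr0; apply.
move=> x' /near_norm x'1 z zN; rewrite addr0.
have -> : A z * a (z.1.1 - x') = wm z * gslab a b r t0 x' y t z by rewrite /A /gslab; ring.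
have := normr_ge0 x; have := normr_ge0 y; have := normr_ge0 t; have := normr_ge0 t0.
move=> ? ? ? ?; rewrite (gslab_out r0 va vb _ _ _ _ zN) ?mulr0//; lra.
Qed.

Lemma is_derive_gslab_y x y t :
  is_derive y (1 : R) (fun y => I (fun z => wm z * gslab a b r t0 x y t z))
    (I (fun z => wm z * gslab a (fun s => - derive1 b s) r t0 x y t z)).
Proof.
pose A z := wm z * (a (z.1.1 - x) * (down r (z.2 - t) - down r (z.2 - t0))).
have cA : continuous A.
  move=> z; apply: cvgM; first exact: cwm.
  by apply: cvgM; [exact: (continuous_shift sa continuous_x)|exact: ctime].
have E c y' : (fun z => wm z * gslab a c r t0 x y' t z) = fun z => A z * c (z.1.2 - y').
  by apply/funext => z; rewrite /gslab /A; ring.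
under eq_fun do rewrite E.
rewrite E.
have := @is_derive_integral_shift R A (fun _ => 0) (fun z => z.1.2) b y
  (`|x| + 1 + `|y| + `|t| + `|t0| + r) cA c0 continuous_y sb.
under eq_fun do under eq_fun do rewrite addr0; apply.
move=> y' /near_norm y'1 z zN; rewrite addr0.
have -> : A z * b (z.1.2 - y') = wm z * gslab a b r t0 x y' t z by rewrite /A /gslab; ring.
have := normr_ge0 x; have := normr_ge0 y; have := normr_ge0 t; have := normr_ge0 t0.
move=> ? ? ? ?; rewrite (gslab_out r0 va vb _ _ _ _ zN) ?mulr0//; lra.
Qed.

Lemma is_derive_gslab_t x y t :
  is_derive t (1 : R) (fun t => I (fun z => wm z * gslab a b r t0 x y t z))
    (I (fun z => wm z * (a (z.1.1 - x) * b (z.1.2 - y) * moll r (z.2 - t)))).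
Proof.
have sd := smooth1_down r0.
pose A z := wm z * (a (z.1.1 - x) * b (z.1.2 - y)).
pose C (z : R * R * R) := - down r (z.2 - t0).
have cA : continuous A.
  move=> z; apply: cvgM; first exact: cwm.
  by apply: cvgM; [exact: (continuous_shift sa continuous_x)|exact: (continuous_shift sb continuous_y)].
have cC : continuous C by move=> z; apply: cvgN; exact: (continuous_shift sd continuous_t).
have E t' : (fun z => wm z * gslab a b r t0 x y t' z) =
    fun z => A z * (down r (z.2 - t') + C z).
  by apply/funext => z; rewrite /gslab /A /C; ring.
under eq_fun do rewrite E.
have -> : (fun z => wm z * (a (z.1.1 - x) * b (z.1.2 - y) * moll r (z.2 - t))) =
    fun z => A z * - derive1 (down r) (z.2 - t).
  by apply/funext => z; rewrite derive1_down// opprK /A mulrA.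
apply: (@is_derive_integral_shift R A C (fun z => z.2) (down r) t
  (`|x| + 1 + `|y| + `|t| + `|t0| + r) cA cC continuous_t sd).
move=> t' /near_norm t'1 z zN.
have -> : A z * (down r (z.2 - t') + C z) = wm z * gslab a b r t0 x y t' z.
  by rewrite /A /gslab /C; ring.
have := normr_ge0 x; have := normr_ge0 y; have := normr_ge0 t; have := normr_ge0 t0.
move=> ? ? ? ?; rewrite (gslab_out r0 va vb _ _ _ _ zN) ?mulr0//; lra.
Qed.

End derivatives.

Lemma ramp_le1 r s : 0 < r -> 0 <= ramp r s <= 1.
Proof.
move=> r0; apply/andP; split.
  rewrite -(@ramp_le _ r (Num.min s (- r)))//; last by rewrite ge_min lexx orbT.
  by apply: ramp_homo => //; rewrite ge_min lexx.
rewrite -(@ramp_ge _ r (Num.max s r))//; last by rewrite le_max lexx orbT.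
by apply: ramp_homo => //; rewrite le_max lexx.
Qed.

Lemma vanish_bounded r a : vanish r a -> smooth1 a ->
  exists2 B, 0 <= B & forall s, `|a s| <= B.
Proof.
move=> va sa; have [B B0 bB] := smooth1_bounded r sa; exists B => // s.
have [h|h] := leP `|s| r; first exact: bB.
by rewrite va// normr0.
Qed.

Lemma gslab_lipschitz r (t0 : R) : 0 < r -> exists2 C, 0 <= C &
  forall x y t x' y' t' z, `|gslab (moll r) (moll r) r t0 x y t z -
    gslab (moll r) (moll r) r t0 x' y' t' z| <= C * (`|x - x'| + `|y - y'| + `|t - t'|).
Proof.
move=> r0; have sm := @smooth1_moll _ r; have vm := vanish_moll r0.
have [B B0 bB] := vanish_bounded vm sm.
have [B' B'0 bB'] := vanish_bounded (derive1_norm_out vm) (smooth1_derive sm).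
have L1 := lipschitz_of_derive sm bB'.
have L2 : forall s t, `|down r s - down r t| <= B * `|s - t|.
  apply: lipschitz_of_derive; first exact: smooth1_down.
  by move=> s; rewrite derive1_down// normrN.
have Q s s' : `|down r s - down r s'| <= 1.
  have /andP[h1 h2] := ramp_le1 (- s) r0; have /andP[h3 h4] := ramp_le1 (- s') r0.
  by rewrite /down ler_norml; apply/andP; split; lra.
exists (B' * B + B * B * B); first by rewrite addr_ge0// !mulr_ge0.
move=> x y t x' y' t' z; rewrite /gslab.
set a1 := moll r (z.1.1 - x); set a2 := moll r (z.1.1 - x').
set b1 := moll r (z.1.2 - y); set b2 := moll r (z.1.2 - y').
set c1 := down r (z.2 - t); set c2 := down r (z.2 - t'); set c := down r (z.2 - t0).
have -> : a1 * b1 * (c1 - c) - a2 * b2 * (c2 - c) =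
  (a1 - a2) * (b1 * (c1 - c)) + (b1 - b2) * (a2 * (c1 - c)) + (c1 - c2) * (a2 * b2) by ring.
have ha : `|a1 - a2| <= B' * `|x - x'|.
  by apply: (le_trans (L1 _ _)); rewrite ler_wpM2l// (_ : _ - _ - _ = x' - x) 1?distrC//; ring.
have hb : `|b1 - b2| <= B' * `|y - y'|.
  by apply: (le_trans (L1 _ _)); rewrite ler_wpM2l// (_ : _ - _ - _ = y' - y) 1?distrC//; ring.
have hc : `|c1 - c2| <= B * `|t - t'|.
  by apply: (le_trans (L2 _ _)); rewrite ler_wpM2l// (_ : _ - _ - _ = t' - t) 1?distrC//; ring.
rewrite (le_trans (ler_normD _ _))// (le_trans (lerD (ler_normD _ _) (lexx _)))//.
have e1 : `|(a1 - a2) * (b1 * (c1 - c))| <= B' * `|x - x'| * (B * 1).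
  rewrite normrM; apply: ler_pM => //; rewrite normrM; apply: ler_pM => //; [exact: bB|exact: Q].
have e2 : `|(b1 - b2) * (a2 * (c1 - c))| <= B' * `|y - y'| * (B * 1).
  rewrite normrM; apply: ler_pM => //; rewrite normrM; apply: ler_pM => //; [exact: bB|exact: Q].
have e3 : `|(c1 - c2) * (a2 * b2)| <= B * `|t - t'| * (B * B).
  by rewrite normrM; apply: ler_pM => //; rewrite normrM; apply: ler_pM => //; exact: bB.
have := normr_ge0 (x - x'); have := normr_ge0 (y - y'); have := normr_ge0 (t - t').
have p1 : 0 <= B' * B by exact: mulr_ge0.
have p2 : 0 <= B * B * B by rewrite !mulr_ge0.
set X := `|x - x'| in e1 *; set Y := `|y - y'| in e2 *; set T := `|t - t'| in e3 *.
move=> T0 Y0 X0.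
have q1 : 0 <= B * B * B * (X + Y) by rewrite mulr_ge0// addr_ge0.
have q2 : 0 <= B' * B * T by rewrite mulr_ge0.
apply: (le_trans (lerD (lerD e1 e2) e3)); rewrite -subr_ge0.
rewrite (_ : _ - _ = B * B * B * (X + Y) + B' * B * T); last by ring.
exact: addr_ge0.
Qed.

Lemma continuous_I_gslab (wm : R * R * R -> R) r (t0 : R) : continuous wm -> 0 < r ->
  continuous (fun p : R * R * R =>
    I (fun z => wm z * gslab (moll r) (moll r) r t0 p.1.1 p.1.2 p.2 z)).
Proof.
move=> cw r0 p; have [C C0 bC] := gslab_lipschitz t0 r0.
have sm := @smooth1_moll _ r; have vm := vanish_moll r0.
pose N := `|p| + 1 + `|t0| + r.
have t0N : `|t0| + r <= N by rewrite /N; have := normr_ge0 p; lra.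
have p'N' (s : R) : `|s| <= `|p| + 1 -> `|s| + r <= N by rewrite /N; have := normr_ge0 t0; lra.
have pN (s : R) : `|s| <= `|p| -> `|s| + r <= N by rewrite /N; have := normr_ge0 t0; lra.
have [W W0 bW] := continuous_bounded_box N cw.
have V0 : 0 <= volume N by rewrite /volume fine_ge0.
apply/cvgrPdist_le => e e0.
have d0 : 0 < e / (W * (C * 3) * volume N + 1).
  by rewrite divr_gt0// ltr_wpDl// !mulr_ge0.
near=> p'.
have pp' : `|p - p'| < e / (W * (C * 3) * volume N + 1).
  by near: p'; exact: cvgr_dist_lt.
have pp1 : `|p - p'| < 1 by near: p'; exact: cvgr_dist_lt.
have p'N : `|p'| <= `|p| + 1.
  rewrite -[p'](subrK p) addrC (le_trans (ler_normD _ _))// lerD2l.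
  by rewrite distrC ltW.
have [p11 p12 p2] := (norm_spacetime p `|p|).1 (lexx _).
have [p'11 p'12 p'2] := (norm_spacetime p' (`|p| + 1)).1 p'N.
have [q11 q12 q2] := (norm_spacetime (p - p') `|p - p'|).1 (lexx _).
have cg q : cc (gslab (moll r) (moll r) r t0 q.1.1 q.1.2 q.2) by exact: cc_gslab.
have cgw (q : R * R * R) : cc (fun z => wm z * gslab (moll r) (moll r) r t0 q.1.1 q.1.2 q.2 z).
  exact: ccM.
rewrite -IB//.
apply: (@le_trans _ _ (W * (C * (3 * `|p - p'|)) * volume N)).
  apply: I_bound.
  - by have [] := ccB (cgw p) (cgw p').
  - move=> z zN; rewrite (gslab_out r0 vm vm (pN _ p11) (pN _ p12) (pN _ p2) t0N zN).
    by rewrite (gslab_out r0 vm vm (p'N' _ p'11) (p'N' _ p'12) (p'N' _ p'2) t0N zN) !mulr0 subr0.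
  move=> z zN; rewrite -mulrBr normrM ler_pM//; first exact: bW.
  by apply: (le_trans (bC _ _ _ _ _ _ _)); rewrite ler_wpM2l//; move: q11 q12 q2 => /=; lra.
rewrite (_ : W * (C * (3 * `|p - p'|)) * volume N = (W * (C * 3) * volume N) * `|p - p'|); last ring.
have D0 : 0 <= W * (C * 3) * volume N by rewrite !mulr_ge0.
move: pp'; rewrite ltr_pdivlMr; last by rewrite ltr_wpDl.
by move=> h; rewrite mulrC; apply: ltW; apply: le_lt_trans h; rewrite ler_wpM2l// lerDl.
Unshelve. all: end_near. Qed.

End slabs.

(** * The mollified potential *)

Section comparison.
Context {R : realType}.

(** All that the comparison argument uses of the equation. The test functions live in positive
    times, since [th] vanishes off [[a, b]]. *)
Definition weak_pme (m : R) (w : R * R * R -> R) :=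
  forall (k1 k2 th : R -> R) (N a b : R),
  smooth1 k1 -> smooth1 k2 -> smooth1 th -> 0 < a ->
  (forall s, N < `|s| -> k1 s = 0) -> (forall s, N < `|s| -> k2 s = 0) ->
  (forall s, ~ (a <= s <= b) -> th s = 0) ->
  I (fun z => ppow m (w z) * (product_test (derive1 (derive1 k1)) k2 th z +
                      product_test k1 (derive1 (derive1 k2)) th z)) =
  - I (fun z => w z * product_test k1 k2 (derive1 th) z).

Variables (m : R) (w : R * R * R -> R).
Hypotheses (m1 : 1 < m) (cw : continuous w) (w0 : forall z, 0 <= w z).
Hypothesis ww : weak_pme m w.

Let wm z := ppow m (w z).

Let cwm : continuous wm.
Proof.
move=> z; apply: (@continuous_comp _ _ _ w (ppow m)); first exact: cw.
by apply: continuous_ppow; exact: lt_trans m1.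
Qed.

(** A mollification of [U (x, y, t)], the integral of [w ^ m] over the times between 0 and [t]. It is smooth
    although [w] is only continuous. Starting at time [2 * r] keeps the kernel in positive times. *)
Definition potential (r x y t : R) : R :=
  I (fun z => ppow m (w z) * gslab (moll r) (moll r) r (2 * r) x y t z).

Definition potential_xx (r x y t : R) : R := I (fun z => ppow m (w z) * gslab (derive1 (derive1 (moll r))) (moll r) r (2 * r) x y t z).
Definition potential_yy (r x y t : R) : R := I (fun z => ppow m (w z) * gslab (moll r) (derive1 (derive1 (moll r))) r (2 * r) x y t z).
Definition potential_x (r x y t : R) : R := I (fun z => ppow m (w z) * gslab (fun s => - derive1 (moll r) s) (moll r) r (2 * r) x y t z).
Definition potential_y (r x y t : R) : R := I (fun z => ppow m (w z) * gslab (moll r) (fun s => - derive1 (moll r) s) r (2 * r) x y t z).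

Let opp_derive2 (g : R -> R) : smooth1 g ->
  (fun s => - derive1 (fun s => - derive1 g s) s) = derive1 (derive1 g).
Proof.
move=> sg; apply/funext => s.
rewrite (_ : (fun s => - derive1 g s) = - derive1 g)//.
have sd := smooth1_derive sg.
by rewrite derive1E deriveN ?opprK -?derive1E//; exact: smooth1_derivable.
Qed.

Lemma potential_dx r x y t : 0 < r -> is_derive x (1 : R) (fun x => potential r x y t) (potential_x r x y t).
Proof.
move=> r0; have sm := @smooth1_moll _ r; have vm := vanish_moll r0.
exact: is_derive_gslab_x.
Qed.

Lemma potential_dy r x y t : 0 < r -> is_derive y (1 : R) (fun y => potential r x y t) (potential_y r x y t).
Proof.
move=> r0; have sm := @smooth1_moll _ r; have vm := vanish_moll r0.
exact: is_derive_gslab_y.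
Qed.

Lemma potential_dxx r x y t : 0 < r -> is_derive x (1 : R) (fun x => potential_x r x y t) (potential_xx r x y t).
Proof.
move=> r0; have sm := @smooth1_moll _ r; have vm := vanish_moll r0.
have := @is_derive_gslab_x R wm cwm _ (moll r) r (2 * r) r0 (smooth1_oppderive sm) sm
  (vanish_derive vm) vm x y t.
by rewrite (opp_derive2 sm).
Qed.

Lemma potential_dyy r x y t : 0 < r -> is_derive y (1 : R) (fun y => potential_y r x y t) (potential_yy r x y t).
Proof.
move=> r0; have sm := @smooth1_moll _ r; have vm := vanish_moll r0.
have := @is_derive_gslab_y R wm cwm (moll r) _ r (2 * r) r0 sm (smooth1_oppderive sm)
  vm (vanish_derive vm) x y t.
by rewrite (opp_derive2 sm).
Qed.

Lemma potential_dt r x y t : 0 < r -> is_derive t (1 : R) (potential r x y)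
  (I (fun z => wm z * kern r x y t z)).
Proof.
move=> r0; have sm := @smooth1_moll _ r; have vm := vanish_moll r0.
exact: is_derive_gslab_t.
Qed.

(** The equation integrated in time: the time derivative of the smooth indicator is a difference of
    two kernels, located at the two end points of the interval. *)
Lemma potential_laplacian r x y t : 0 < r -> 0 <= t ->
  potential_xx r x y (2 * r + t) + potential_yy r x y (2 * r + t) =
  I (fun z => w z * kern r x y (2 * r + t) z) - I (fun z => w z * kern r x y (2 * r) z).
Proof.
move=> r0 t0; have sm := @smooth1_moll _ r; have vm := vanish_moll r0.
pose t1 := 2 * r + t; pose d := down r.
have sd : smooth1 d by exact: smooth1_down.
pose th s := d (s - t1) + -1 * d (s - 2 * r).
have sth : smooth1 th.
  exact: smooth1D (@smooth1_shift _ _ t1 sd) (smooth1M (@smooth1_cst _ (-1)) (@smooth1_shift _ _ (2 * r) sd)).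
have dth s : derive1 th s = - moll r (s - t1) + moll r (s - 2 * r).
  have D c (e : R) : is_derive e (1 : R) (fun s => d (s - c)) (- moll r (e - c)).
    apply: (DeriveDef (smooth1_derivable (@smooth1_shift _ _ c sd))).
    by rewrite -derive1E (derive1_shift c e sd) (derive1_down _ r0).
  have [_ E] := is_deriveD (D t1 s) (is_deriveZ (-1) (D (2 * r) s)).
  rewrite derive1E [LHS]E; congr (_ + _).
  by rewrite -[_ *: _]/(_ * _) mulN1r opprK.
have vs a (N : R) : `|a| + r <= N -> forall s, N < `|s| -> moll r (s - a) = 0.
  by move=> aN s; exact: (vanish_shift vm aN).
pose N := `|x| + `|y| + r.
have xN : `|x| + r <= N by rewrite /N; have := normr_ge0 y; lra.
have yN : `|y| + r <= N by rewrite /N; have := normr_ge0 x; lra.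
have thout s : ~ (r <= s <= t1 + r) -> th s = 0.
  move=> h; rewrite /th mulN1r /d down_diff_out// => /andP[h1 h2]; apply: h.
  have e1 : Num.min t1 (2 * r) = 2 * r by apply: min_r; rewrite /t1; lra.
  have e2 : Num.max t1 (2 * r) = t1 by apply: max_l; rewrite /t1; lra.
  by move: h1 h2; rewrite e1 e2; lra.
have H := ww (@smooth1_shift _ _ x sm) (@smooth1_shift _ _ y sm) sth r0 (vs x N xN) (vs y N yN) thout.
pose k2 c := derive1 (derive1 (fun s => moll r (s - c))).
have d2 c s : k2 c s = derive1 (derive1 (moll r)) (s - c).
  rewrite /k2 (_ : derive1 (fun s => moll r (s - c)) = fun s => derive1 (moll r) (s - c)).
    by rewrite (derive1_shift c s (smooth1_derive sm)).
  by apply/funext => s'; rewrite (derive1_shift c s' sm).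
have sm2 := smooth1_derive (smooth1_derive sm).
have vm2 : vanish r (derive1 (derive1 (moll r))).
  by rewrite -(opp_derive2 sm); exact: vanish_derive (vanish_derive vm).
have cg1 : cc (fun z => wm z * gslab (derive1 (derive1 (moll r))) (moll r) r (2 * r) x y t1 z).
  by apply: ccM => //; exact: (cc_gslab _ _ _ _ r0 sm2 sm vm2 vm).
have cg2 : cc (fun z => wm z * gslab (moll r) (derive1 (derive1 (moll r))) r (2 * r) x y t1 z).
  by apply: ccM => //; exact: (cc_gslab _ _ _ _ r0 sm sm2 vm vm2).
rewrite /potential_xx /potential_yy -ID//.
have -> : (fun z => wm z * gslab (derive1 (derive1 (moll r))) (moll r) r (2 * r) x y t1 z +
    wm z * gslab (moll r) (derive1 (derive1 (moll r))) r (2 * r) x y t1 z) =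
    (fun z => ppow m (w z) * (product_test (k2 x) (fun s => moll r (s - y)) th z +
       product_test (fun s => moll r (s - x)) (k2 y) th z)).
  apply/funext => z; rewrite /product_test (d2 x) (d2 y) /gslab /th /wm -/d mulN1r.
  move: (derive1 (derive1 (moll r)) (z.1.1 - x)) (derive1 (derive1 (moll r)) (z.1.2 - y)) => p q.
  move: (moll r (z.1.1 - x)) (moll r (z.1.2 - y)) (d (z.2 - t1)) (d (z.2 - 2 * r)) => p' q' e e'.
  by ring.
apply: (etrans H).
have ck1 : cc (fun z => w z * kern r x y t1 z) by apply: ccM => //; exact: cc_kernel.
have ck2 : cc (fun z => w z * kern r x y (2 * r) z) by apply: ccM => //; exact: cc_kernel.
rewrite -IB// -IN; last first.
  rewrite (_ : (fun z => _) = fun z => w z * kern r x y (2 * r) z - w z * kern r x y t1 z).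
    exact: ccB.
  by apply/funext => z; rewrite /product_test dth /kern; ring.
by congr I; apply/funext => z; rewrite /product_test dth /kern; ring.
Qed.

End comparison.

(** * The comparison principle *)

Section distances.
Context {R : realType}.

Lemma kern_dist (x y s r : R) (z : R * R * R) : 0 < r -> `|z.1.1 - x| < r ->
  `|z.1.2 - y| < r -> `|z.2 - s| < 3 * r -> `|(x, y, s) - z| < 4 * r.
Proof.
move=> r0 h1 h2 h3; apply: (@le_lt_trans _ _ (3 * r)); last first.
  by rewrite ltr_pM2r// ltr_nat.
have r3 : r <= 3 * r by rewrite ler_peMl ?ler1n// ltW.
apply/norm_spacetime; split; rewrite distrC ltW//.
  exact: lt_le_trans h1 r3.
exact: lt_le_trans h2 r3.
Qed.

Lemma time_shift_dist (s a r : R) : `|s - (2 * r + a)| < r -> `|s - a| < 3 * r.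
Proof. by rewrite !ltr_norml => /andP[? ?]; apply/andP; split; lra. Qed.

Lemma third_bounds (eta : R) : 0 < eta -> 0 <= eta / 3 + eta / 3 < eta.
Proof. by move=> h; lra. Qed.

Lemma signed_laplacian_bound (sg A1 A0 D c c0 d : R) : sg = 1 \/ sg = -1 ->
  sg * (A1 - A0 - D) <= 0 -> `|A1 - c| <= d -> `|A0 - c0| <= d ->
  sg * (c - (D + c0)) <= d + d.
Proof.
by case=> -> h; rewrite !ler_norml => /andP[? ?] /andP[? ?]; lra.
Qed.

Lemma signed_speed_bound (sg A c F e d : R) : sg = 1 \/ sg = -1 ->
  e <= sg * (A - F) -> `|A - c| <= d -> e - d <= sg * (c - F).
Proof. by case=> -> h; rewrite !ler_norml => /andP[? ?]; lra. Qed.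

Lemma signed_ppow_bound (m sg c G d eta e : R) : sg = 1 \/ sg = -1 -> 0 <= m ->
  0 <= d < eta -> (forall y, `|c - y| < eta -> `|ppow m c - ppow m y| < e) ->
  sg * (c - G) <= d -> sg * (ppow m c - ppow m G) <= e.
Proof.
move=> sg1 m0 /andP[d0 de] H; case: sg1 => ->; rewrite ?mul1r ?mulN1r => cG.
  have h : ppow m (c - d) <= ppow m G by apply: ppow_homo => //; lra.
  have : `|ppow m c - ppow m (c - d)| < e.
    by apply: H; rewrite opprB addrCA subrr addr0 ger0_norm.
  by move=> /ltr_normlW; lra.
have h : ppow m G <= ppow m (c + d) by apply: ppow_homo => //; lra.
have : `|ppow m c - ppow m (c + d)| < e.
  by apply: H; rewrite opprD addrA subrr sub0r normrN ger0_norm.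
by rewrite distrC => /ltr_normlW; lra.
Qed.

Lemma signed_contradiction (sg P F Q e : R) : 0 < e -> sg = 1 \/ sg = -1 ->
  e - e / 4 <= sg * (P - F) -> 0 <= sg * (F - Q) -> sg * (P - Q) <= e / 4 -> False.
Proof. by move=> e0; case=> -> h1 h2 h3; lra. Qed.

End distances.

Section barrier.
Context {R : realType}.
Variables (m : R) (w : R * R * R -> R).
Hypotheses (m1 : 1 < m) (cw : continuous w) (w0 : forall z, 0 <= w z).
Hypothesis ww : weak_pme m w.

Let wm z := ppow m (w z).

Let cwm : continuous wm.
Proof.
move=> z; apply: (@continuous_comp _ _ _ w (ppow m)); first exact: cw.
by apply: continuous_ppow; exact: lt_trans m1.
Qed.

Variables (sg L T : R) (F Ft Fx Fxx Fy Fyy : R -> R -> R -> R).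
Hypotheses (sg1 : sg = 1 \/ sg = -1) (L0 : 0 < L) (T0 : 0 < T).
Hypothesis F0 : forall x y, F x y 0 = 0.
Hypothesis Fc : continuous (fun p : R * R * R => F p.1.1 p.1.2 p.2).
Hypothesis dFt : forall x y t, is_derive t (1 : R) (F x y) (Ft x y t).
Hypothesis dFx : forall x y t, is_derive x (1 : R) (fun x => F x y t) (Fx x y t).
Hypothesis dFxx : forall x y t, is_derive x (1 : R) (fun x => Fx x y t) (Fxx x y t).
Hypothesis dFy : forall x y t, is_derive y (1 : R) (fun y => F x y t) (Fy x y t).
Hypothesis dFyy : forall x y t, is_derive y (1 : R) (fun y => Fy x y t) (Fyy x y t).
Hypothesis Fbd : forall x y t, `|x| <= L -> `|y| <= L -> `|x| = L \/ `|y| = L ->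
  0 < t <= T -> 0 <= sg * (Ft x y t - ppow m (w (x, y, t))).
Hypothesis Fin : forall x y t, `|x| < L -> `|y| < L -> 0 < t <= T ->
  0 <= sg * (Ft x y t - ppow m (Fxx x y t + Fyy x y t + w (x, y, 0))).

Let J r (p : R * R * R) (e : R) :=
  sg * (potential m w r p.1.1 p.1.2 (2 * r + p.2) - F p.1.1 p.1.2 p.2) - e * p.2.

Let continuous_J r e : 0 < r -> continuous (fun p => J r p e).
Proof.
move=> r0 p; apply: cvgB; last first.
  by apply: cvgM; [exact: cvg_cst|exact: continuous_t].
apply: cvgM; first exact: cvg_cst.
apply: cvgB; last exact: Fc.
pose s (p : R * R * R) : R * R * R := (p.1, 2 * r + p.2).
have cs : s @ p --> s p.
  have c1 : (fun z : R * R * R => z.1) @ p --> p.1 by exact: cvg_fst.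
  have c2 : (fun z : R * R * R => 2 * r + z.2) @ p --> 2 * r + p.2.
    by apply: cvgD; [exact: cvg_cst|exact: continuous_t].
  exact: (cvg_pair c1 c2).
have H := @continuous_I_gslab R wm r (2 * r) cwm r0 (s p).
exact: (cvg_comp s _ cs H).
Qed.

Let J_time r x y t e : 0 < r -> 0 < t ->
  (forall s, 0 <= s <= t -> J r (x, y, s) e <= J r (x, y, t) e) ->
  e <= sg * (I (fun z => wm z * kern r x y (2 * r + t) z) - Ft x y t).
Proof.
move=> r0 t0 H; rewrite -subr_ge0.
suff D : is_derive t (1 : R) (fun s => J r (x, y, s) e)
    (sg * (I (fun z => wm z * kern r x y (2 * r + t) z) - Ft x y t) - e).
  exact: (derive_left_max D t0 H).
have D1 : is_derive t (1 : R) (fun s => potential m w r x y (2 * r + s))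
    (I (fun z => wm z * kern r x y (2 * r + t) z)).
  have D := is_derive_affine (@potential_dt R m w m1 cw r x y (1 * t + 2 * r) r0).
  rewrite (_ : (fun s => potential m w r x y (2 * r + s)) =
    fun s => potential m w r x y (1 * s + 2 * r)).
    by apply: (is_derive_eq D); rewrite mul1r mul1r addrC.
  by apply/funext => s; rewrite mul1r addrC.
have D2 := is_deriveB D1 (dFt x y t).
have D3 := is_deriveZ sg D2.
have D4 : is_derive t (1 : R) (fun s : R => e * s) e.
  have := is_deriveZ e (is_derive_id t (1 : R)).
  by rewrite -[e *: 1]/(e * 1) mulr1.
exact: (is_deriveB D3 D4).
Qed.

Let J_space r x y t e : 0 < r -> 0 <= t -> `|x| < L -> `|y| < L ->
  (forall x' y', `|x'| <= L -> `|y'| <= L -> J r (x', y', t) e <= J r (x, y, t) e) ->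
  sg * (I (fun z => w z * kern r x y (2 * r + t) z) -
    I (fun z => w z * kern r x y (2 * r) z) - (Fxx x y t + Fyy x y t)) <= 0.
Proof.
move=> r0 t0 xL yL H.
rewrite -(@potential_laplacian R m w m1 cw ww r x y t r0 t0).
have near_le (a b : R) : `|a - b| < L - `|b| -> `|a| <= L.
  by move=> ab; have := ler_normD (a - b) b; rewrite subrK; lra.
have DX x' : is_derive x' (1 : R) (fun s => J r (s, y, t) e)
    (sg * (potential_x m w r x' y (2 * r + t) - Fx x' y t)).
  have D3 := is_deriveZ sg (is_deriveB (@potential_dx R m w m1 cw r x' y (2 * r + t) r0) (dFx x' y t)).
  have := is_deriveB D3 (is_derive_cst (e * t) x' (1 : R)).
  by rewrite subr0.
have DY y' : is_derive y' (1 : R) (fun s => J r (x, s, t) e)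
    (sg * (potential_y m w r x y' (2 * r + t) - Fy x y' t)).
  have D3 := is_deriveZ sg (is_deriveB (@potential_dy R m w m1 cw r x y' (2 * r + t) r0) (dFy x y' t)).
  have := is_deriveB D3 (is_derive_cst (e * t) y' (1 : R)).
  by rewrite subr0.
have DXX := is_deriveZ sg (is_deriveB (@potential_dxx R m w m1 cw r x y (2 * r + t) r0) (dFxx x y t)).
have DYY := is_deriveZ sg (is_deriveB (@potential_dyy R m w m1 cw r x y (2 * r + t) r0) (dFyy x y t)).
have hx : sg * (potential_xx m w r x y (2 * r + t) - Fxx x y t) <= 0.
  apply: (@second_derivative_max R (fun s => J r (s, y, t) e) _ x (L - `|x|) _ _ DX DXX).
    by rewrite subr_gt0.
  by move=> x' /near_le x'L; apply: H => //; exact: ltW.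
have hy : sg * (potential_yy m w r x y (2 * r + t) - Fyy x y t) <= 0.
  apply: (@second_derivative_max R (fun s => J r (x, s, t) e) _ y (L - `|y|) _ _ DY DYY).
    by rewrite subr_gt0.
  by move=> y' /near_le y'L; apply: H => //; exact: ltW.
rewrite (_ : _ * _ = sg * (potential_xx m w r x y (2 * r + t) - Fxx x y t) +
   sg * (potential_yy m w r x y (2 * r + t) - Fyy x y t)); last by ring.
by rewrite -(addr0 0) lerD.
Qed.

(** The maximum principle for [U_t = (Delta U + w (., 0)) ^ m]; the sign [sg] treats barriers from
    above and from below together. At a maximum of [sg (U - F) - e t] at a positive time, the time
    derivative of [sg (U - F)] is at least [e] while the second derivatives in space are nonpositive.
    For small [r] mollification changes the values of [w] and of [w ^ m] by much less than [e], and
    the differential inequality [Fin] is contradicted. On the lateral boundary the first derivative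
    suffices, by [Fbd]. *)
Lemma comparison e : 0 < e -> exists2 r0, 0 < r0 & forall r, 0 < r < r0 ->
  forall x y t, `|x| <= L -> `|y| <= L -> 0 <= t <= T ->
  sg * (potential m w r x y (2 * r + t) - F x y t) <= e * t.
Proof.
move=> e0.
pose N := L + T + 1.
have LN : L <= N by rewrite /N; move: T0; lra.
have TN : T <= N by rewrite /N; move: L0; lra.
have [W W0 bW] := continuous_bounded_box N cw.
have e4 : 0 < e / 4 by rewrite divr_gt0.
have [eta eta0 Heta] := heine (@segment_compact R (- W) W) (continuous_ppow (lt_trans ltr01 m1)) e4.
have n3 : 0 < eta / 3 by rewrite divr_gt0.
have [d1 d10 Hw] := heine (@compact_box R N) cw n3.
have [d2 d20 Hwm] := heine (@compact_box R N) cwm e4.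
exists (Num.min 1 (Num.min d1 d2) / 4); first by rewrite divr_gt0// !lt_min ltr01 d10 d20.
move=> r /andP[r0]; rewrite ltr_pdivlMr// !lt_min => /and3P[r1 rd1 rd2].
pose Jr p := J r p e.
pose K : set (R * R * R) := (`[- L, L] `*` `[- L, L]) `*` `[0, T].
have cK : compact K.
  apply: compact_setX; last exact: segment_compact.
  by apply: compact_setX; exact: segment_compact.
have cJ : continuous Jr by exact: continuous_J.
have [p pK pmax] : exists2 p, p \in K & forall q, q \in K -> Jr q <= Jr p.
  apply: compact_EVT_max => //; last exact: continuous_subspaceT.
  by exists (0, 0, 0); split; [split|] => /=; rewrite in_itv/= ?lexx ?oppr_le0 ?ltW.
have KE (q : R * R * R) : q \in K <-> [/\ `|q.1.1| <= L, `|q.1.2| <= L & 0 <= q.2 <= T].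
  split=> [|[h1 h2 h3]].
    rewrite inE => -[[/=]]; rewrite !in_itv/= -!ler_norml => h1 h2 h3.
    by split.
  by rewrite inE; split; [split|] => /=; rewrite in_itv/= ?h3// -ler_norml.
suff Jp : Jr p <= 0.
  move=> x y t xL yL tT; have /pmax/le_trans/(_ Jp) : (x, y, t) \in K by apply/KE.
  by rewrite /Jr /J/= subr_le0.
have [pxL pyL /andP[pt0 ptT]] := (KE p).1 pK.
case: p pK pmax pxL pyL pt0 ptT => [[x y] t] /= pK pmax xL yL t0 tT.
move: t0; rewrite le_eqVlt => /predU1P[t0|t0].
  rewrite /Jr /J/= -t0 F0 addr0 subr0 mulr0 subr0 /potential.
  rewrite (_ : (fun z => _) = fun z => 0 * kern r x y 0 z).
    by rewrite IM ?mul0r ?mulr0//; exact: cc_kernel.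
  by apply/funext => z; rewrite /gslab subrr !mulr0 mul0r.
exfalso.
have time : e <= sg * (I (fun z => wm z * kern r x y (2 * r + t) z) - Ft x y t).
  apply: J_time => // s /andP[s0 st]; apply: (pmax (x, y, s)); apply/KE => /=.
  by rewrite xL yL s0 (le_trans st tT).
have tT' : 0 < t <= T by rewrite t0.
have xyN : `|((x, y), t)| <= N.
  apply/norm_spacetime; split; [exact: le_trans LN|exact: le_trans LN|].
  by rewrite /= gtr0_norm//; exact: le_trans TN.
have xyN0 : `|((x, y), 0 : R)| <= N.
  apply/norm_spacetime; split; [exact: le_trans LN|exact: le_trans LN|].
  by rewrite /= normr0; apply: le_trans LN; exact: ltW.
have avg_m : `|I (fun z => wm z * kern r x y (2 * r + t) z) - wm (x, y, t)| <= e / 4.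
  apply: kernel_average => // z h1 h2 h3; rewrite distrC ltW//; apply: Hwm => //.
  by apply: lt_trans rd2; rewrite mulrC; apply: kern_dist => //; exact: time_shift_dist.
have avg_1 : `|I (fun z => w z * kern r x y (2 * r + t) z) - w (x, y, t)| <= eta / 3.
  apply: kernel_average => // z h1 h2 h3; rewrite distrC ltW//; apply: Hw => //.
  by apply: lt_trans rd1; rewrite mulrC; apply: kern_dist => //; exact: time_shift_dist.
have avg_0 : `|I (fun z => w z * kern r x y (2 * r) z) - w (x, y, 0)| <= eta / 3.
  apply: kernel_average => // z h1 h2 h3; rewrite distrC ltW//; apply: Hw => //.
  by apply: lt_trans rd1; rewrite mulrC; apply: kern_dist => //; apply: time_shift_dist; rewrite addr0.
have Ft_wm : e - e / 4 <= sg * (wm (x, y, t) - Ft x y t).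
  exact: signed_speed_bound time avg_m.
have [bd|nbd] := pselect (`|x| = L \/ `|y| = L).
  have := Fbd xL yL bd tT'; rewrite -/(wm _) => FG.
  apply: (signed_contradiction e0 sg1 Ft_wm FG).
  by rewrite subrr mulr0 ltW.
have xL' : `|x| < L by rewrite lt_neqAle xL andbT; apply/eqP => h; apply: nbd; left.
have yL' : `|y| < L by rewrite lt_neqAle yL andbT; apply/eqP => h; apply: nbd; right.
have space : sg * (I (fun z => w z * kern r x y (2 * r + t) z) -
    I (fun z => w z * kern r x y (2 * r) z) - (Fxx x y t + Fyy x y t)) <= 0.
  apply: J_space => //; first exact: ltW.
  move=> x' y' x'L y'L; apply: (pmax (x', y', t)); apply/KE => /=.
  by rewrite x'L y'L tT ltW.
have := Fin xL' yL' tT'.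
set G := Fxx x y t + Fyy x y t + w (x, y, 0) => FG.
set c := w (x, y, t) in avg_1.
have cW : `[- W, W]%classic c by rewrite /= in_itv/= -ler_norml; exact: bW.
have cG : sg * (c - G) <= eta / 3 + eta / 3.
  exact: signed_laplacian_bound space avg_1 avg_0.
have ppc : sg * (ppow m c - ppow m G) <= e / 4.
  apply: (signed_ppow_bound sg1 _ _ (fun y => Heta c y cW) cG); first exact: ltW (lt_trans ltr01 m1).
  exact: third_bounds.
exact: (signed_contradiction e0 sg1 Ft_wm FG ppc).
Qed.

End barrier.

(** * From the potential to the support *)

Section potential_support.
Context {R : realType}.
Variables (m : R) (w : R * R * R -> R).
Hypotheses (m1 : 1 < m) (cw : continuous w) (w0 : forall z, 0 <= w z).

Let wm z := ppow m (w z).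

Let cwm : continuous wm.
Proof.
move=> z; apply: (@continuous_comp _ _ _ w (ppow m)); first exact: cw.
by apply: continuous_ppow; exact: lt_trans m1.
Qed.

(** The kernel of the potential is supported in the set described by the conclusion. *)
Lemma potential_pos_support r x y T : 0 < r -> 0 <= T -> 0 < potential m w r x y (2 * r + T) ->
  exists z : R * R * R, [/\ `|z.1.1 - x| < r, `|z.1.2 - y| < r, 0 < z.2,
    z.2 <= T + 3 * r & 0 < w z].
Proof.
move=> r0 T0; rewrite ltNge => /negP pos; apply: contrapT => nz; apply: pos.
rewrite /potential (_ : (fun z => _) = fun z => 0 * kern r x y 0 z).
  by rewrite IM ?mul0r//; exact: cc_kernel.
apply/funext => z; rewrite mul0r /gslab.
have [h1|h1] := ltP `|z.1.1 - x| r; last by rewrite moll_out// !mul0r mulr0.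
have [h2|h2] := ltP `|z.1.2 - y| r; last by rewrite [moll r (z.1.2 - y)]moll_out// mulr0 mul0r mulr0.
have [h3|h3] := pselect (Num.min (2 * r + T) (2 * r) - r <= z.2 <= Num.max (2 * r + T) (2 * r) + r); last first.
  by rewrite down_diff_out// !mulr0.
have {h3}[h3 h4] : r <= z.2 /\ z.2 <= T + 3 * r.
  move: h3; rewrite min_r ?max_l ?lerDl// => /andP[? ?]; split; lra.
have [wz|wz] := ltP 0 (w z); last first.
  by rewrite ppow_le0 ?mul0r// gt_eqF// (lt_trans ltr01).
by exfalso; apply: nz; exists z; split => //; exact: lt_le_trans h3.
Qed.

(** If [w] were positive at [(x, y, s)], the potential would stay above a bound that does not depend on
    [r]: around time [s] its kernel is a mollifier in space alone, which dominates a fixed multiple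
    of a mollifier of width [rho] in time. *)
Lemma potential_vanish x y T :
  (forall e, 0 < e -> exists2 r0, 0 < r0 & forall r, 0 < r < r0 ->
     potential m w r x y (2 * r + T) <= e * T) ->
  forall s, 0 < s < T -> w (x, y, s) = 0.
Proof.
move=> H s /andP[s0 sT]; apply/eqP; rewrite eq_le w0 andbT leNgt; apply/negP => ws.
have T0 : 0 < T := lt_trans s0 sT.
pose P := wm (x, y, s).
have P0 : 0 < P by rewrite /P /wm ppow_gt0E ?w0// powR_gt0.
have /nbhs_ballP[d /= d0 Hd] : nbhs (x, y, s) (wm @^-1` [set a | P / 2 < a]).
  have nP : nbhs P [set a | P / 2 < a].
    apply: open_nbhs_nbhs; split; first exact: open_gt.
    by rewrite /= ltr_pdivrMr// ltr_pMr// ltrDl.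
  exact: (cwm (x := (x, y, s)) nP).
pose rho := Num.min (d / 2) (Num.min (s / 2) (T - s)).
have rho0 : 0 < rho by rewrite !lt_min !divr_gt0//= subr_gt0.
have [rho1 rho2 rho3] : [/\ rho <= d / 2, rho <= s / 2 & rho <= T - s].
  by split; rewrite !ge_min lexx ?orbT.
have [B B0 bB] := vanish_bounded (vanish_moll rho0) (@smooth1_moll _ rho).
have B1 : 0 < B + 1 by rewrite ltr_wpDl.
(* The bound for the potential is [P / 2 / (B + 1)], where [B] bounds the mollifier in time. *)
pose e := P / 2 / (B + 1) / (2 * T).
have e0 : 0 < e by rewrite !divr_gt0// mulr_gt0.
have [r0 r00 Hr] := H e e0.
pose r := Num.min (r0 / 2) (Num.min (rho / 2) (s / 8)).
have rp : 0 < r by rewrite !lt_min !divr_gt0.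
have [rr0 rr1 rr2] : [/\ r <= r0 / 2, r <= rho / 2 & r <= s / 8].
  by split; rewrite !ge_min lexx ?orbT.
have rlt : 0 < r < r0.
  by rewrite rp (le_lt_trans rr0)// ltr_pdivrMr// ltr_pMr// ltrDl.
have := Hr r rlt; apply/negP; rewrite -ltNge.
have -> : e * T = P / 2 / (B + 1) / 2.
  by rewrite /e; field; rewrite !gt_eqF.
pose c := P / 2 / (B + 1).
have c0 : 0 < c by rewrite !divr_gt0.
apply: (@lt_le_trans _ _ c); first by rewrite ltr_pdivrMr// ltr_pMr// ltrDl.
pose K z := moll r (z.1.1 - x) * moll r (z.1.2 - y) * moll rho (z.2 - s).
have sm r := @smooth1_moll R r.
have cK : cc K by exact: cc_moll_product.
have -> : c = I (fun z => c * K z) by rewrite IM// /K I_moll// mulr1.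
apply: I_le; first exact: ccMl.
  by apply: ccM => //; apply: cc_gslab => //; exact: vanish_moll.
move=> z; rewrite /K /gslab -/(wm z).
have m0 a : 0 <= moll r a by exact: moll_ge0.
have br0 : 0 <= down r (z.2 - (2 * r + T)) - down r (z.2 - 2 * r).
  by rewrite subr_ge0; apply: ramp_homo => //; lra.
have wm0 : 0 <= wm z by exact: ppow_ge0.
have R0 : 0 <= wm z * (moll r (z.1.1 - x) * moll r (z.1.2 - y) *
    (down r (z.2 - (2 * r + T)) - down r (z.2 - 2 * r))).
  by apply: mulr_ge0 => //; apply: mulr_ge0 => //; exact: mulr_ge0.
have [h1|h1] := ltP `|z.1.1 - x| r; last first.
  by apply: le_trans R0; rewrite [moll r (z.1.1 - x)]moll_out// !mul0r mulr0.
have [h2|h2] := ltP `|z.1.2 - y| r; last first.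
  by apply: le_trans R0; rewrite [moll r (z.1.2 - y)]moll_out// mulr0 mul0r mulr0.
have [h3|h3] := ltP `|z.2 - s| rho; last first.
  by apply: le_trans R0; rewrite [moll rho (z.2 - s)]moll_out// !mulr0.
have /andP[h4 h5] : s - rho < z.2 < s + rho by rewrite -ltr_distl.
have -> : down r (z.2 - (2 * r + T)) = 1 by rewrite /down ramp_ge//; move: h5 rho3 rho2 rr2 rp; clear -m1 cw w0 cwm; lra.
have -> : down r (z.2 - 2 * r) = 0 by rewrite /down ramp_le//; move: h4 rho3 rho2 rr2 rp; clear -m1 cw w0 cwm; lra.
rewrite subr0 mulr1 mulrCA [leRHS]mulrC ler_wpM2l//; first exact: mulr_ge0.
have Hz : P / 2 <= wm z.
  apply: ltW; apply: Hd; rewrite -ball_normE /=.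
  apply: (@le_lt_trans _ _ rho); last by move: rho1 d0; clear -m1 cw w0 cwm; lra.
  have rrho : r <= rho by move: rr1 rho0; clear -m1 cw w0 cwm; lra.
  apply/norm_spacetime; split; rewrite distrC /= ltW//; exact: lt_le_trans rrho.
apply: le_trans Hz; rewrite /c mulrAC ler_pdivrMr// ler_wpM2l ?divr_ge0// ?(ltW P0)//.
by have := bB (z.2 - s) => /(le_trans (ler_norm _)); clear -m1 cw w0 cwm; lra.
Qed.

End potential_support.

(** * Supports do not shrink *)

Section retention.
Context {R : realType}.
Variables (m : R) (w : R * R * R -> R).
Hypotheses (m1 : 1 < m) (cw : continuous w) (w0 : forall z, 0 <= w z).
Hypothesis ww : weak_pme m w.

Let wm z := ppow m (w z).

Let cwm : continuous wm.
Proof.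
move=> z; apply: (@continuous_comp _ _ _ w (ppow m)); first exact: cw.
by apply: continuous_ppow; exact: lt_trans m1.
Qed.

Lemma ppow_le_linear (M a : R) : 0 <= a <= M -> ppow m a <= M `^ (m - 1) * a.
Proof.
move=> /andP[a0 aM]; rewrite ppow_gt0E// -mulr_powRB1//; last exact: lt_trans m1.
rewrite mulrC ler_wpM2r//; apply: ge0_ler_powR; rewrite ?nnegrE//; last exact: le_trans aM.
by rewrite subr_ge0 ltW.
Qed.

Let cc_exp_moll (lam d r x y s : R) : 0 < d -> 0 < r ->
  cc (fun z : R * R * R => w z * (moll d (z.1.1 - x) * moll d (z.1.2 - y) *
    (expR (lam * z.2) * moll r (z.2 - s)))).
Proof.
move=> d0 r0.
have cE : continuous (fun z : R * R * R => w z * expR (lam * z.2)).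
  move=> z; apply: cvgM; first exact: cw.
  apply: (@continuous_comp _ _ _ (fun z : R * R * R => lam * z.2) expR).
    by apply: cvgM; [exact: cvg_cst|exact: continuous_t].
  exact: continuous_expR.
rewrite (_ : (fun z => _) = fun z : R * R * R => (w z * expR (lam * z.2)) *
  (moll d (z.1.1 - x) * moll d (z.1.2 - y) * moll r (z.2 - s))).
  exact: ccM cE (cc_moll_product _ _ _ d0 r0).
by apply/funext => z; move: (moll d (z.1.1 - x)) (moll d (z.1.2 - y)) (moll r (z.2 - s)) (expR _) => a b c e; ring.
Qed.

(** The equation is tested with a bump in space times [expR (lam t)] on the interval from [s] to [t]. By
    [moll_derive2] the Laplacian of the bump is at least [- 36 / d ^+ 2] times the bump, and the growth
    of the exponential absorbs this loss as long as [w ^ m] is at most a multiple of [w]. *)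
Lemma retention_test d r x y s t lam : 0 < d -> 0 < r -> 0 < s - r -> s <= t ->
  (forall z : R * R * R, `|z.1.1 - x| <= d -> `|z.1.2 - y| <= d -> 0 <= z.2 <= t + r ->
     36 / d ^+ 2 * ppow m (w z) <= lam * w z) ->
  I (fun z => w z * (moll d (z.1.1 - x) * moll d (z.1.2 - y) *
     (expR (lam * z.2) * moll r (z.2 - s)))) <=
  I (fun z => w z * (moll d (z.1.1 - x) * moll d (z.1.2 - y) *
     (expR (lam * z.2) * moll r (z.2 - t)))).
Proof.
move=> d0 r0 sr st H.
pose k c a := moll d (a - c).
have sk c : smooth1 (k c) by exact: (@smooth1_shift _ _ c (@smooth1_moll _ d)).
pose up c a := ramp r (a - c).
have su c : smooth1 (up c) by exact: (@smooth1_shift _ _ c (smooth1_ramp r0)).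
pose ex a := expR (lam * a + 0).
have sex : smooth1 ex by exact: (@smooth1_affine _ _ lam 0 smooth1_expR).
pose th a := ex a * (up s a + -1 * up t a).
have sth : smooth1 th.
  exact: smooth1M sex (smooth1D (su s) (smooth1M (@smooth1_cst _ (-1)) (su t))).
have dth a : derive1 th a = lam * th a + ex a * (moll r (a - s) - moll r (a - t)).
  have Du c : is_derive a (1 : R) (up c) (moll r (a - c)).
    apply: (DeriveDef (smooth1_derivable (su c))).
    rewrite -derive1E (derive1_shift c a (smooth1_ramp r0)) derive1E.
    by have [_ ->] := is_derive_ramp (a - c) r0.
  have De : is_derive a (1 : R) ex (lam * ex a).
    exact: is_derive_affine (is_derive_expR (lam * a + 0)).
  have [_ E] := is_deriveM De (is_deriveD (Du s) (is_deriveZ (-1) (Du t))).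
  rewrite derive1E [LHS]E -![_ *: _]/(_ * _).
  by rewrite /th -[(up s + _) a]/(up s a + -1 * up t a); ring.
pose N := `|x| + `|y| + d.
have kN c : `|c| <= `|x| + `|y| -> forall a, N < `|a| -> k c a = 0.
  by move=> cN a; apply: moll_shift_out; rewrite // /N lerD2r.
have xN : `|x| <= `|x| + `|y| by rewrite lerDl.
have yN : `|y| <= `|x| + `|y| by rewrite lerDr.
have uple a : up t a <= up s a by apply: ramp_homo => //; rewrite lerD2l lerN2.
have thge a : 0 <= th a.
  by apply: mulr_ge0; [exact: expR_ge0|rewrite mulN1r subr_ge0].
have thout a : ~ (s - r <= a <= t + r) -> th a = 0.
  move=> /negP; rewrite negb_and -!ltNge => /orP[h|h]; rewrite /th mulN1r /up.
    have h' : a - s <= - r by rewrite lerBlDr addrC ltW.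
    have h'' : a - t <= - r by apply: le_trans h'; rewrite lerD2l lerN2.
    by rewrite !ramp_le// subrr mulr0.
  have h' : r <= a - t by rewrite lerBrDl ltW.
  have h'' : r <= a - s by apply: le_trans h' _; rewrite lerD2l lerN2.
  by rewrite !ramp_ge// subrr mulr0.
have E := ww (sk x) (sk y) sth sr (kN x xN) (kN y yN) thout.
have k2 c a : - (18 / d ^+ 2) * k c a <= derive1 (derive1 (k c)) a.
  rewrite /k (_ : derive1 (fun b => moll d (b - c)) = fun b => derive1 (moll d) (b - c)).
    rewrite (derive1_shift c a (smooth1_derive (@smooth1_moll _ d))).
    exact: moll_derive2.
  by apply/funext => b; rewrite (derive1_shift c b (@smooth1_moll _ d)).
have k2out c : `|c| <= `|x| + `|y| -> forall a, N < `|a| -> derive1 (derive1 (k c)) a = 0.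
  by move=> cN; apply: derive1_norm_out; apply: derive1_norm_out; exact: kN.
have ccf (f : R * R * R -> R) (c1 c2 c3 : R -> R) : continuous f -> smooth1 c1 -> smooth1 c2 -> smooth1 c3 ->
    (forall a, N < `|a| -> c1 a = 0) -> (forall a, N < `|a| -> c2 a = 0) ->
    (forall a, ~ (s - r <= a <= t + r) -> c3 a = 0) ->
    cc (fun z => f z * product_test c1 c2 c3 z).
  move=> cf s1 s2 s3 z1 z2 z3; apply: ccM cf _; split.
    exact: (continuous_product_test s1 s2 s3).
  exists (N + `|s| + `|t| + `|r|) => z Nz; rewrite /product_test.
  have n1 := normr_ge0 s; have n2 := normr_ge0 t; have n3 := normr_ge0 r.
  have n4 : 0 <= N by rewrite /N !addr_ge0// ltW.
  have [h1|h1] := ltP N `|z.1.1|; first by rewrite z1// !mul0r.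
  have [h2|h2] := ltP N `|z.1.2|; first by rewrite z2// mulr0 mul0r.
  rewrite z3 ?mulr0// => /andP[h3 h4].
  move: Nz; rewrite ltNge => /negP; apply; apply/norm_spacetime; split.
  - exact: le_trans h1 (ler_wpDr n3 (ler_wpDr n2 (ler_wpDr n1 (lexx N)))).
  - exact: le_trans h2 (ler_wpDr n3 (ler_wpDr n2 (ler_wpDr n1 (lexx N)))).
  have t3 : `|z.2| <= t + r by rewrite ger0_norm//; apply: le_trans h3; exact: ltW.
  apply: (le_trans t3); apply: lerD (ler_norm r).
  by apply: (le_trans (ler_norm t)); rewrite ler_wpDl// addr_ge0.
have c1 := ccf _ _ _ _ cw (sk x) (sk y) sth (kN x xN) (kN y yN) thout.
have sk2 c := smooth1_derive (smooth1_derive (sk c)).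
have c2 := ccf _ _ _ _ cwm (sk2 x) (sk y) sth (k2out x xN) (kN y yN) thout.
have c3 := ccf _ _ _ _ cwm (sk x) (sk2 y) sth (kN x xN) (k2out y yN) thout.
have LHS : - (lam * I (fun z => w z * product_test (k x) (k y) th z)) <=
    I (fun z => wm z * (product_test (derive1 (derive1 (k x))) (k y) th z +
       product_test (k x) (derive1 (derive1 (k y))) th z)).
  rewrite -IM// -IN; last exact: ccMl.
  apply: I_le.
  - exact: ccN (ccMl _ _).
  - rewrite (_ : (fun z => _) = fun z => wm z * product_test (derive1 (derive1 (k x))) (k y) th z +
       wm z * product_test (k x) (derive1 (derive1 (k y))) th z).
      exact: ccD.
    by apply/funext => z; rewrite mulrDr.
  move=> z; rewrite /product_test.
  have [/andP[z1 z2]|nz] := pselect (s - r <= z.2 <= t + r); last first.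
    by rewrite thout// !mulr0 addr0 mulr0 oppr0.
  have kx : 0 <= k x z.1.1 by exact: moll_ge0.
  have ky : 0 <= k y z.1.2 by exact: moll_ge0.
  have wz : 0 <= wm z by exact: ppow_ge0.
  have key : - lam * w z * (k x z.1.1 * k y z.1.2) <=
     wm z * (derive1 (derive1 (k x)) z.1.1 * k y z.1.2 + k x z.1.1 * derive1 (derive1 (k y)) z.1.2).
    have lap : - (36 / d ^+ 2) * (k x z.1.1 * k y z.1.2) <=
        derive1 (derive1 (k x)) z.1.1 * k y z.1.2 + k x z.1.1 * derive1 (derive1 (k y)) z.1.2.
      have := lerD (ler_wpM2r ky (k2 x z.1.1)) (ler_wpM2l kx (k2 y z.1.2)).
      by apply: le_trans; rewrite le_eqVlt; apply/orP; left; apply/eqP; ring.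
    apply: le_trans (ler_wpM2l wz lap).
    have [h1|h1] := leP `|z.1.1 - x| d; last first.
      by rewrite /k (moll_out d0 (ltW h1)) !mul0r !mulr0.
    have [h2|h2] := leP `|z.1.2 - y| d; last first.
      by rewrite /k [moll d (z.1.2 - y)](moll_out d0 (ltW h2)) !mulr0.
    have z02 : 0 <= z.2 <= t + r by rewrite z2 andbT; apply: le_trans z1; exact: ltW.
    rewrite (_ : wm z * _ = - (36 / d ^+ 2 * wm z) * (k x z.1.1 * k y z.1.2)); last by ring.
    apply: ler_wpM2r; first exact: mulr_ge0.
    by rewrite mulNr lerN2; exact: H.
  have := ler_wpM2r (thge z.2) key.
  move: (derive1 (derive1 (k x)) z.1.1) (derive1 (derive1 (k y)) z.1.2) => p q.
  move: (k x z.1.1) (k y z.1.2) (th z.2) (w z) (wm z) => kx' ky' e' v v' h.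
  rewrite (_ : - _ = - lam * v * (kx' * ky') * e'); last by ring.
  by apply: (le_trans h); rewrite le_eqVlt; apply/orP; left; apply/eqP; ring.
rewrite E in LHS; rewrite -subr_ge0.
have sdth := smooth1_derive sth.
have c4 := ccf _ _ _ _ cw (sk x) (sk y) sdth (kN x xN) (kN y yN) (derive1_itv_out thout).
have cm c := cc_exp_moll lam x y c d0 r0.
rewrite -IB//.
suff -> : (fun z => w z * (moll d (z.1.1 - x) * moll d (z.1.2 - y) * (expR (lam * z.2) * moll r (z.2 - t))) -
   w z * (moll d (z.1.1 - x) * moll d (z.1.2 - y) * (expR (lam * z.2) * moll r (z.2 - s)))) =
   fun z => lam * (w z * product_test (k x) (k y) th z) - w z * product_test (k x) (k y) (derive1 th) z.
  rewrite IB//; last exact: ccMl.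
  by rewrite IM//; move: LHS; rewrite lerN2 subr_ge0.
apply/funext => z; rewrite /product_test dth /ex addr0 /k.
move: (moll d (z.1.1 - x)) (moll d (z.1.2 - y)) (moll r (z.2 - s)) (moll r (z.2 - t)) (th z.2)
  (expR (lam * z.2)) => p1 p2 p3 p4 p5 p6; ring.
Qed.

Let exp_moll_le (lam d r x y s c : R) : 0 < d -> 0 < r ->
  (forall z : R * R * R, `|z.1.1 - x| < d -> `|z.1.2 - y| < d -> `|z.2 - s| < r ->
     w z * expR (lam * z.2) <= c) ->
  I (fun z => w z * (moll d (z.1.1 - x) * moll d (z.1.2 - y) *
    (expR (lam * z.2) * moll r (z.2 - s)))) <= c.
Proof.
move=> d0 r0 H; have cK := cc_moll_product x y s d0 r0.
have -> : c = I (fun z => c * (moll d (z.1.1 - x) * moll d (z.1.2 - y) * moll r (z.2 - s))).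
  by rewrite IM// I_moll// mulr1.
apply: I_le; [exact: cc_exp_moll|exact: ccMl|move=> z].
have [h1|h1] := ltP `|z.1.1 - x| d; last by rewrite moll_out// !(mul0r, mulr0).
have [h2|h2] := ltP `|z.1.2 - y| d; last by rewrite [moll d (z.1.2 - y)]moll_out// !(mul0r, mulr0).
have [h3|h3] := ltP `|z.2 - s| r; last by rewrite [moll r (z.2 - s)]moll_out// !(mul0r, mulr0).
have p1 : 0 <= moll d (z.1.1 - x) * moll d (z.1.2 - y) * moll r (z.2 - s).
  by apply: mulr_ge0; [apply: mulr_ge0|]; exact: moll_ge0.
have := ler_wpM2r p1 (H z h1 h2 h3); apply: le_trans.
rewrite le_eqVlt; apply/orP; left; apply/eqP.
by move: (moll d (z.1.1 - x)) (moll d (z.1.2 - y)) (moll r (z.2 - s)) => a b e; ring.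
Qed.

Let exp_moll_ge (lam d r x y s c : R) : 0 < d -> 0 < r ->
  (forall z : R * R * R, `|z.1.1 - x| < d -> `|z.1.2 - y| < d -> `|z.2 - s| < r ->
     c <= w z * expR (lam * z.2)) ->
  c <= I (fun z => w z * (moll d (z.1.1 - x) * moll d (z.1.2 - y) *
    (expR (lam * z.2) * moll r (z.2 - s)))).
Proof.
move=> d0 r0 H; have cK := cc_moll_product x y s d0 r0.
have -> : c = I (fun z => c * (moll d (z.1.1 - x) * moll d (z.1.2 - y) * moll r (z.2 - s))).
  by rewrite IM// I_moll// mulr1.
apply: I_le; [exact: ccMl|exact: cc_exp_moll|move=> z].
have [h1|h1] := ltP `|z.1.1 - x| d; last by rewrite moll_out// !(mul0r, mulr0).
have [h2|h2] := ltP `|z.1.2 - y| d; last by rewrite [moll d (z.1.2 - y)]moll_out// !(mul0r, mulr0).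
have [h3|h3] := ltP `|z.2 - s| r; last by rewrite [moll r (z.2 - s)]moll_out// !(mul0r, mulr0).
have p1 : 0 <= moll d (z.1.1 - x) * moll d (z.1.2 - y) * moll r (z.2 - s).
  by apply: mulr_ge0; [apply: mulr_ge0|]; exact: moll_ge0.
apply: (le_trans (ler_wpM2r p1 (H z h1 h2 h3))).
rewrite le_eqVlt; apply/orP; left; apply/eqP.
by move: (moll d (z.1.1 - x)) (moll d (z.1.2 - y)) (moll r (z.2 - s)) => a b e; ring.
Qed.

(** If [w] vanished around [(x, y)] at time [t], its weighted average there would be small at time [t],
    whereas by [retention_test] it is at least the average around [(x, y, s)]. *)
Lemma support_retained (x y s t rho : R) : 0 < s -> s <= t -> 0 < rho -> 0 < w (x, y, s) ->
  exists x' y', [/\ `|x' - x| < rho, `|y' - y| < rho & 0 < w (x', y', t)].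
Proof.
move=> s0 st rho0 ws; apply: contrapT => nex.
pose c := w (x, y, s) / 2.
have c0 : 0 < c by rewrite divr_gt0.
have /nbhs_ballP[d1 /= d10 Hd] : nbhs (x, y, s) (w @^-1` [set a | c < a]).
  have nP : nbhs (w (x, y, s)) [set a | c < a].
    apply: open_nbhs_nbhs; split; first exact: open_gt.
    by rewrite /= ltr_pdivrMr// ltr_pMr// ltrDl.
  exact: (cw (x := (x, y, s)) nP).
pose d := Num.min (rho / 2) (d1 / 2).
have d0 : 0 < d by rewrite lt_min !divr_gt0.
have [dr dd] : d < rho /\ d < d1.
  by split; rewrite gt_min; apply/orP; [left|right]; rewrite ltr_pdivrMr// ltr_pMr// ltrDl.
have t0 : 0 < t := lt_le_trans s0 st.
pose N := `|x| + `|y| + d + (t + 1).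
have NxyT : [/\ `|x| + d <= N, `|y| + d <= N & t + 1 <= N].
  by rewrite /N; have := normr_ge0 x; have := normr_ge0 y; move=> ? ?; split; lra.
have inbox (z : R * R * R) (a : R) : 0 <= a -> a <= 1 -> `|z.1.1 - x| <= d -> `|z.1.2 - y| <= d ->
    0 <= z.2 <= t + a -> `|z| <= N.
  case: NxyT => N1 N2 N3 a0 a1 h1 h2 /andP[h3 h4]; apply/norm_spacetime; split.
  - rewrite -[z.1.1](subrK x) addrC; apply: le_trans N1.
    by rewrite (le_trans (ler_normD _ _))// lerD2l.
  - rewrite -[z.1.2](subrK y) addrC; apply: le_trans N2.
    by rewrite (le_trans (ler_normD _ _))// lerD2l.
  - by rewrite ger0_norm//; apply: le_trans N3; apply: (le_trans h4); rewrite lerD2l.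
have [M M0 bM] := continuous_bounded_box N cw.
(* Since [w <= M] on the box, [w ^ m <= M ^ (m - 1) w] there. *)
pose lam := 36 / d ^+ 2 * M `^ (m - 1).
have lam0 : 0 <= lam by rewrite mulr_ge0 ?powR_ge0// divr_ge0// sqr_ge0.
(* By uniform continuity the average at time [t] is at most [c / 2], in spite of the exponential. *)
pose eta := c / 2 / expR (lam * (t + 1)).
have eta0 : 0 < eta by rewrite !divr_gt0// expR_gt0.
have [d2 d20 Hw] := heine (@compact_box R N) cw eta0.
pose r := Num.min (d2 / 2) (Num.min (d / 2) (Num.min (s / 2) (1 / 2))).
have r0 : 0 < r by rewrite !lt_min !divr_gt0.
have [r1 r2 r3 r4] : [/\ r < d2, r < d, r < s & r < 1].
  have half (a : R) : 0 < a -> a / 2 < a by move=> a0; rewrite ltr_pdivrMr// ltr_pMr// ltrDl.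
  by split; rewrite !gt_min !half ?orbT.
have sr : 0 < s - r by rewrite subr_gt0.
have := @retention_test d r x y s t lam d0 r0 sr st.
have cond : forall z : R * R * R, `|z.1.1 - x| <= d -> `|z.1.2 - y| <= d -> 0 <= z.2 <= t + r ->
    36 / d ^+ 2 * ppow m (w z) <= lam * w z.
  move=> z h1 h2 h3; rewrite (_ : lam * w z = 36 / d ^+ 2 * (M `^ (m - 1) * w z)); last by rewrite mulrA.
  apply: ler_wpM2l; first by apply: divr_ge0 => //; exact: sqr_ge0.
  apply: ppow_le_linear; rewrite w0 /=.
  exact: le_trans (ler_norm _) (bM z (inbox z r (ltW r0) (ltW r4) h1 h2 h3)).
move=> /(_ cond); apply/negP; rewrite -ltNge.
apply: (@le_lt_trans _ _ (c / 2)).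
  apply: exp_moll_le => // z h1 h2 h3.
  move: (h3); rewrite ltr_distl => /andP[h4 h5].
  have z20 : 0 <= z.2 by apply: ltW (lt_trans sr (le_lt_trans _ h4)); rewrite lerD2r.
  have wt : w (z.1.1, z.1.2, t) = 0.
    apply/eqP; rewrite eq_le w0 andbT leNgt; apply/negP => wt; apply: nex.
    by exists z.1.1, z.1.2; split => //; [exact: lt_trans h1 dr|exact: lt_trans h2 dr].
  have bt : box N (z.1.1, z.1.2, t).
    by apply: (inbox _ 0) => //=; [exact: ltW|exact: ltW|rewrite addr0 lexx ltW].
  have := Hw (z.1.1, z.1.2, t) z bt; rewrite wt sub0r normrN => /(_ _)/wrap[].
    apply: le_lt_trans r1; apply/norm_spacetime; split => /=.
    - by rewrite subrr normr0 ltW.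
    - by rewrite subrr normr0 ltW.
    - by rewrite distrC ltW.
  move=> /ltr_normlW wz.
  rewrite (_ : c / 2 = eta * expR (lam * (t + 1))); last by rewrite /eta divfK// gt_eqF// expR_gt0.
  apply: ler_pM; [exact: w0|exact: expR_ge0|exact: ltW|].
  rewrite ler_expR ler_wpM2l// ltW// (lt_trans h5)// ltrD2l//.
apply: (@lt_le_trans _ _ c); first by rewrite ltr_pdivrMr// ltr_pMr// ltrDl.
apply: exp_moll_ge => // z h1 h2 h3.
move: (h3); rewrite ltr_distl => /andP[h4 h5].
have z20 : 0 <= z.2 := ltW (lt_trans sr h4).
have wz : c <= w z.
  apply: ltW; apply: Hd; rewrite -ball_normE /=; apply: le_lt_trans dd.
  by apply/norm_spacetime; split; rewrite distrC ltW//; apply: lt_trans h3 r2.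
rewrite -[c]mulr1; apply: ler_pM => //; first exact: ltW.
by rewrite -expR0 ler_expR mulr_ge0.
Qed.

End retention.

(** * Moving paraboloids *)

Section truncated_powers.
Context {R : realType}.

Lemma is_derive_square (a b c x : R) :
  is_derive x (1 : R) (fun s => a * s ^+ 2 + b * s + c) (2 * a * x + b).
Proof.
apply: (@is_derive_quadratic _ _ _ _ `|a|) => h.
rewrite (_ : _ - _ = a * h ^+ 2); last by ring.
by rewrite normrM [`|h ^+ 2|]ger0_norm// sqr_ge0.
Qed.

Lemma is_derive_line (b c x : R) : is_derive x (1 : R) (fun s => b * s + c) b.
Proof.
have := is_derive_square 0 b c x; rewrite mulr0 mul0r add0r.
by congr is_derive; apply/funext => s; rewrite mul0r add0r.
Qed.

Lemma is_derive_ppow_comp (p : R) (g : R -> R) (x dg : R) : 1 < p ->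
  is_derive x (1 : R) g dg ->
  is_derive x (1 : R) (fun s => ppow p (g s)) (p * ppow (p - 1) (g x) * dg).
Proof.
move=> p1 Dg; have := @is_derive1_comp R (ppow p) g x _ _ (is_derive_ppow (g x) p1) Dg.
by [].
Qed.

Lemma is_derive_ppow_primitive (q : R) (g : R -> R) (x dg : R) : 1 < q ->
  is_derive x (1 : R) g dg ->
  is_derive x (1 : R) (fun s => ppow (q + 1) (g s) / (q + 1)) (ppow q (g x) * dg).
Proof.
move=> q1 Dg; have q1' : 1 < q + 1 by rewrite ltrDr (lt_trans ltr01).
have := is_deriveZ (q + 1)^-1 (is_derive_ppow_comp q1' Dg).
rewrite addrK (_ : _ *: _ = ppow q (g x) * dg).
  by congr is_derive; apply/funext => s; rewrite mulrC.
rewrite -[LHS]/(_ * _) !mulrA mulVf ?mul1r//.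
by rewrite gt_eqF// (lt_trans ltr01).
Qed.

Lemma is_derive_ppow_slope (q : R) (g dg : R -> R) (x ddg : R) : 1 < q ->
  is_derive x (1 : R) g (dg x) -> is_derive x (1 : R) dg ddg ->
  is_derive x (1 : R) (fun s => ppow q (g s) * dg s)
    (q * ppow (q - 1) (g x) * dg x ^+ 2 + ppow q (g x) * ddg).
Proof.
move=> q1 Dg Ddg; apply: (is_derive_eq (is_deriveM (is_derive_ppow_comp q1 Dg) Ddg)).
rewrite -![_ *: _]/(_ * _); move: (ppow _ _) (ppow _ _) => a b; ring.
Qed.

End truncated_powers.

Section barrier_function.
Context {R : realType}.
Variables (m lam c kap x0 y0 B : R).
Hypothesis m1 : 1 < m.

(** The exponent for which [u ^ m] is a multiple of the power [q] of the pressure. *)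
Definition conjugate : R := m / (m - 1).
Local Notation q := conjugate.

Lemma conjugate_gt1 : 1 < q.
Proof. by rewrite /q ltr_pdivlMr ?subr_gt0// mul1r ltrBlDr ltrDl. Qed.

(** A perturbation of [y - y0] for which the squared gradient [1 + 4 kap front] and the Laplacian
    [4 kap] are functions of [front] itself. *)
Definition front (x y : R) : R := (y - y0) + kap * ((x - x0) ^+ 2 + (y - y0) ^+ 2).
Definition moving (x y t : R) : R := (1 + lam * t) * front x y + c * t.
(** If the pressure were a multiple of [moving], then [u ^ m] would be a multiple of its power [q], and
    the integral of [u ^ m] over time would be a multiple of the increase of the power [q + 1]. *)
Definition barrier (x y t : R) : R :=
  B * (ppow (q + 1) (moving x y t) / (q + 1) - ppow (q + 1) (front x y) / (q + 1)).
Definition front_x (x : R) : R := 2 * kap * (x - x0).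
Definition front_y (y : R) : R := 1 + 2 * kap * (y - y0).
Definition barrier_t (x y t : R) : R := B * (ppow q (moving x y t) * (lam * front x y + c)).
Definition barrier_x (x y t : R) : R :=
  B * (ppow q (moving x y t) * ((1 + lam * t) * front_x x) - ppow q (front x y) * front_x x).
Definition barrier_y (x y t : R) : R :=
  B * (ppow q (moving x y t) * ((1 + lam * t) * front_y y) - ppow q (front x y) * front_y y).
Definition barrier_xx (x y t : R) : R :=
  B * (q * ppow (q - 1) (moving x y t) * ((1 + lam * t) * front_x x) ^+ 2 +
       ppow q (moving x y t) * ((1 + lam * t) * (2 * kap)) -
       (q * ppow (q - 1) (front x y) * front_x x ^+ 2 + ppow q (front x y) * (2 * kap))).
Definition barrier_yy (x y t : R) : R :=
  B * (q * ppow (q - 1) (moving x y t) * ((1 + lam * t) * front_y y) ^+ 2 +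
       ppow q (moving x y t) * ((1 + lam * t) * (2 * kap)) -
       (q * ppow (q - 1) (front x y) * front_y y ^+ 2 + ppow q (front x y) * (2 * kap))).

Let is_derive_front_x x y : is_derive x (1 : R) (front^~ y) (front_x x).
Proof.
have := is_derive_square kap (- (2 * kap * x0)) ((y - y0) + kap * (x0 ^+ 2 + (y - y0) ^+ 2)) x.
rewrite (_ : 2 * kap * x + _ = front_x x); last by rewrite /front_x; ring.
by congr is_derive; apply/funext => s; rewrite /front; ring.
Qed.

Let is_derive_front_y x y : is_derive y (1 : R) (front x) (front_y y).
Proof.
have := is_derive_square kap (1 - 2 * kap * y0) (- y0 + kap * ((x - x0) ^+ 2 + y0 ^+ 2)) y.
rewrite (_ : 2 * kap * y + _ = front_y y); last by rewrite /front_y; ring.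
by congr is_derive; apply/funext => s; rewrite /front; ring.
Qed.

Let is_derive_moving_x x y t :
  is_derive x (1 : R) (fun x => moving x y t) ((1 + lam * t) * front_x x).
Proof.
have := is_deriveD (is_deriveZ (1 + lam * t) (is_derive_front_x x y)) (is_derive_cst (c * t) x (1 : R)).
by rewrite addr0; congr is_derive; apply/funext.
Qed.

Let is_derive_moving_y x y t :
  is_derive y (1 : R) (fun y => moving x y t) ((1 + lam * t) * front_y y).
Proof.
have := is_deriveD (is_deriveZ (1 + lam * t) (is_derive_front_y x y)) (is_derive_cst (c * t) y (1 : R)).
by rewrite addr0; congr is_derive; apply/funext.
Qed.

Let is_derive_moving_t x y t : is_derive t (1 : R) (moving x y) (lam * front x y + c).
Proof.
have := is_derive_line (lam * front x y + c) (front x y) t.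
by congr is_derive; apply/funext => s; rewrite /moving; ring.
Qed.

Let is_derive_front_xx x : is_derive x (1 : R) front_x (2 * kap).
Proof.
have := is_derive_line (2 * kap) (- (2 * kap * x0)) x.
by congr is_derive; apply/funext => s; rewrite /front_x; ring.
Qed.

Let is_derive_front_yy x : is_derive x (1 : R) front_y (2 * kap).
Proof.
have := is_derive_line (2 * kap) (1 - 2 * kap * y0) x.
by congr is_derive; apply/funext => s; rewrite /front_y; ring.
Qed.

Let is_derive_scaled (f : R -> R) (a df x : R) : is_derive x (1 : R) f df ->
  is_derive x (1 : R) (fun s => a * f s) (a * df).
Proof. exact: is_deriveZ. Qed.

Lemma is_derive_barrier_t x y t : is_derive t (1 : R) (barrier x y) (barrier_t x y t).
Proof.
apply: is_derive_scaled.
have := is_deriveB (is_derive_ppow_primitive conjugate_gt1 (is_derive_moving_t x y t))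
  (is_derive_cst (ppow (q + 1) (front x y) / (q + 1)) t (1 : R)).
by rewrite subr0.
Qed.

Lemma is_derive_barrier_x x y t :
  is_derive x (1 : R) (fun x => barrier x y t) (barrier_x x y t).
Proof.
apply: is_derive_scaled.
exact: (is_deriveB (is_derive_ppow_primitive conjugate_gt1 (is_derive_moving_x x y t))
  (is_derive_ppow_primitive conjugate_gt1 (is_derive_front_x x y))).
Qed.

Lemma is_derive_barrier_y x y t :
  is_derive y (1 : R) (fun y => barrier x y t) (barrier_y x y t).
Proof.
apply: is_derive_scaled.
exact: (is_deriveB (is_derive_ppow_primitive conjugate_gt1 (is_derive_moving_y x y t))
  (is_derive_ppow_primitive conjugate_gt1 (is_derive_front_y x y))).
Qed.

Lemma is_derive_barrier_xx x y t :
  is_derive x (1 : R) (fun x => barrier_x x y t) (barrier_xx x y t).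
Proof.
apply: is_derive_scaled; apply: is_deriveB.
  apply: is_derive_ppow_slope conjugate_gt1 (is_derive_moving_x x y t) _.
  exact: is_derive_scaled (is_derive_front_xx x).
exact: is_derive_ppow_slope conjugate_gt1 (is_derive_front_x x y) (is_derive_front_xx x).
Qed.

Lemma is_derive_barrier_yy x y t :
  is_derive y (1 : R) (fun y => barrier_y x y t) (barrier_yy x y t).
Proof.
apply: is_derive_scaled; apply: is_deriveB.
  apply: is_derive_ppow_slope conjugate_gt1 (is_derive_moving_y x y t) _.
  exact: is_derive_scaled (is_derive_front_yy y).
exact: is_derive_ppow_slope conjugate_gt1 (is_derive_front_y x y) (is_derive_front_yy y).
Qed.

Lemma barrier0 x y : barrier x y 0 = 0.
Proof. by rewrite /barrier /moving !mulr0 !addr0 mul1r subrr mulr0. Qed.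

Lemma continuous_barrier : continuous (fun p : R * R * R => barrier p.1.1 p.1.2 p.2).
Proof.
have cp : continuous (fun s : R => ppow (q + 1) s / (q + 1)).
  move=> s; apply: cvgM; last exact: cvg_cst.
  by apply: continuous_ppow; rewrite ltr_wpDl// ltW// (lt_trans ltr01)// conjugate_gt1.
have cX : continuous (fun p : R * R * R => p.1.1 - x0).
  by move=> p; apply: cvgB; [exact: continuous_x|exact: cvg_cst].
have cY : continuous (fun p : R * R * R => p.1.2 - y0).
  by move=> p; apply: cvgB; [exact: continuous_y|exact: cvg_cst].
have cF : continuous (fun p : R * R * R => front p.1.1 p.1.2).
  move=> p; apply: cvgD; first exact: cY.
  by apply: cvgM; [exact: cvg_cst|apply: cvgD; [apply: cvgM; exact: cX|apply: cvgM; exact: cY]].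
have cV : continuous (fun p : R * R * R => moving p.1.1 p.1.2 p.2).
  move=> p; apply: cvgD; last by apply: cvgM; [exact: cvg_cst|exact: continuous_t].
  apply: cvgM; last exact: cF.
  apply: cvgD; first exact: cvg_cst.
  by apply: cvgM; [exact: cvg_cst|exact: continuous_t].
move=> p; apply: cvgM; first exact: cvg_cst.
apply: cvgB.
  exact: (@continuous_comp _ _ _ (fun p : R * R * R => moving p.1.1 p.1.2 p.2) _ p (cV p) (cp _)).
exact: (@continuous_comp _ _ _ (fun p : R * R * R => front p.1.1 p.1.2) _ p (cF p) (cp _)).
Qed.

End barrier_function.

Section barrier_inequality.
Context {R : realType}.
Implicit Types m a B : R.

Lemma ppowM (p b s : R) : 0 <= b -> ppow p (b * s) = b `^ p * ppow p s.
Proof.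
move=> b0; rewrite /ppow -powRM// ?le_max ?lexx//; congr (_ `^ _).
by rewrite -{1}(mulr0 b) maxr_pMr.
Qed.

Lemma ppow_split (p s : R) : 1 < p -> ppow p s = ppow (p - 1) s * s.
Proof.
move=> p1; have [s0|s0] := leP s 0.
  by rewrite !ppow_le0 ?mul0r// ?gt_eqF ?subr_gt0// (lt_trans ltr01).
by rewrite !ppow_gt0E ?(ltW s0)// mulrC mulr_powRB1// ?ltW// (lt_trans ltr01).
Qed.

Lemma conjugate_subr1 m : 1 < m -> (conjugate m - 1) * (m - 1) = 1.
Proof. by move=> m1; rewrite /conjugate; field; rewrite gt_eqF// subr_gt0. Qed.

Lemma conjugate_mul m : 1 < m -> (conjugate m - 1) * m = conjugate m.
Proof. by move=> m1; rewrite /conjugate; field; rewrite gt_eqF// subr_gt0. Qed.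

(** Chosen so that [B q d ^ (q - 1)] is the density whose pressure is [a d]. *)
Definition barrier_coef m a : R := (a / conjugate m `^ m) `^ (m - 1)^-1.

Lemma conjugate_gt0 m : 1 < m -> 0 < conjugate m.
Proof. by move=> m1; rewrite (lt_trans ltr01)// conjugate_gt1. Qed.

Lemma barrier_coef_gt0 m a : 1 < m -> 0 < a -> 0 < barrier_coef m a.
Proof. by move=> m1 a0; rewrite powR_gt0// divr_gt0// powR_gt0// conjugate_gt0. Qed.

Lemma barrier_coefX m a : 1 < m -> 0 < a ->
  barrier_coef m a `^ (m - 1) * conjugate m `^ m = a.
Proof.
move=> m1 a0; have q0 := conjugate_gt0 m1.
rewrite /barrier_coef -powRrM mulVf ?gt_eqF ?subr_gt0// powRr1.
  by rewrite divfK// gt_eqF// powR_gt0.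
by rewrite divr_ge0 ?powR_ge0// ltW.
Qed.

(** The order of pressures at time 0 is the order of densities. *)
Lemma initial_order m a (sg d u : R) : 1 < m -> 0 < a -> sg = 1 \/ sg = -1 -> 0 <= u ->
  0 <= sg * (a * Num.max 0 d - pressure m u) ->
  0 <= sg * (barrier_coef m a * conjugate m * ppow (conjugate m - 1) d - u).
Proof.
move=> m1 a0 sg1 u0; set B := barrier_coef m a; set q := conjugate m.
have B0 : 0 < B by exact: barrier_coef_gt0.
have q0 : 0 < q by exact: conjugate_gt0.
have m10 : 0 < m - 1 by rewrite subr_gt0.
set s := B * q * _.
have s0 : 0 <= s by rewrite mulr_ge0 ?ppow_ge0// mulr_ge0// ltW.
have -> : a * Num.max 0 d = q * s `^ (m - 1).
  rewrite /s powRM ?ppow_ge0 ?(mulr_ge0 (ltW B0) (ltW q0))//.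
  rewrite (powRM _ (ltW B0) (ltW q0)) /ppow -powRrM conjugate_subr1// powRr1 ?le_max ?lexx//.
  by rewrite -{1}(barrier_coefX m1 a0) -/B -/q -(mulr_powRB1 (ltW q0) (lt_trans ltr01 m1)); ring.
rewrite -[pressure m u]/(q * u `^ (m - 1)) -mulrBr mulrCA pmulr_rge0//.
case: sg1 => ->; rewrite ?mul1r ?mulN1r ?oppr_ge0 ?subr_ge0 ?subr_le0 => h.
  by rewrite leNgt; apply/negP => /(gt0_ltr_powR m10); rewrite !nnegrE => /(_ s0 u0); rewrite ltNge h.
by rewrite leNgt; apply/negP => /(gt0_ltr_powR m10); rewrite !nnegrE => /(_ u0 s0); rewrite ltNge h.
Qed.

Lemma sg_square (sg : R) : sg = 1 \/ sg = -1 -> sg * sg = 1.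
Proof. by case=> ->; rewrite ?mulr1// mulrNN mulr1. Qed.

(** Since gradient and Laplacian of [front] are functions of [front], both sides of the differential
    inequality are the same power of [moving] times explicit factors; only an inequality between speed
    and slope is left where [moving] is positive, and nothing elsewhere. The part of the Laplacian that
    involves [front] alone is controlled by the initial order. *)
Lemma barrier_inequality m a (sg k lam c x0 y0 x y t u : R) :
  1 < m -> 0 < a -> sg = 1 \/ sg = -1 -> 0 <= k -> 0 <= 1 + lam * t -> 0 <= u ->
  let d := front (sg * k) x0 y0 x y in
  let v := moving lam c (sg * k) x0 y0 x y t in
  0 <= sg * (a * Num.max 0 d - pressure m u) ->
  (0 < v -> 0 <= sg * (lam * d + c - a * ppow m ((1 + lam * t) ^+ 2 * (1 + 4 * (sg * k) * d) +
     4 * (sg * k) / conjugate m * (1 + lam * t) * v))) ->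
  0 <= sg * (barrier_t m lam c (sg * k) x0 y0 (barrier_coef m a) x y t -
    ppow m (barrier_xx m lam c (sg * k) x0 y0 (barrier_coef m a) x y t +
            barrier_yy m lam c (sg * k) x0 y0 (barrier_coef m a) x y t + u)).
Proof.
move=> m1 a0 sg1 k0 l0 u0 d v /(initial_order m1 a0 sg1 u0) Hu Hv.
set B := barrier_coef m a in Hu *; set q := conjugate m in Hu Hv *.
have B0 : 0 < B by exact: barrier_coef_gt0.
have q0 : 0 < q by exact: conjugate_gt0.
have q1 : 1 < q by exact: conjugate_gt1.
have m0 : 0 <= m by rewrite ltW// (lt_trans ltr01).
set S := (X in ppow m X).
pose E := B * q * ppow (q - 1) v *
  ((1 + lam * t) ^+ 2 * (1 + 4 * (sg * k) * d) + 4 * (sg * k) / q * (1 + lam * t) * v).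
have ES : E - S = (B * q * ppow (q - 1) d - u) +
    4 * (sg * k) * (B * (q + 1) * (ppow (q - 1) d * d)).
  rewrite /S /barrier_xx /barrier_yy -/d -/v -/q (ppow_split v q1) (ppow_split d q1) /E.
  have grad : front_x (sg * k) x0 x ^+ 2 + front_y (sg * k) y0 y ^+ 2 = 1 + 4 * (sg * k) * d.
    by rewrite /front_x /front_y /d /front; ring.
  move: (ppow (q - 1) v) (ppow (q - 1) d) grad => P Q.
  move: (front_x _ _ _) (front_y _ _ _) => X Y grad.
  have Y2 : Y ^+ 2 = 1 + 4 * (sg * k) * d - X ^+ 2 by rewrite -grad; ring.
  rewrite !exprMn !Y2; field; exact: lt0r_neq0.
have dd : 0 <= ppow (q - 1) d * d.
  have [d0|d0] := leP d 0; first by rewrite ppow_le0 ?mul0r// gt_eqF// subr_gt0.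
  by rewrite mulr_ge0 ?ppow_ge0// ltW.
have sES : 0 <= sg * (E - S).
  rewrite ES mulrDr addr_ge0//.
  rewrite [leRHS](_ : _ = sg * sg * (4 * k * (B * (q + 1) * (ppow (q - 1) d * d)))); last by ring.
  rewrite sg_square// mul1r; apply: mulr_ge0; first exact: mulr_ge0.
  by apply: mulr_ge0 => //; apply: mulr_ge0; [exact: ltW|apply: addr_ge0 => //; exact: ltW].
have sP : 0 <= sg * (ppow m E - ppow m S).
  case: sg1 sES => ->; rewrite ?mul1r ?mulN1r ?oppr_ge0 ?subr_ge0 ?subr_le0 => h; exact: ppow_homo.
suff H : 0 <= sg * (barrier_t m lam c (sg * k) x0 y0 B x y t - ppow m E).
  by move: (addr_ge0 H sP); rewrite -mulrDr addrA subrK.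
rewrite /barrier_t -/d -/v -/q.
have [v0|v0] := leP v 0.
  rewrite /E !ppow_le0 ?gt_eqF ?subr_gt0// ?mulr0 ?mul0r ?subr0 ?mulr0//; last exact: lt_trans ltr01 m1.
have c0 : 0 <= B * q * ppow (q - 1) v by rewrite mulr_ge0 ?ppow_ge0// mulr_ge0// ltW.
have -> : ppow m E = B * ppow q v * (a * ppow m ((1 + lam * t) ^+ 2 * (1 + 4 * (sg * k) * d) +
    4 * (sg * k) / q * (1 + lam * t) * v)).
  rewrite /E ppowM//; set GG := ppow m (_ + _).
  rewrite powRM ?ppow_ge0 ?(mulr_ge0 (ltW B0) (ltW q0))// (powRM _ (ltW B0) (ltW q0)).
  rewrite {1}/ppow -powRrM conjugate_mul// -/(ppow q v).
  rewrite -(barrier_coefX m1 a0) -/B -/q.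
  by rewrite -(mulr_powRB1 (ltW B0) (lt_trans ltr01 m1)); ring.
rewrite [B * (_ * _)]mulrA -mulrBr mulrCA mulr_ge0//; first by rewrite mulr_ge0 ?ppow_ge0// ltW.
exact: Hv.
Qed.

End barrier_inequality.

(** * The speed condition *)

Section bernoulli.
Context {R : realType}.

Lemma ppow1 (p : R) : ppow p 1 = 1.
Proof. by rewrite ppow_gt0E// powR1. Qed.

Lemma bernoulli (m s : R) : 1 < m -> 1 + m * (s - 1) <= ppow m s.
Proof.
move=> m1; have m0 : 0 < m by exact: lt_trans m1.
have D x : is_derive x (1 : R) (ppow m) (m * ppow (m - 1) x) by exact: is_derive_ppow.
have C (a b : R) : {within `[a, b], continuous (ppow m)}.
  by apply: continuous_subspaceT => x; apply: continuous_ppow.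
have m10 : 0 <= m - 1 by rewrite subr_ge0 ltW.
have [s1|s1|->] := ltgtP s 1; last by rewrite subrr mulr0 addr0 ppow1.
  have [e] := MVT s1 (fun x _ => D x) (C s 1).
  rewrite in_itv/= => /andP[_ e1]; rewrite ppow1 => E.
  have := ppow_homo m10 (ltW e1); rewrite ppow1.
  have s10 : 0 <= 1 - s by rewrite subr_ge0 ltW.
  move=> /(ler_wpM2r s10) /(ler_wpM2l (ltW m0)); rewrite mulrA -E; lra.
have [e] := MVT s1 (fun x _ => D x) (C 1 s).
rewrite in_itv/= => /andP[e1 _]; rewrite ppow1 => E.
have := ppow_homo m10 (ltW e1); rewrite ppow1.
have s10 : 0 <= s - 1 by rewrite subr_ge0 ltW.
move=> /(ler_wpM2r s10) /(ler_wpM2l (ltW m0)); rewrite [leRHS]mulrA -E; lra.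
Qed.

(** Bernoulli's inequality at [(1 + Z)^-1]. *)
Lemma ppow_linear_bound (m z Z W : R) : 1 < m -> z <= Z -> 0 <= Z <= W ->
  ppow m (1 + z) <= 1 + m * ppow (m - 1) (1 + W) * Z.
Proof.
move=> m1 zZ /andP[Z0 ZW]; have m0 : 0 < m by exact: lt_trans m1.
have p0 : 0 < 1 + Z by rewrite ltr_pwDl.
apply: (@le_trans _ _ (ppow m (1 + Z))); first by apply: ppow_homo; [exact: ltW|rewrite lerD2l].
have pW : 0 < 1 + W by rewrite ltr_pwDl// (le_trans Z0).
have i0 : 0 <= (1 + Z)^-1 by rewrite invr_ge0 ltW.
have := bernoulli (1 + Z)^-1 m1.
rewrite (ppow_gt0E _ i0) (ppow_gt0E _ (ltW p0)) (ppow_gt0E _ (ltW pW)).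
have P0 : 0 < (1 + Z) `^ m by rewrite powR_gt0.
move=> /(ler_wpM2l (ltW P0)); rewrite -powRM ?invr_ge0 ?(ltW p0)// mulfV ?gt_eqF// powR1 => H.
have E : (1 + Z) `^ m * (1 + m * ((1 + Z)^-1 - 1)) = (1 + Z) `^ m - m * (1 + Z) `^ (m - 1) * Z.
  by rewrite -{1 2}(mulr_powRB1 (ltW p0) m0); field; exact: lt0r_neq0.
move: H; rewrite E lerBlDr => H; apply: (le_trans H); rewrite lerD2l.
apply: ler_wpM2r => //; apply: ler_wpM2l; first exact: ltW.
apply: ge0_ler_powR; rewrite ?nnegrE ?subr_ge0 ?(ltW p0) ?(ltW m1)//.
  by rewrite addr_ge0// (le_trans Z0).
by rewrite lerD2l.
Qed.

End bernoulli.

Section arithmetic.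
Context {R : realType}.

Lemma upper_coefficient (Lam t d q v c e : R) : 0 <= Lam * t <= 1 -> 1 <= q -> 0 <= d -> 0 <= v ->
  e <= d -> v <= 2 * d + c ->
  (1 + Lam * t) ^+ 2 * (1 + 4 * e) + 4 / q * (1 + Lam * t) * v <=
  1 + (3 * (Lam * t) + 32 * d + 8 * c).
Proof.
move=> /andP[l0 l1] q1 d0 v0 ed vd; move: (Lam * t) l0 l1 => l l0 l1.
have q0 : 0 < q by exact: lt_le_trans q1.
have h1 : 4 / q * (1 + l) * v <= 8 * v.
  apply: ler_wpM2r => //; have : q^-1 <= 1 by rewrite invf_le1.
  by have : 0 < q^-1 by [rewrite invr_gt0]; nra.
have h2 : (1 + l) ^+ 2 * (1 + 4 * e) <= (1 + l) ^+ 2 * (1 + 4 * d).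
  by apply: ler_wpM2l; [exact: sqr_ge0|lra].
have h3 : (1 + l) ^+ 2 <= 1 + 3 * l by nra.
have h4 : (1 + l) ^+ 2 * d <= 4 * d by apply: ler_wpM2r => //; nra.
by nra.
Qed.

(** [Lam] dominates the terms that are linear in [front]; the remaining terms are of order [T] and are
    covered by the surplus speed [2 (C1 + C2) T]. *)
Lemma upper_margin (Lam K T d dp c C1 C2 : R) : 0 <= T -> 0 <= K -> 0 <= dp -> 32 * K <= Lam ->
  C1 = Lam + 8 * K -> C2 = 3 * K * Lam -> C1 * T <= 1 / 2 -> c = 1 + 2 * (C1 + C2) * T ->
  dp - c * T <= d -> 1 + K * (3 * (Lam * T) + 32 * dp + 8 * (c * T)) <= Lam * d + c.
Proof.
move=> T0 K0 dp0 KL -> -> C1T -> H.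
set c' := 1 + _ in H *.
have L0 : 0 <= Lam by apply: le_trans KL; rewrite mulr_ge0.
have h1 : Lam * (dp - c' * T) <= Lam * d by exact: ler_wpM2l.
have h2 : 32 * K * dp <= Lam * dp by exact: ler_wpM2r.
have h3 : (Lam + 8 * K) * T * (2 * (Lam + 8 * K + 3 * K * Lam) * T) <=
   1 / 2 * (2 * (Lam + 8 * K + 3 * K * Lam) * T).
  apply: ler_wpM2r => //; apply: mulr_ge0 => //; apply: mulr_ge0 => //.
  by have := mulr_ge0 K0 L0; lra.
suff : 1 + K * (3 * (Lam * T) + 8 * (c' * T)) <= c' - Lam * (c' * T) by lra.
by rewrite /c'; nra.
Qed.

(** By Bernoulli's inequality the slope factor may be replaced with its linearization. As for the
    barrier from above, [Lam] dominates the terms linear in [front] and [C3] those of order [T]. *)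
Lemma lower_margin (m a k Lam t T d dp q v c C3 : R) : 1 < m -> 0 < a -> 0 <= k -> 1 <= q ->
  8 * (a * m * k) <= Lam -> 0 < t <= T -> Lam * T <= 1 / 2 -> 2 * m * Lam + 4 * (m * k * a) + 2 * Lam <= C3 ->
  c = a * (1 - C3 * T) -> 0 <= c -> 0 <= dp -> d <= dp -> (dp = d \/ dp = 0) ->
  v = (1 + - Lam * t) * d + c * t -> 0 < v ->
  c - Lam * d <= a * (1 + m * ((1 + - Lam * t) ^+ 2 * (1 + 4 * (- k) * d) +
     4 * (- k) / q * (1 + - Lam * t) * v - 1)).
Proof.
move=> m1 a0 k0 q1 kL /andP[t0 tT] LT C3L cE c0 dp0 ddp dpE vE v0.
have T0 : 0 < T by exact: lt_le_trans tT.
have m0 : 0 <= m by rewrite ltW// (lt_trans ltr01).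
have amk : 0 <= a * m * k by apply: mulr_ge0 => //; apply: mulr_ge0 => //; exact: ltW.
have L0 : 0 <= Lam by apply: le_trans kL; apply: mulr_ge0.
have [l0 lT l1] : [/\ 0 <= Lam * t, Lam * t <= Lam * T & Lam * t <= 1 / 2].
  have h : Lam * t <= Lam * T by exact: ler_wpM2l.
  by split=> //; [rewrite mulr_ge0// ltW|exact: le_trans LT].
have C30 : 0 <= C3.
  apply: le_trans C3L; have := mulr_ge0 m0 L0; have : 0 <= m * k * a by rewrite mulrC mulrA.
  by lra.
have ca : c <= a.
  by rewrite cE ger_pMr// gerBl mulr_ge0// ltW.
have ct : c * t <= a * T by apply: ler_pM => //; exact: ltW.
have c0t : 0 <= c * t by rewrite mulr_ge0// ltW.
rewrite mulNr in vE *; move: (Lam * t) l0 lT l1 vE => l l0 lT l1 vE.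
have dlow : dp - 2 * (a * T) <= d by case: dpE => dpE; nra.
have vdp : v <= dp + a * T by nra.
have Ld : Lam * (dp - 2 * (a * T)) <= Lam * d by exact: ler_wpM2l.
have q0 : 0 < q by exact: lt_le_trans q1.
have G : - (2 * (Lam * T)) - 8 * (k * dp) - 4 * (k * (a * T)) <=
    (1 - l) ^+ 2 * (1 + 4 * (- k) * d) + 4 * (- k) / q * (1 - l) * v - 1.
  have h1 : (1 - l) ^+ 2 * (k * d) <= k * dp.
    have := ler_wpM2l k0 ddp; have := mulr_ge0 k0 dp0; have : (1 - l) ^+ 2 <= 1 by nra.
    have := sqr_ge0 (1 - l); move: ((1 - l) ^+ 2) (k * d) (k * dp) => A X Y; nra.
  have h2 : k / q * (1 - l) * v <= k * v.
    apply: ler_wpM2r; first exact: ltW.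
    have : q^-1 <= 1 by rewrite invf_le1.
    have : 0 < q^-1 by [rewrite invr_gt0].
    move: (q^-1) => p p0 p1; have := ler_wpM2l k0 p1; have := mulr_ge0 k0 (ltW p0).
    by move: (k * p) => X; nra.
  have h3 : k * v <= k * dp + k * (a * T) by rewrite -mulrDr ler_wpM2l.
  have h4 : 1 - 2 * l <= (1 - l) ^+ 2 by nra.
  have -> : 4 * (- k) / q * (1 - l) * v = - 4 * (k / q * (1 - l) * v) by ring.
  have -> : (1 - l) ^+ 2 * (1 + 4 * (- k) * d) = (1 - l) ^+ 2 - 4 * ((1 - l) ^+ 2 * (k * d)) by ring.
  by lra.
have am0 : 0 <= a * m by rewrite mulr_ge0// ltW// (lt_trans ltr01).
have := ler_wpM2l am0 G.
set g := _ - 1 => H.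
have kdp : 8 * (a * m * k) * dp <= Lam * dp by exact: ler_wpM2r.
have C3T : (2 * m * Lam + 4 * (m * k * a) + 2 * Lam) * (a * T) <= C3 * (a * T).
  by apply: ler_wpM2r => //; rewrite mulr_ge0// ltW.
have -> : c = a - C3 * (a * T) by rewrite cE; ring.
by lra.
Qed.

End arithmetic.

(** * Bounds on the front *)

Section consequences.
Context {R : realType}.
Variables (m : R) (w : R * R * R -> R).
Hypotheses (m1 : 1 < m) (cw : continuous w) (w0 : forall z, 0 <= w z).
Hypothesis ww : weak_pme m w.

Let q1 : 1 <= conjugate m := ltW (conjugate_gt1 m1).

Lemma positive_part_cases (d : R) :
  [/\ 0 <= Num.max 0 d, d <= Num.max 0 d & Num.max 0 d = d \/ Num.max 0 d = 0].
Proof.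
split; rewrite ?le_max ?lexx ?orbT//.
by have [d0|d0] := leP 0 d; [left|right].
Qed.

Lemma front_up_bound (x y : R) : `|x| < 2 -> `|y| < 2 -> y + (x ^+ 2 + y ^+ 2) <= 10.
Proof. by rewrite !ltr_norml => /andP[? ?] /andP[? ?]; nra. Qed.

Lemma front_up_side (x y : R) : `|x| = 2 \/ `|y| = 2 -> 2 <= y + (x ^+ 2 + y ^+ 2).
Proof.
have sq (s : R) : `|s| = 2 -> s ^+ 2 = 4 by move=> h; rewrite -real_normK ?num_real// h; ring.
case=> h; have := sq _ h; first by move=> ->; nra.
move=> e; have : - 2 <= y by have := ler_norm (- y); rewrite normrN h; lra.
  by rewrite e; have := sqr_ge0 x; lra.
Qed.

Lemma front_down_side (k x0 y0 x y : R) : 2 <= k -> `|x0| <= 1 / 2 -> `|y0| <= 1 / 2 ->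
  `|x| = 2 \/ `|y| = 2 -> y - y0 + - k * ((x - x0) ^+ 2 + (y - y0) ^+ 2) <= - 2.
Proof.
move=> k2 hx hy h.
have far (s s0 : R) : `|s| = 2 -> `|s0| <= 1 / 2 -> 9 / 4 <= (s - s0) ^+ 2.
  move=> hs hs0; have := lerB_dist s s0; rewrite hs => h1.
  have {}h1 : 3 / 2 <= `|s - s0| by lra.
  by rewrite -real_normK ?num_real//; nra.
have a2 := sqr_ge0 (x - x0); have b2 := sqr_ge0 (y - y0).
have : 2 * ((x - x0) ^+ 2 + (y - y0) ^+ 2) <= k * ((x - x0) ^+ 2 + (y - y0) ^+ 2).
  by apply: ler_wpM2r => //; exact: addr_ge0.
rewrite mulNr; set X := k * _ => H.
have : 9 / 4 <= (x - x0) ^+ 2 + (y - y0) ^+ 2.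
  by case: h => [/far/(_ hx)|/far/(_ hy)]; lra.
set Y := y - y0 in a2 b2 H * => H2.
have : Y <= 1 / 4 + Y ^+ 2 by have := sqr_ge0 (Y - 1 / 2); lra.
by move: a2 b2 H H2; set A := (x - x0) ^+ 2; set E := Y ^+ 2; lra.
Qed.

Lemma barrier_comparison (a sg k lam c x0 y0 T e : R) :
  let d := front (sg * k) x0 y0 in
  let v := moving lam c (sg * k) x0 y0 in
  let F := barrier m lam c (sg * k) x0 y0 (barrier_coef m a) in
  let Ft := barrier_t m lam c (sg * k) x0 y0 (barrier_coef m a) in
  0 < a -> sg = 1 \/ sg = -1 -> 0 <= k -> 0 < T -> (forall t, 0 < t <= T -> 0 <= 1 + lam * t) ->
  (forall x y t, `|x| <= 2 -> `|y| <= 2 -> `|x| = 2 \/ `|y| = 2 -> 0 < t <= T ->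
     0 <= sg * (Ft x y t - ppow m (w (x, y, t)))) ->
  (forall x y, `|x| < 2 -> `|y| < 2 ->
     0 <= sg * (a * Num.max 0 (d x y) - pressure m (w (x, y, 0)))) ->
  (forall x y t, `|x| < 2 -> `|y| < 2 -> 0 < t <= T -> 0 < v x y t ->
     0 <= sg * (lam * d x y + c - a * ppow m ((1 + lam * t) ^+ 2 * (1 + 4 * (sg * k) * d x y) +
       4 * (sg * k) / conjugate m * (1 + lam * t) * v x y t))) ->
  0 < e -> exists2 r0, 0 < r0 & forall r, 0 < r < r0 -> forall x y t, `|x| <= 2 -> `|y| <= 2 ->
    0 <= t <= T -> sg * (potential m w r x y (2 * r + t) - F x y t) <= e * t.
Proof.
move=> d v F Ft a0 sg1 k0 T0 l0 side init speed e0.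
apply: (@comparison R m w m1 cw ww sg 2 T F Ft
  (barrier_x m lam c (sg * k) x0 y0 (barrier_coef m a))
  (barrier_xx m lam c (sg * k) x0 y0 (barrier_coef m a))
  (barrier_y m lam c (sg * k) x0 y0 (barrier_coef m a))
  (barrier_yy m lam c (sg * k) x0 y0 (barrier_coef m a)) sg1 (ltr0n R 2) T0 _ _ _ _ _ _ _ side _ e e0).
- by move=> x y; exact: barrier0.
- exact: continuous_barrier.
- by move=> x y t; exact: is_derive_barrier_t.
- by move=> x y t; exact: is_derive_barrier_x.
- by move=> x y t; exact: is_derive_barrier_xx.
- by move=> x y t; exact: is_derive_barrier_y.
- by move=> x y t; exact: is_derive_barrier_yy.
move=> x y t xL yL tT; apply: barrier_inequality m1 a0 sg1 k0 (l0 t tT) (w0 _) _ _.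
  exact: init.
exact: speed.
Qed.

End consequences.

Section consequences.
Context {R : realType}.
Variables (m : R) (w : R * R * R -> R).
Hypotheses (m1 : 1 < m) (cw : continuous w) (w0 : forall z, 0 <= w z).
Hypothesis ww : weak_pme m w.

Let q1 : 1 <= conjugate m := ltW (conjugate_gt1 m1).

Lemma upper_speed (Lam T C1 C2 c t d dp : R) : let K := m * ppow (m - 1) (1 + 340) in
  T <= 1 -> 0 <= Lam -> 32 * K <= Lam -> C1 = Lam + 8 * K -> C2 = 3 * K * Lam -> Lam * T <= 1 ->
  C1 * T <= 1 / 2 -> c = 1 + 2 * (C1 + C2) * T -> c <= 2 -> 0 < t <= T ->
  0 <= dp -> d <= dp -> dp = d \/ dp = 0 -> d <= 10 -> 0 < (1 + Lam * t) * d + c * t ->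
  0 <= Lam * d + c - ppow m ((1 + Lam * t) ^+ 2 * (1 + 4 * d) +
    4 / conjugate m * (1 + Lam * t) * ((1 + Lam * t) * d + c * t)).
Proof.
move=> K T1 L0 KL C1E C2E LT CT1 cE c2 /andP[t0 tT] dp0 ddp dpE d10 v0.
have K0 : 0 <= K by rewrite mulr_ge0 ?ppow_ge0// ltW// (lt_trans ltr01).
have T0 : 0 <= T by exact: le_trans (ltW t0) tT.
have dp10 : dp <= 10 by case: dpE => ->.
have c0 : 0 <= c.
  by rewrite cE addr_ge0// mulr_ge0// mulr_ge0// C1E C2E !addr_ge0// mulr_ge0// mulr_ge0.
have lt0 : 0 <= Lam * t by rewrite mulr_ge0// ltW.
have ltT : Lam * t <= Lam * T by exact: ler_wpM2l.
have lt1 : 0 <= Lam * t <= 1 by rewrite lt0 (le_trans ltT).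
have ctT : c * t <= c * T by exact: ler_wpM2l.
have cT2 : c * T <= 2 by rewrite -[2]mulr1; exact: ler_pM.
have ct0 : 0 <= c * t by rewrite mulr_ge0// ltW.
have l0 : 0 <= 1 + Lam * t by exact: addr_ge0.
have l2 : 1 + Lam * t <= 2 by case/andP: lt1 => _; lra.
have vd : (1 + Lam * t) * d + c * t <= 2 * dp + c * T.
  apply: lerD => //; apply: (@le_trans _ _ ((1 + Lam * t) * dp)); first exact: ler_wpM2l.
  exact: ler_wpM2r.
have dlow : dp - c * T <= d.
  case: dpE => dpE; first by rewrite dpE lerBlDr lerDl (le_trans ct0).
  rewrite dpE sub0r; have [d0|d0] := leP 0 d; first by rewrite (le_trans _ d0)// oppr_le0 (le_trans ct0).
  have : (1 + Lam * t) * d <= 1 * d by rewrite ler_nM2r// lerDl.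
  by rewrite mul1r; move: v0 ctT; lra.
have := upper_coefficient lt1 q1 dp0 (ltW v0) ddp vd.
set GG := _ * _ + _ => GZ.
have ZW : 0 <= 3 * (Lam * t) + 32 * dp + 8 * (c * T) <= 340.
  case/andP: lt1 => _ l1; move: dp10 dp0 cT2 lt0 l1 (le_trans ct0 ctT); clear -m1 cw w0 ww q1; move=> ? ? ? ? ? ?.
  by apply/andP; split; lra.
have := ppow_linear_bound m1 (_ : GG - 1 <= _) ZW.
rewrite addrCA subrr addr0 -/K lerBlDl => /(_ GZ) PG.
rewrite subr_ge0 (le_trans PG)//.
have Kt : K * (3 * (Lam * t)) <= K * (3 * (Lam * T)).
  by apply: ler_wpM2l => //; exact: ler_wpM2l.
have := @upper_margin R Lam K T d dp c C1 C2 T0 K0 dp0 KL C1E C2E CT1 cE dlow.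
by move: Kt; clear -m1 cw w0 ww q1; lra.
Qed.

(** A barrier from above with speed [1 + C T]. Its front is [y + x ^+ 2 + y ^+ 2], which is at least 2 on
    the lateral boundary, so that a large [Lam] also beats the solution there. *)
Lemma vanishing_below :
  (forall x y, `|x| < 2 -> `|y| < 2 ->
     pressure m (w (x, y, 0)) <= Num.max 0 (y + (x ^+ 2 + y ^+ 2))) ->
  exists C T0, [/\ 0 < C, 0 < T0 & forall T x y s : R, 0 < T <= T0 -> `|x| <= 2 -> `|y| <= 2 ->
    y + (x ^+ 2 + y ^+ 2) <= - T - C * T ^+ 2 -> 0 < s < T -> w (x, y, s) = 0].
Proof.
move=> init.
have [M M0 bM] := continuous_bounded_box 2 cw.
(* 340 bounds [3 Lam T + 32 front + 8 c T] on the box, where [front <= 10]. *)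
pose K := m * ppow (m - 1) (1 + 340).
have K0 : 0 <= K by rewrite mulr_ge0 ?ppow_ge0// ltW// (lt_trans ltr01).
pose B := barrier_coef m 1.
have B0 : 0 < B by apply: barrier_coef_gt0.
(* The first summand serves the interior inequality, the second one the lateral boundary. *)
pose Lam := 32 * K + M `^ m / B + 1.
have MB : 0 <= M `^ m / B by rewrite divr_ge0 ?powR_ge0// ltW.
have L0 : 0 < Lam by rewrite /Lam; lra.
have KL : 32 * K <= Lam by rewrite /Lam; lra.
pose C1 := Lam + 8 * K; pose C2 := 3 * K * Lam; pose C3 := 2 * (C1 + C2).
have C10 : 0 < C1 by rewrite ltr_wpDr// mulr_ge0.
have C20 : 0 <= C2 by apply: mulr_ge0; [exact: mulr_ge0|exact: ltW].
have C30 : 0 < C3 by rewrite mulr_gt0// ltr_wpDr.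
pose D := 1 + Lam + 2 * C1 + C3.
have D0 : 0 < D by rewrite /D; lra.
exists C3, (D^-1); split => // [|T x y s /andP[T0 TD] xL yL dT sT]; first by rewrite invr_gt0.
have TD1 : T * D <= 1 by rewrite -ler_pdivlMr// mul1r.
have [T1 LT CT1 CT3] : [/\ T <= 1, Lam * T <= 1, C1 * T <= 1 / 2 & C3 * T <= 1].
  have h1 := mulr_ge0 (ltW L0) (ltW T0); have h2 := mulr_ge0 (ltW C10) (ltW T0).
  have h3 := mulr_ge0 (ltW C30) (ltW T0); rewrite /D in TD1.
  by move: T0 TD1 h1 h2 h3; clear -m1 cw w0 ww q1; move=> ? ? ? ? ?; split; lra.
pose c := 1 + C3 * T.
have [c1 c2] : 1 <= c /\ c <= 2.
  by have := mulr_ge0 (ltW C30) (ltW T0); rewrite /c; move: CT3; clear -m1 cw w0 ww q1; lra.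
have c0 : 0 <= c by exact: le_trans c1.
have frontE (x' y' : R) : front (1 * 1) 0 0 x' y' = y' + (x' ^+ 2 + y' ^+ 2).
  by rewrite /front !subr0 !mul1r.
apply: (@potential_vanish R m w m1 cw w0 x y T) sT => e e0.
have F0 : barrier m Lam c (1 * 1) 0 0 B x y T = 0.
  rewrite /barrier !ppow_le0 ?mul0r ?subr0 ?mulr0// ?frontE.
  - by rewrite gt_eqF// addr_gt0// conjugate_gt0.
  - apply: (le_trans dT); rewrite subr_le0 (le_trans (y := 0)) ?oppr_le0 ?(ltW T0)//.
    by rewrite mulr_ge0 ?sqr_ge0// ltW.
  - by rewrite gt_eqF// addr_gt0// conjugate_gt0.
  rewrite /moving frontE /c; set d := (y + _) in dT *.
  have d0 : d <= 0 by have := mulr_ge0 (ltW C30) (sqr_ge0 T); move: dT T0; clear -m1 cw w0 ww q1; lra.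
  have h : (Lam * T) * d <= 0 by rewrite mulr_ge0_le0// mulr_ge0// ltW.
  by move: dT h; rewrite expr2; clear -m1 cw w0 ww q1; lra.
have := @barrier_comparison R m w m1 cw w0 ww 1 1 1 Lam c 0 0 T e ltr01 (or_introl erefl) ler01 T0.
rewrite -/B => H.
have [||||r0 r00 Hr] := H _ _ _ _ e0.
- by move=> t /andP[t0 _]; apply: addr_ge0 => //; rewrite mulr_ge0// ltW.
- move=> x' y' t xL' yL' edge /andP[t0 tT]; rewrite mul1r subr_ge0.
  have lt0 : 0 <= Lam * t by rewrite mulr_ge0// ltW.
  have ct0 : 0 <= c * t by rewrite mulr_ge0// ltW.
  have d2 : 2 <= front (1 * 1) 0 0 x' y' by rewrite frontE; exact: front_up_side.
  have v1 : 1 <= moving Lam c (1 * 1) 0 0 x' y' t.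
    rewrite /moving; move: (front _ _ _ _ _) d2 => d d2.
    by have := mulr_ge0 lt0 (le_trans (ler0n _ 2) d2); move: d2 ct0; clear -m1 cw w0 ww q1; lra.
  have q0 := ltW (conjugate_gt0 m1).
  have := ppow_homo q0 v1; rewrite ppow1 => P1.
  apply: (@le_trans _ _ (M `^ m)).
    rewrite ppow_gt0E//; apply: ge0_ler_powR; rewrite ?nnegrE//; first by rewrite ltW// (lt_trans ltr01).
    apply: le_trans (ler_norm _) (bM _ _); apply/norm_spacetime; split => //=.
    by rewrite gtr0_norm//; apply: (le_trans tT); apply: (le_trans T1); rewrite ler1n.
  have : B * (1 * Lam) <= B * (ppow (conjugate m) (moving Lam c (1 * 1) 0 0 x' y' t) *
      (Lam * front (1 * 1) 0 0 x' y' + c)).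
    apply: ler_wpM2l; first exact: ltW.
    apply: ler_pM => //; first exact: ltW.
    by have := ler_wpM2l (ltW L0) d2; move: c0 L0; clear -m1 cw w0 ww q1; lra.
  apply: le_trans; rewrite mul1r -ler_pdivrMl// mulrC /Lam.
  by move: K0; clear -m1 cw w0 ww q1; lra.
- move=> x' y' xL' yL'; rewrite mul1r subr_ge0 mul1r frontE; exact: init.
- move=> x' y' t xL' yL' tT; rewrite /moving (mulr1 (1 : R)) => v0.
  have [dp0 ddp dpE] := positive_part_cases (front 1 0 0 x' y').
  have d10 := front_up_bound xL' yL'; rewrite -frontE (mulr1 (1 : R)) in d10.
  rewrite !mul1r mulr1.
  exact: (upper_speed T1 (ltW L0) KL erefl erefl LT CT1 erefl c2 tT dp0 ddp dpE d10).
exists r0; [exact: r00|move=> r rr].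
have := Hr r rr x y T xL yL; rewrite mul1r F0 subr0; apply.
by rewrite lexx ltW.
Qed.

End consequences.

Lemma dist_through (R : realType) (a b c r e : R) : `|a - b| < e / 2 -> `|b - c| < r -> r <= e / 2 ->
  `|a - c| < e.
Proof.
move=> h1 h2 h3; have := ler_normD (a - b) (b - c); rewrite addrA subrK => h4.
by apply: (le_lt_trans h4); rewrite [e]splitr ltrD// (lt_le_trans h2).
Qed.

Section consequences.
Context {R : realType}.
Variables (m : R) (w : R * R * R -> R).
Hypotheses (m1 : 1 < m) (cw : continuous w) (w0 : forall z, 0 <= w z).
Hypothesis ww : weak_pme m w.

Let q1 : 1 <= conjugate m := ltW (conjugate_gt1 m1).

Lemma lower_speed (a k Lam T C3 c t d : R) : 0 < a -> 0 <= k ->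
  8 * (a * m * k) <= Lam -> 0 < t <= T -> Lam * T <= 1 / 2 ->
  2 * m * Lam + 4 * (m * k * a) + 2 * Lam <= C3 -> c = a * (1 - C3 * T) -> 0 <= c ->
  0 < (1 + - Lam * t) * d + c * t ->
  0 <= -1 * (- Lam * d + c - a * ppow m ((1 + - Lam * t) ^+ 2 * (1 + 4 * (-1 * k) * d) +
    4 * (-1 * k) / conjugate m * (1 + - Lam * t) * ((1 + - Lam * t) * d + c * t))).
Proof.
move=> a0 k0 kL tT LT C3L cE c0 v0.
have [dp0 ddp dpE] := positive_part_cases d.
have := lower_margin m1 a0 k0 q1 kL tT LT C3L cE c0 dp0 ddp dpE erefl v0.
rewrite mulN1r; set GG := _ * _ + _ => H.
have := ler_wpM2l (ltW a0) (bernoulli GG m1).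
by rewrite mulN1r mulNr; lra.
Qed.

(** A barrier from below, given by a paraboloid under the initial pressure with slope [a] at its vertex.
    The constants do not depend on the vertex, which will move with [t]. Below the vertex the barrier
    becomes positive, so [w] is positive nearby at some time before [t], and then at [t]. *)
Lemma positivity_above (k : R) : 2 <= k ->
  exists C T0, [/\ 0 < C, 0 < T0 & forall a x0 y0 T z t rho : R,
    1 / 2 <= a <= 2 -> `|x0| <= 1 / 2 -> `|y0| <= 1 / 2 ->
    (forall x y, `|x| < 2 -> `|y| < 2 ->
      a * Num.max 0 (y - y0 + - k * ((x - x0) ^+ 2 + (y - y0) ^+ 2)) <= pressure m (w (x, y, 0))) ->
    0 < T <= T0 -> T < t -> 0 < rho -> `|y0 - z| <= 2 -> 0 <= z ->
    z + k * z ^+ 2 < a * T - C * T ^+ 2 ->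
    exists x' y', [/\ `|x' - x0| < rho, `|y' - (y0 - z)| < rho & 0 < w (x', y', t)]].
Proof.
move=> k2; have k0 : 0 <= k by exact: le_trans k2.
have m0 : 0 < m by exact: lt_trans m1.
have mk0 : 0 <= m * k by rewrite mulr_ge0// ltW.
pose Lam := 16 * (m * k) + 1.
have L0 : 0 < Lam by rewrite /Lam; lra.
pose C3 := 2 * m * Lam + 8 * (m * k) + 2 * Lam.
have mL0 : 0 < m * Lam by exact: mulr_gt0.
have C30 : 0 < C3 by rewrite /C3; lra.
pose D := 2 + 2 * Lam + C3.
have D0 : 0 < D by rewrite /D; lra.
exists (2 * C3), (D^-1); split; [exact: mulr_gt0|by rewrite invr_gt0|].
move=> a x0 y0 T z t rho /andP[a1 a2] hx0 hy0 init /andP[T0 TD] Tt rho0 hz z0 zT.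
have TD1 : T * D <= 1 by rewrite -ler_pdivlMr// mul1r.
have [T1 LT CT3] : [/\ T <= 1 / 2, Lam * T <= 1 / 2 & C3 * T <= 1].
  have h1 := mulr_ge0 (ltW L0) (ltW T0); have h3 := mulr_ge0 (ltW C30) (ltW T0).
  by move: T0 TD1 h1 h3; rewrite /D; clear -m1 cw w0 ww q1; move=> ? ? ? ?; split; lra.
have a0 : 0 < a by apply: lt_le_trans a1; rewrite divr_gt0.
pose c := a * (1 - C3 * T).
have c0 : 0 <= c by rewrite mulr_ge0 ?subr_ge0// ltW.
have ca : c <= a.
  by rewrite ger_pMr// gerBl mulr_ge0// ltW.
have mka : 0 <= (2 - a) * (m * k) by rewrite mulr_ge0// subr_ge0.
have kL : 8 * (a * m * k) <= Lam by rewrite /Lam; lra.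
have C3L : 2 * m * Lam + 4 * (m * k * a) + 2 * Lam <= C3 by rewrite /C3; lra.
pose F := barrier m (- Lam) c (-1 * k) x0 y0 (barrier_coef m a).
have dz : front (-1 * k) x0 y0 x0 (y0 - z) = - (z + k * z ^+ 2) by rewrite /front; ring.
have kz : 0 <= k * z ^+ 2 by rewrite mulr_ge0// sqr_ge0.
have v0 : 0 < moving (- Lam) c (-1 * k) x0 y0 x0 (y0 - z) T.
  rewrite /moving dz; have LZ : 0 <= Lam * T * (z + k * z ^+ 2).
    by apply: mulr_ge0; [rewrite mulr_ge0// ltW|exact: addr_ge0].
  have : 0 <= (2 - a) * (C3 * T ^+ 2).
    by apply: mulr_ge0; [rewrite subr_ge0|rewrite mulr_ge0 ?sqr_ge0// ltW].
  by rewrite /c; move: zT LZ; clear -m1 cw w0 ww q1; lra.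
have F0 : 0 < F x0 (y0 - z) T.
  apply: mulr_gt0; first exact: barrier_coef_gt0.
  have qp : 0 < conjugate m + 1 by rewrite addr_gt0// conjugate_gt0.
  rewrite dz [ppow _ (- _)]ppow_le0 ?gt_eqF// ?mul0r ?subr0; last by rewrite oppr_le0 addr_ge0.
  by rewrite divr_gt0// ppow_gt0E ?(ltW v0)// powR_gt0.
pose e := F x0 (y0 - z) T / (2 * T).
have e0 : 0 < e by rewrite divr_gt0// mulr_gt0.
have H := @barrier_comparison R m w m1 cw w0 ww a (-1) k (- Lam) c x0 y0 T e a0 (or_intror erefl) k0 T0.
have [||||r0 r00 Hr] := H _ _ _ _ e0.
- move=> s /andP[s0 sT]; have : Lam * s <= Lam * T by rewrite ler_wpM2l// ltW.
  by move: LT; rewrite mulNr; clear -m1 cw w0 ww q1; lra.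
- move=> x y s xL yL side /andP[s0 sT].
  have d2 : front (-1 * k) x0 y0 x y <= - 2 by rewrite /front mulN1r; exact: front_down_side.
  have v1 : moving (- Lam) c (-1 * k) x0 y0 x y s <= 0.
    have Ls : Lam * s <= Lam * T by rewrite ler_wpM2l// ltW.
    have Ls0 : 0 <= Lam * s by rewrite mulr_ge0// ltW.
    have cs : c * s <= 2 * (1 / 2).
      by apply: ler_pM => //; [exact: ltW|exact: le_trans ca a2|exact: le_trans sT T1].
    rewrite /moving [- Lam * s]mulNr; move: (front _ _ _ _ _) d2 (Lam * s) (c * s) Ls Ls0 cs => d d2 l cs' Ls Ls0 cs.
    have l2 : l <= 1 / 2 := le_trans Ls LT.
    have : (1 - l) * d <= (1 - l) * (- 2) by apply: ler_wpM2l => //; move: l2; clear -m1 cw w0 ww q1; lra.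
    by move: l2 cs; clear -m1 cw w0 ww q1; lra.
  rewrite /barrier_t [ppow (conjugate m) _]ppow_le0 ?gt_eqF ?conjugate_gt0// mul0r mulr0 sub0r.
  by rewrite mulrNN mul1r ppow_ge0.
- move=> x y xL yL; rewrite mulN1r oppr_ge0 subr_le0 /front mulN1r; exact: init.
- move=> x y s xL yL sT vs; exact: (@lower_speed a k Lam T C3 c s _ a0 k0 kL sT LT C3L erefl c0 vs).
pose r := Num.min (r0 / 2) (Num.min (rho / 2) ((t - T) / 3)).
have rp : 0 < r by rewrite !lt_min !divr_gt0// subr_gt0.
have [rr0 rr1 rr2] : [/\ r <= r0 / 2, r <= rho / 2 & r <= (t - T) / 3].
  by split; rewrite !ge_min lexx ?orbT.
have rlt : 0 < r < r0 by rewrite rp (le_lt_trans rr0)// ltr_pdivrMr// ltr_pMr// ltrDl.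
have hx02 : `|x0| <= 2 by apply: (le_trans hx0); clear -m1 cw w0 ww q1; lra.
have T0T : 0 <= T <= T by rewrite lexx ltW.
have Hp := Hr r rlt x0 (y0 - z) T hx02 hz T0T.
have {Hp} pos : 0 < potential m w r x0 (y0 - z) (2 * r + T).
  have eT : e * T = F x0 (y0 - z) T / 2 by rewrite /e; field; exact: lt0r_neq0.
  move: Hp; rewrite eT -/(F _ _ _); move: (F _ _ _) F0 => f f0.
  by move: (potential _ _ _ _ _ _) => p; move: f0; clear -m1 cw w0 ww q1; lra.
have [p [h1 h2 h3 h4 h5]] := @potential_pos_support R m w m1 r x0 (y0 - z) T rp (ltW T0) pos.
have pt : p.2 <= t.
  apply: (le_trans h4); rewrite -lerBrDl (le_trans (ler_wpM2l (ler0n _ 3) rr2))//.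
  by rewrite mulrC divfK.
have pE : p = (p.1.1, p.1.2, p.2) by case: p {h1 h2 h3 h4 h5 pt} => [[]].
rewrite pE in h5.
have rho2 : 0 < rho / 2 by rewrite divr_gt0.
have [x' [y' [h6 h7 h8]]] := @support_retained R m w m1 cw w0 ww p.1.1 p.1.2 p.2 t (rho / 2) h3 pt rho2 h5.
exists x', y'; split; [exact: dist_through h6 h1 rr1|exact: dist_through h7 h2 rr1|exact: h8].
Qed.

End consequences.

(** * Concavity of powers along a segment *)

Section second_derivative.
Context {R : realType}.

(** The point [1 - t] is the parameter of [conv t p q] on the segment from [p] to [q]. *)
Lemma convex_of_second_derivative (f df ddf : R -> R) :
  (forall s : R, 0 <= s <= 1 -> is_derive s (1 : R) f (df s)) ->
  (forall s : R, 0 < s < 1 -> is_derive s (1 : R) df (ddf s)) ->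
  (forall s : R, 0 < s < 1 -> 0 <= ddf s) ->
  forall t : {i01 R}, f (1 - t%:num) <= t%:num * f 0 + (1 - t%:num) * f 1.
Proof.
move=> Df Ddf ddf0 t.
have cf (s : R) : 0 <= s <= 1 -> f x @[x --> s] --> f s.
  move=> /Df[/derivable1_diffP + _]; exact: differentiable_continuous.
have DDf (s : R) : 0 < s < 1 -> is_derive s (1 : R) ('D_1 f) (ddf s).
  move=> s01; apply: (near_eq_is_derive _ (Ddf _ s01)).
  case/andP: s01 => s0 s1; near=> x.
  have x01 : 0 <= x <= 1.
    by apply/andP; split; apply: ltW; near: x; [exact: lt_nbhsr|exact: lt_nbhsl].
  by have [_ ->] := Df _ x01.
have H := @second_derivative_convex R f 0 1.
have E : 1 - t%:num = conv t (0 : R^o) 1 by rewrite convRE mulr0 add0r mulr1.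
rewrite {1}E.
apply: (le_trans (H _ _ _ _ _ t ler01)) => //.
- by move=> x x01; have [_ ->] := DDf x x01; exact: ddf0.
- by apply: cvg_at_left_filter; apply: cf; rewrite ler01 lexx.
- by apply: cvg_at_right_filter; apply: cf; rewrite ler01 lexx.
- by move=> x; rewrite in_itv/= => /andP[x0 x1]; have [] := Df x _; rewrite ?(ltW x0) ?(ltW x1).
- by move=> x; rewrite in_itv/= => /DDf[].
Unshelve. all: end_near. Qed.

Lemma is_derive_monomial (f : R -> R) (n : nat) (x df : R) :
  is_derive x (1 : R) f df -> is_derive x (1 : R) (fun s => f s ^+ n.+1) (n.+1%:R * f x ^+ n * df).
Proof.
move=> D; rewrite (_ : (fun s => _) = f ^+ n.+1); first exact: (is_deriveX n.+1 D).
by apply/funext => s; rewrite exprfctE.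
Qed.

Lemma is_derive_powR_comp (al : R) (g : R -> R) (x dg : R) : 0 < g x ->
  is_derive x (1 : R) g dg ->
  is_derive x (1 : R) (fun s => g s `^ al) (al * g x `^ (al - 1) * dg).
Proof. by move=> g0 Dg; exact: (@is_derive1_comp R (fun y => y `^ al) g x _ _ (is_derive1_powR al g0) Dg). Qed.

Lemma is_derive_ln_comp (g : R -> R) (x dg : R) : 0 < g x ->
  is_derive x (1 : R) g dg -> is_derive x (1 : R) (fun s => ln (g s)) ((g x)^-1 * dg).
Proof. by move=> g0 Dg; exact: (@is_derive1_comp R (@ln R) g x _ _ (is_derive1_ln g0) Dg). Qed.

(** The second derivative of [g ^ al] is [al g ^ (al - 2) (g g'' - (1 - al) g' ^ 2)], and that of [ln g] has
    the same sign condition with [al = 0]. *)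
Lemma concave_power (al : R) (g dg ddg : R -> R) : 0 <= al ->
  (forall s : R, 0 <= s <= 1 -> 0 < g s) ->
  (forall s : R, is_derive s (1 : R) g (dg s)) ->
  (forall s : R, is_derive s (1 : R) dg (ddg s)) ->
  (forall s : R, 0 < s < 1 -> g s * ddg s <= (1 - al) * dg s ^+ 2) ->
  let phi := fun a : R => if al == 0 then ln a else a `^ al in
  forall t : {i01 R}, t%:num * phi (g 0) + (1 - t%:num) * phi (g 1) <= phi (g (1 - t%:num)).
Proof.
move=> al0 g0 Dg Ddg H phi t.
have g0' s : 0 < s < 1 -> 0 < g s by move=> /andP[? ?]; apply: g0; rewrite !ltW.
pose df s := if al == 0 then - ((g s)^-1 * dg s) else - (al * (g s `^ (al - 1) * dg s)).
pose ddf s := if al == 0 then - ((g s)^-1 ^+ 2 * (g s * ddg s - dg s ^+ 2)) else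
  - (al * (g s `^ (al - 2) * (g s * ddg s - (1 - al) * dg s ^+ 2))).
have := @convex_of_second_derivative (fun s => - phi (g s)) df ddf _ _ _ t.
rewrite !mulrN -opprD lerN2; apply.
- move=> s s01; rewrite /df /phi; have [_|_] := eqVneq al 0.
    exact: is_deriveN (is_derive_ln_comp (g0 _ s01) (Dg s)).
  by rewrite mulrA; exact: is_deriveN (is_derive_powR_comp al (g0 _ s01) (Dg s)).
- move=> s /g0' gs; rewrite /df /ddf; have [_|_] := eqVneq al 0.
    have gn0 : g s != 0 by rewrite gt_eqF.
    apply: is_derive_eq (is_deriveN (is_deriveM (is_deriveV gn0 (Dg s)) (Ddg s))) _.
    by rewrite -![_ *: _]/(_ * _); field.
  have E : g s `^ (al - 1) = g s `^ (al - 2) * g s.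
    rewrite -{3}(powRr1 (ltW gs)) -powRD; last by apply/implyP => _; rewrite gt_eqF.
    by congr (_ `^ _); ring.
  have D := is_derive_powR_comp (al - 1) gs (Dg s).
  apply: is_derive_eq (is_deriveN (is_deriveZ al (is_deriveM D (Ddg s)))) _.
  rewrite -![_ *: _]/(_ * _) E (_ : al - 1 - 1 = al - 2); last by ring.
  by move: (_ `^ _) => P; ring.
- move=> s s01; rewrite /ddf; have := H s s01; have gs := g0' s s01.
  have [->|_] := eqVneq al 0.
    by rewrite subr0 mul1r -subr_le0 oppr_ge0 => /mulr_ge0_le0; apply; exact: sqr_ge0.
  rewrite -subr_le0 oppr_ge0 => h; rewrite mulr_ge0_le0// mulr_ge0_le0//; exact: powR_ge0.
Qed.

End second_derivative.

(** * The cell and its initial pressure *)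

Section domain.
Context {R : realType}.
Implicit Types p q : R * R.

(** Concave, and its zero set is flat to order 5 at the origin. *)
Definition depth p : R := p.2 - p.2 ^+ 2 - p.1 ^+ 6.
Definition cell : set (R * R) := [set p | 0 < depth p].
(** Convex, with a linear term that keeps its derivative positive on the cell. *)
Definition speed (eps x : R) : R := 1 + x / 2 + eps * x ^+ 2.
Definition initial_pressure (eps : R) p : R := depth p * speed eps p.1.

Lemma speed_bounds (eps x : R) : 0 <= eps <= 1 / 64 -> `|x| <= 1 -> 1 / 2 <= speed eps x <= 2.
Proof.
move=> /andP[e0 e1]; rewrite ler_norml => /andP[x1 x2].
have x20 := sqr_ge0 x; have x21 : x ^+ 2 <= 1 by nra.
have ex0 : 0 <= eps * x ^+ 2 by exact: mulr_ge0.
have ex1 : eps * x ^+ 2 <= 1 / 64 * 1 by exact: ler_pM.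
by rewrite /speed; apply/andP; split; lra.
Qed.

(** Multiplied by [1 - al], the difference of the two sides is the square of
    [(1 - al) h s' - al s h'] plus terms that the hypotheses make nonnegative. *)
Lemma product_concavity (al s ds dds h dh ddh : R) : al < 1 -> 0 < s -> 0 < h -> dds <= 0 ->
  (1 - al) * (h * ddh) <= (1 - 2 * al) * dh ^+ 2 ->
  s * h * ((s * ddh + dh * ds) + (h * dds + ds * dh)) <= (1 - al) * (s * dh + h * ds) ^+ 2.
Proof.
move=> al1 s0 h0 dds0 hh; have a0 : 0 < 1 - al by rewrite subr_gt0.
rewrite -(ler_pM2l a0).
have e1 : s ^+ 2 * ((1 - al) * (h * ddh)) <= s ^+ 2 * ((1 - 2 * al) * dh ^+ 2).
  by apply: ler_wpM2l => //; exact: sqr_ge0.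
have e2 : (1 - al) * (s * h ^+ 2) * dds <= 0.
  by apply: mulr_ge0_le0 => //; rewrite mulr_ge0 ?mulr_ge0 ?sqr_ge0// ltW.
rewrite -subr_ge0; have := sqr_ge0 ((1 - al) * (h * ds) - al * (s * dh)) => e3.
have -> : (1 - al) * ((1 - al) * (s * dh + h * ds) ^+ 2) -
    (1 - al) * (s * h * (s * ddh + dh * ds + (h * dds + ds * dh))) =
  ((1 - al) * (h * ds) - al * (s * dh)) ^+ 2 +
  (s ^+ 2 * ((1 - 2 * al) * dh ^+ 2) - s ^+ 2 * ((1 - al) * (h * ddh))) -
  (1 - al) * (s * h ^+ 2) * dds by ring.
by apply: addr_ge0; [apply: addr_ge0 => //; rewrite subr_ge0|rewrite oppr_ge0].
Qed.

Section line.
Variables a b c e : R.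

Let X (s : R) := b * s + a.
Let Y (s : R) := e * s + c.
Let S (s : R) := Y s - Y s ^+ 2 - X s ^+ 6.
Let dS (s : R) := e - 2 * Y s * e - 6 * X s ^+ 5 * b.
Let ddS (s : R) := - (2 * e ^+ 2 + 30 * X s ^+ 4 * b ^+ 2).

Let DX (s : R) : is_derive s (1 : R) X b. Proof. exact: is_derive_line. Qed.
Let DY (s : R) : is_derive s (1 : R) Y e. Proof. exact: is_derive_line. Qed.

Let is_derive_S (s : R) : is_derive s (1 : R) S (dS s).
Proof.
apply: is_derive_eq (is_deriveB (is_deriveB (DY s) (is_derive_monomial 1 (DY s)))
  (is_derive_monomial 5 (DX s))) _.
by rewrite /dS expr1.
Qed.

Let is_derive_dS (s : R) : is_derive s (1 : R) dS (ddS s).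
Proof.
pose f (s : R) := (- 2 * e) * Y s + (- 6 * b) * X s ^+ 5 + e.
have D : is_derive s (1 : R) f ((- 2 * e) * e + (- 6 * b) * (5%:R * X s ^+ 4 * b) + 0).
  exact: is_deriveD (is_deriveD (is_deriveZ (- 2 * e) (DY s))
    (is_deriveZ (- 6 * b) (is_derive_monomial 4 (DX s)))) (is_derive_cst e s (1 : R)).
rewrite (_ : dS = f); first by apply: is_derive_eq D _; rewrite /ddS; ring.
by apply/funext => r; rewrite /dS /f; ring.
Qed.

Let ddS_le0 (s : R) : ddS s <= 0.
Proof.
rewrite oppr_le0; have := sqr_ge0 e; have : 0 <= X s ^+ 4 * b ^+ 2.
  by rewrite mulr_ge0// ?sqr_ge0// exprn_even_ge0.
by move: (X s ^+ 4) (b ^+ 2) (e ^+ 2) => u v w; lra.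
Qed.

Lemma depth_line_concave (t : {i01 R}) :
  t%:num * S 0 + (1 - t%:num) * S 1 <= S (1 - t%:num).
Proof.
have := @convex_of_second_derivative R (fun s => - S s) (fun s => - dS s) (fun s => - ddS s) _ _ _ t.
rewrite !mulrN -opprD lerN2; apply => s _; last by rewrite oppr_ge0; exact: ddS_le0.
  exact: (is_deriveN (is_derive_S s)).
exact: (is_deriveN (is_derive_dS s)).
Qed.

Variables al eps : R.
Hypotheses (al0 : 0 <= al) (al2 : al < 1 / 2).
Hypothesis epsE : eps = (1 - 2 * al) / 64.

Let H (s : R) := speed eps (X s).
Let dH (s : R) := b * (1 / 2 + 2 * eps * X s).
Let ddH : R := 2 * eps * b ^+ 2.

Let is_derive_H (s : R) : is_derive s (1 : R) H (dH s).
Proof.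
have := is_derive_square (eps * b ^+ 2) (b / 2 + 2 * eps * a * b) (1 + a / 2 + eps * a ^+ 2) s.
rewrite (_ : 2 * _ * _ + _ = dH s); last by rewrite /dH /X; field.
by congr is_derive; apply/funext => r; rewrite /H /speed /X; field.
Qed.

Let is_derive_dH (s : R) : is_derive s (1 : R) dH ddH.
Proof.
have := is_derive_line (2 * eps * b ^+ 2) (b * (1 / 2 + 2 * eps * a)) s.
by congr is_derive; apply/funext => r; rewrite /dH /X; field.
Qed.

(** Here [speed] is at most 2 and its derivative at least 15/32, whereas its second derivative is
    [(1 - 2 al) / 32]; this is the hypothesis of [product_concavity]. *)
Lemma pressure_line_concave (t : {i01 R}) :
  (forall s, 0 <= s <= 1 -> 0 < S s) -> (forall s, 0 <= s <= 1 -> `|X s| <= 1) ->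
  let phi := fun a : R => if al == 0 then ln a else a `^ al in
  t%:num * phi (S 0 * H 0) + (1 - t%:num) * phi (S 1 * H 1) <=
  phi (S (1 - t%:num) * H (1 - t%:num)).
Proof.
move=> S0 X1.
have eps1 : 0 <= eps <= 1 / 64 by move: al0 al2; rewrite epsE => ? ?; apply/andP; split; lra.
have H0 (s : R) : 0 <= s <= 1 -> 0 < H s.
  by move=> /X1 /(speed_bounds eps1)/andP[h _]; apply: lt_le_trans h; rewrite divr_gt0.
apply: (@concave_power R al (fun s => S s * H s) (fun s => S s * dH s + H s * dS s)
  (fun s => (S s * ddH + dH s * dS s) + (H s * ddS s + dS s * dH s)) al0 _ _ _ _ t).
- by move=> s s01; apply: mulr_gt0; [exact: S0|exact: H0].
- by move=> s; exact: (is_deriveM (is_derive_S s) (is_derive_H s)).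
- move=> s; exact: (is_deriveD (is_deriveM (is_derive_S s) (is_derive_dH s))
    (is_deriveM (is_derive_H s) (is_derive_dS s))).
- move=> s /andP[s0 s1]; have s01 : 0 <= s <= 1 by rewrite !ltW.
  apply: product_concavity; [|exact: S0|exact: H0|exact: ddS_le0|].
    by apply: lt_trans al2 _; rewrite ltr_pdivrMr// mul1r ltr1n.
  have /andP[_ h2] := speed_bounds eps1 (X1 _ s01).
  have := X1 _ s01; rewrite ler_norml => /andP[x1 x2].
  have w1 : - (1 / 64) <= eps * X s by case/andP: eps1 => h0 h1; have := ler_wpM2l h0 x1; lra.
  have -> : (1 - al) * (H s * ddH) = (1 - 2 * al) * (b ^+ 2 * ((1 - al) * H s / 32)).
    by rewrite /ddH epsE; field.
  rewrite /dH exprMn; apply: ler_wpM2l; first by move: al2; lra.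
  apply: ler_wpM2l; first exact: sqr_ge0.
  have a1 : (1 - al) * H s <= 1 * 2.
    by apply: ler_pM => //; [move: al2; lra|exact: ltW (H0 _ s01)|move: al0; lra].
  have : 15 / 32 <= 1 / 2 + 2 * eps * X s by lra.
  by move: (1 / 2 + 2 * eps * X s) => u; nra.
Qed.

End line.
End domain.

Section cell.
Context {R : realType}.
Implicit Types p q : R * R.

Lemma conv_plane (t : {i01 R}) p q :
  conv t (p : convex_lmodType (R * R)%type) q =
  ((q.1 - p.1) * (1 - t%:num) + p.1, (q.2 - p.2) * (1 - t%:num) + p.2).
Proof.
have E (a b : R) : t%:num * a + (1 - t%:num) * b = (b - a) * (1 - t%:num) + a by ring.
by case: p q => [a c] [b e]; rewrite -!E.
Qed.

Lemma depth_conv (t : {i01 R}) p q : t%:num * depth p + (1 - t%:num) * depth q <=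
  depth (conv t (p : convex_lmodType (R * R)%type) q).
Proof.
have := depth_line_concave p.1 (q.1 - p.1) p.2 (q.2 - p.2) t.
by rewrite !mulr0 !add0r !mulr1 !subrK conv_plane.
Qed.

Lemma cell_bounds p : 0 <= depth p -> [/\ `|p.1| <= 1, 0 <= p.2 & p.2 <= 1].
Proof.
rewrite /depth => h; have x6 : 0 <= p.1 ^+ 6 by exact: exprn_even_ge0.
have [y0 y1] : 0 <= p.2 /\ p.2 <= 1 by split; nra.
split => //; rewrite leNgt; apply/negP => x1.
have : 1 < `|p.1| ^+ 6 by rewrite exprn_egt1.
by rewrite -normrX ger0_norm//; nra.
Qed.

Lemma cell_boundsW p : 0 < depth p -> [/\ `|p.1| <= 1, 0 < p.2 & p.2 < 1].
Proof.
move=> h; have [x1 y0 y1] := cell_bounds (ltW h).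
have x6 : 0 <= p.1 ^+ 6 by exact: exprn_even_ge0.
by split=> //; move: h; rewrite /depth; nra.
Qed.

Lemma itv01_bounds (t : {i01 R}) : 0 <= t%:num <= 1.
Proof. by apply/andP; split; [exact: ge0|exact: le1]. Qed.

Lemma convex_combination_gt0 (t a b : R) : 0 <= t <= 1 -> 0 < a -> 0 < b -> 0 < t * a + (1 - t) * b.
Proof.
move=> /andP[t0 t1] a0 b0; have [->|tn0] := eqVneq t 0; first by rewrite mul0r add0r subr0 mul1r.
apply: ltr_pwDl; first by rewrite mulr_gt0// lt0r tn0.
by rewrite mulr_ge0 ?subr_ge0// ltW.
Qed.

Lemma convex_cell : @convex_set R (R * R)%type (@cell R).
Proof.
move=> p q t; rewrite !inE /cell /= => hp hq.
exact: lt_le_trans (convex_combination_gt0 (itv01_bounds t) hp hq) (depth_conv t p q).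
Qed.

Lemma initial_pressure_gt0 (eps : R) p : 0 <= eps <= 1 / 64 -> 0 < depth p -> 0 < initial_pressure eps p.
Proof.
move=> e01 h; apply: mulr_gt0 => //; have [x1 _ _] := cell_boundsW h.
by have /andP[s _] := speed_bounds e01 x1; apply: lt_le_trans s; rewrite divr_gt0.
Qed.

Lemma alpha_concave_initial_pressure (al eps : R) : 0 <= al -> al < 1 / 2 -> eps = (1 - 2 * al) / 64 ->
  alpha_concave al (@cell R) (initial_pressure eps).
Proof.
move=> al0 al2 epsE.
have e01 : 0 <= eps <= 1 / 64 by rewrite epsE; apply/andP; split; lra.
split; first by move=> p; exact: initial_pressure_gt0.
split; first exact: convex_cell.
move=> t p q; rewrite !inE /cell /= => hp hq.
rewrite conv_plane; set phi := fun a : R => if al == 0 then ln a else a `^ al.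
pose a := p.1; pose b := q.1 - p.1; pose c := p.2; pose e := q.2 - p.2.
have seg (s : R) : 0 <= s <= 1 -> 0 < depth (b * s + a, e * s + c).
  move=> /andP[s0 s1]; have s0' : 0 <= 1 - s by rewrite subr_ge0.
  have s1' : 1 - s <= 1 by rewrite gerBl.
  pose t' := Itv01 s0' s1' : {i01 R}.
  have := convex_combination_gt0 (itv01_bounds t') hp hq.
  move=> /lt_le_trans/(_ (depth_conv t' p q)).
  by rewrite conv_plane /= opprB addrCA subrr addr0.
have X1 (s : R) : 0 <= s <= 1 -> `|b * s + a| <= 1 by move=> /seg/cell_boundsW[].
have := pressure_line_concave al0 al2 epsE t seg X1.
rewrite !mulr0 !add0r !mulr1 /b /e !subrK -/b -/e -/(phi _) => H.
rewrite -subr_ge0; set rhs := conv _ _ _.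
have -> : rhs = - (t%:num * phi (initial_pressure eps p) + (1 - t%:num) * phi (initial_pressure eps q)).
  by rewrite /rhs convRE /= !mulrN opprD.
by rewrite opprK addrC subr_ge0; exact: H.
Qed.

End cell.

Section cell_geometry.
Context {R : realType}.
Implicit Types p q v : R * R.
Notation plane := (R * R)%type.

Lemma smooth1_id : smooth1 (fun s : R => s).
Proof. exact: (@smooth1_primitive _ _ (cst 1) (@smooth1_cst _ 1) (fun x => is_derive_id x 1)). Qed.

Definition polynomial_fun : (plane -> R) -> Prop := smooth_alg (@smooth_coordinates R plane).

Lemma polynomial_fst : polynomial_fun fst.
Proof. by apply: smooth_alg_gen; exists fst, (fun s => s); split => //; [exact: coordinate_fst|exact: smooth1_id]. Qed.

Lemma polynomial_snd : polynomial_fun snd.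
Proof. by apply: smooth_alg_gen; exists snd, (fun s => s); split => //; [exact: coordinate_snd|exact: smooth1_id]. Qed.

Lemma polynomialX (f : plane -> R) n : polynomial_fun f -> polynomial_fun (fun p => f p ^+ n).
Proof.
move=> pf; elim: n => [|n ih]; first exact: smooth_alg_cst 1.
by rewrite (_ : (fun p => _) = fun p => f p * f p ^+ n); [exact: smooth_alg_mul|apply/funext => p; rewrite exprS].
Qed.

Lemma polynomial_depth : polynomial_fun depth.
Proof.
rewrite (_ : depth = fun p : plane => p.2 + (cst (-1) p * p.2 ^+ 2 + cst (-1) p * p.1 ^+ 6)).
  apply: smooth_alg_add; first exact: polynomial_snd.
  apply: smooth_alg_add; apply: smooth_alg_mul; try exact: (smooth_alg_cst _ (-1)).
    exact: polynomialX polynomial_snd.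
  exact: polynomialX polynomial_fst.
by apply/funext => p; rewrite /depth /= !mulN1r addrA.
Qed.

Lemma polynomial_speed (eps : R) : polynomial_fun (fun p => speed eps p.1).
Proof.
rewrite (_ : (fun p => _) = fun p : plane => cst 1 p + (cst (1 / 2) p * p.1 + cst eps p * p.1 ^+ 2)).
  apply: smooth_alg_add; first exact: (smooth_alg_cst _ 1).
  apply: smooth_alg_add; apply: smooth_alg_mul.
  - exact: (smooth_alg_cst _ (1 / 2)).
  - exact: polynomial_fst.
  - exact: (smooth_alg_cst _ eps).
  - exact: polynomialX polynomial_fst.
by apply/funext => p; rewrite /speed /= addrA mulrC div1r.
Qed.

Lemma polynomial_initial_pressure (eps : R) : polynomial_fun (initial_pressure eps).
Proof.
by apply: smooth_alg_mul; [exact: polynomial_depth|exact: polynomial_speed].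
Qed.

Lemma smooth_polynomial (f : plane -> R) : polynomial_fun f -> smooth_on setT f.
Proof. exact: (smooth_alg_smooth (@smooth_coordinates_stable _ _)). Qed.

Lemma continuous_iter_derive (f : plane -> R) vs : polynomial_fun f -> continuous (iter_derive vs f).
Proof.
move=> pf p; apply: differentiable_continuous; exact: (smooth_polynomial pf vs).
Qed.

Lemma is_derive_coordinate (l : plane -> R) v p : coordinate l -> is_derive p v l (l v).
Proof.
move=> cl; apply: DeriveDef; first by apply: diff_derivable; exact: cl.1.
have Di := is_derive_id (l p) (1 : R).
have := @coordinate_derive _ _ l id p v cl (@ex_derive _ _ _ _ _ _ _ Di).
by rewrite derive1E (@derive_val _ _ _ _ _ _ _ Di) mulr1.
Qed.

Lemma is_derive_depth v p :
  is_derive p v depth (v.2 * (1 - 2 * p.2) - v.1 * (6 * p.1 ^+ 5)).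
Proof.
have D1 := is_derive_coordinate v p (@coordinate_fst R).
have D2 := is_derive_coordinate v p (@coordinate_snd R).
have := is_deriveB (is_deriveB D2 (is_deriveX 2 D2)) (is_deriveX 6 D1).
rewrite (_ : _ - _ - _ = depth :> (plane -> R)); last by apply/funext => r; rewrite /depth !exprfctE.
by move=> D; apply: is_derive_eq D _; rewrite -![_ *: _]/(_ * _) expr1; ring.
Qed.

Lemma closure_cell p : closure (@cell R) p -> 0 <= depth p.
Proof.
have cl : closed [set p : plane | 0 <= depth p].
  apply: (@preimage_closed _ _ depth [set x | 0 <= x]) => [q _|]; last exact: closed_ge.
  exact: (@continuous_iter_derive depth [::] polynomial_depth).
move=> /closureS-/(_ [set p : plane | 0 <= depth p]).
have /closure_id <- := cl; apply => q; exact: ltW.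
Qed.

Lemma open_cell : open (@cell R).
Proof.
apply: (@open_comp _ _ depth [set x | 0 < x]) => [q _|]; last exact: open_gt.
exact: (@continuous_iter_derive depth [::] polynomial_depth).
Qed.

Lemma boundary_cell p : boundary (@cell R) p -> depth p = 0.
Proof.
case=> /closure_cell h np; apply/eqP; rewrite eq_le h andbT leNgt; apply/negP => hp; apply: np.
by move: (open_cell); rewrite openE; exact.
Qed.

Lemma bounded_cell : bounded_set (@cell R).
Proof.
exists 1; split; first exact: real1.
move=> M M1 p /cell_boundsW[x1 y0 y1].
rewrite /= /Num.norm /= ge_max; apply/andP; split; first exact: le_trans x1 (ltW M1).
by rewrite gtr0_norm// ltW// (lt_trans y1).
Qed.

Lemma gradient_depth p : gradient depth p = (- (6 * p.1 ^+ 5), 1 - 2 * p.2).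
Proof.
rewrite /gradient !(@derive_val _ _ _ _ _ _ _ (is_derive_depth _ p)) /=.
by rewrite !mul0r !mul1r sub0r subr0.
Qed.

(** The only critical point of [depth] is its maximum, of value 1/4. *)
Lemma gradient_depth_neq0 p : depth p < 1 / 4 -> gradient depth p != 0.
Proof.
rewrite gradient_depth => h; apply/eqP => -[/eqP]; rewrite oppr_eq0 mulf_eq0 pnatr_eq0 /= expf_eq0 /=.
move=> /eqP x0 y0; move: h; rewrite /depth x0 expr0n /= subr0.
have -> : p.2 = 1 / 2 by lra.
by rewrite (_ : 1 / 2 - (1 / 2) ^+ 2 = 1 / 4 :> R) ?ltxx//; field.
Qed.

Lemma smooth_boundary_cell : has_smooth_boundary (@cell R).
Proof.
move=> p /boundary_cell p0; exists [set q | depth q < 1 / 4], (fun q => - depth q); split.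
- apply: (@open_comp _ _ depth [set x | x < 1 / 4]) => [q _|]; last exact: open_lt.
  exact: (@continuous_iter_derive depth [::] polynomial_depth).
- by rewrite /= p0 divr_gt0.
- have : smooth_on setT (fun q : plane => cst (-1) q * depth q).
    by apply: smooth_polynomial; apply: smooth_alg_mul; [exact: (smooth_alg_cst _ (-1))|exact: polynomial_depth].
  rewrite (_ : (fun q => _) = fun q => - depth q); last by apply/funext => q; rewrite /= mulN1r.
  by move=> sm vs q _; exact: sm.
- move=> q /gradient_depth_neq0; apply: contra_neq => g0.
  have E v : 'D_v (fun q : plane => - depth q) q = - 'D_v depth q.
    by rewrite (@derive_val _ _ _ _ _ _ _ (is_deriveN (is_derive_depth v q)))
      (@derive_val _ _ _ _ _ _ _ (is_derive_depth v q)).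
  move: g0; rewrite /gradient !E => -[g1 g2].
  have /= E1 := oppr_inj (etrans g1 (esym (oppr0 R))).
  have /= E2 := oppr_inj (etrans g2 (esym (oppr0 R))).
  by rewrite E1 E2.
- by move=> q _; rewrite /cell /= oppr_lt0.
Qed.

Variable eps : R.
Hypothesis eps01 : 0 <= eps <= 1 / 64.

(** On the boundary only the derivative of the factor [depth] survives. *)
Lemma gradient_initial_pressure_neq0 p : depth p = 0 -> gradient (initial_pressure eps) p != 0.
Proof.
move=> p0; have [x1 _ _] := cell_bounds (eq_ind_r (fun a => 0 <= a) (lexx 0) p0).
have /andP[s0 _] := speed_bounds eps01 x1.
have s1 : 0 < speed eps p.1 by apply: lt_le_trans s0; rewrite divr_gt0.
have ds v : is_derive p v (fun q : plane => speed eps q.1) ('D_v (fun q : plane => speed eps q.1) p).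
  apply: DeriveDef => //; apply: diff_derivable.
  exact: (smooth_polynomial (polynomial_speed eps) [::]).
have E v : 'D_v (initial_pressure eps) p = speed eps p.1 * 'D_v depth p.
  have := @derive_val _ _ _ _ _ _ _ (is_deriveM (is_derive_depth v p) (ds v)).
  rewrite (@derive_val _ _ _ _ _ _ _ (is_derive_depth v p)) p0 scale0r add0r; exact.
have : gradient depth p != 0 by apply: gradient_depth_neq0; rewrite p0 divr_gt0.
apply: contra_neq; rewrite /gradient !E => -[g1 g2].
have /= E1 := mulfI (lt0r_neq0 s1) (etrans g1 (esym (mulr0 _))).
have /= E2 := mulfI (lt0r_neq0 s1) (etrans g2 (esym (mulr0 _))).
by rewrite E1 E2.
Qed.

Lemma smooth_initial_pressure : smooth_upto_boundary (@cell R) (initial_pressure eps).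
Proof.
have pv := polynomial_initial_pressure eps; split.
- by move=> vs p _; exact: (smooth_polynomial pv vs).
- by apply: continuous_subspaceT; exact: (@continuous_iter_derive _ [::] pv).
- move=> vs; exists (iter_derive vs (initial_pressure eps)) => //.
  by apply: continuous_subspaceT; exact: (@continuous_iter_derive _ vs pv).
Qed.

Lemma extends_gradient_initial_pressure :
  extends_gradient (@cell R) (initial_pressure eps) (gradient (initial_pressure eps)).
Proof.
split => //; apply: continuous_subspaceT => p.
have pv := polynomial_initial_pressure eps.
have c1 := @continuous_iter_derive _ [:: (1, 0)] pv p.
have c2 := @continuous_iter_derive _ [:: (0, 1)] pv p.
exact: (cvg_pair c1 c2).
Qed.

End cell_geometry.

(** * Paraboloids around the initial pressure *)

Section initial_data.
Context {R : realType}.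
Implicit Types p q v : R * R.
Notation plane := (R * R)%type.
Variable eps : R.
Hypothesis eps01 : 0 <= eps <= 1 / 64.

Lemma patch_initial_pressure p :
  patch (cst 0) (closure (@cell R)) (initial_pressure eps) p = Num.max 0 (depth p) * speed eps p.1.
Proof.
rewrite patchE; have [h|h] := pselect (closure (@cell R) p).
  by rewrite mem_set// max_r//; exact: closure_cell.
rewrite memNset// max_l ?mul0r// leNgt; apply/negP => hp; apply: h.
exact: subset_closure.
Qed.

Lemma continuous_patched : continuous (fun p => Num.max 0 (depth p) * speed eps p.1).
Proof.
rewrite (_ : (fun p => _) = fun p => ppow 1 (depth p) * speed eps p.1).
  move=> p; apply: cvgM; last exact: (@continuous_iter_derive _ _ [::] (polynomial_speed eps)).
  apply: (@continuous_comp _ _ _ depth (ppow 1)).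
    exact: (@continuous_iter_derive _ depth [::] polynomial_depth).
  exact: continuous_ppow.
by apply/funext => p; rewrite /ppow powRr1// le_max lexx.
Qed.

Lemma density_of_pressure (m a b : R) : 1 < m -> 0 <= a -> b = pressure m a ->
  a = ppow (m - 1)^-1 (b / conjugate m).
Proof.
move=> m1 a0 ->; have q0 := conjugate_gt0 m1.
rewrite /pressure -/(conjugate m) mulrAC divff ?gt_eqF// mul1r ppow_gt0E ?powR_ge0//.
by rewrite -powRrM mulfV ?powRr1// gt_eqF// subr_gt0.
Qed.

(** The pressure determines the density, which inherits the continuity of the initial pressure. *)
Lemma continuous_density (m : R) (u0 : plane -> R) : 1 < m -> (forall p, 0 <= u0 p) ->
  (forall p, patch (cst 0) (closure (@cell R)) (initial_pressure eps) p = pressure m (u0 p)) ->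
  continuous u0.
Proof.
move=> m1 u00 H.
rewrite (_ : u0 = fun p => ppow (m - 1)^-1 (Num.max 0 (depth p) * speed eps p.1 / conjugate m)).
  move=> p; apply: (@continuous_comp _ _ _ (fun p => Num.max 0 (depth p) * speed eps p.1 / conjugate m)).
    by apply: cvgM; [exact: continuous_patched|exact: cvg_cst].
  by apply: continuous_ppow; rewrite invr_gt0 subr_gt0.
by apply/funext => p; apply: density_of_pressure => //; rewrite -patch_initial_pressure H.
Qed.

Lemma initial_below_front x y :
  Num.max 0 (depth (x, y)) * speed eps x <= Num.max 0 (y + (x ^+ 2 + y ^+ 2)).
Proof.
have [h|h] := leP (depth (x, y)) 0; first by rewrite mul0r le_max lexx.
have [x1 y0 y1] := cell_boundsW h; rewrite /= in x1 y0 y1.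
have [e0 e1] := andP eps01.
have /andP[s0 _] := speed_bounds eps01 x1.
rewrite le_max; apply/orP; right.
apply: (@le_trans _ _ (y * speed eps x)).
  apply: ler_wpM2r; first by apply: le_trans s0; rewrite divr_ge0.
  rewrite /depth /= -subr_ge0 !opprB addrA addrAC; have := sqr_ge0 y.
  by have : 0 <= x ^+ 6 by [exact: exprn_even_ge0]; lra.
have h1 : eps * x ^+ 2 * y <= 1 / 64 * x ^+ 2 * 1.
  apply: ler_pM => //; [by rewrite mulr_ge0// sqr_ge0|exact: ltW|by rewrite ler_wpM2r ?sqr_ge0|exact: ltW].
have := sqr_ge0 (x - y); have := sqr_ge0 x; have := sqr_ge0 y.
by rewrite /speed; lra.
Qed.

(** Convexity of the square and of the cube. *)
Lemma sum_pow6 (a b : R) : (a + b) ^+ 6 <= 32 * (a ^+ 6 + b ^+ 6).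
Proof.
have h1 (u v : R) : 0 <= u -> 0 <= v -> (u + v) ^+ 3 <= 4 * (u ^+ 3 + v ^+ 3).
  move=> u0 v0; rewrite -subr_ge0.
  rewrite (_ : _ - _ = 3 * ((u + v) * (u - v) ^+ 2)); last by ring.
  by apply: mulr_ge0 => //; apply: mulr_ge0; [exact: addr_ge0|exact: sqr_ge0].
have h2 : (a + b) ^+ 2 <= 2 * (a ^+ 2 + b ^+ 2).
  by have := sqr_ge0 (a - b); rewrite -subr_ge0 => ?; lra.
rewrite (exprM _ 2 3).
apply: (@le_trans _ _ ((2 * (a ^+ 2 + b ^+ 2)) ^+ 3)).
  by rewrite lerXn2r ?nnegrE ?sqr_ge0// mulr_ge0 ?addr_ge0 ?sqr_ge0.
rewrite exprMn; have := h1 _ _ (sqr_ge0 a) (sqr_ge0 b); rewrite -!exprM; clear -eps01; lra.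
Qed.

(** The vertex is lifted by [64 * x0 ^+ 6] to compensate [32 * x0 ^+ 6] from [sum_pow6] and the square of
    the lift itself. *)
Lemma depth_lower (x0 x y : R) : `|x0| <= 1 / 4 -> `|x - x0| <= 1 ->
  y - 64 * x0 ^+ 6 - 32 * ((x - x0) ^+ 2 + (y - 64 * x0 ^+ 6) ^+ 2) <= depth (x, y).
Proof.
move=> hx0 hX; rewrite /depth /=; set s := x0 ^+ 6.
have s0 : 0 <= s by exact: exprn_even_ge0.
have s1 : s <= 1 / 256.
  apply: (@le_trans _ _ ((1 / 4) ^+ 6)); last by lra.
  by rewrite -[s]ger0_norm// normrX lerXn2r ?nnegrE.
have hs : 8192 * s ^+ 2 <= 32 * s by nra.
have := sum_pow6 (x - x0) x0; rewrite subrK -/s => h6.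
have X2 : (x - x0) ^+ 6 <= (x - x0) ^+ 2.
  have : (x - x0) ^+ 2 <= 1 by rewrite -real_normK ?num_real// expr_le1.
  by rewrite (exprM _ 2 3); have := sqr_ge0 (x - x0); move: (_ ^+ 2) => u; nra.
have y2 := sqr_ge0 (y - 64 * s - 64 * s).
have Y2 := sqr_ge0 (y - 64 * s).
move: h6 X2; set A := (x - x0) ^+ 6; set B := (x - x0) ^+ 2; set E := x ^+ 6 => h6 X2.
have e1 : y ^+ 2 <= 2 * (y - 64 * s) ^+ 2 + 8192 * s ^+ 2 by move: y2; clear -eps01; lra.
by move: e1 h6 X2 hs Y2; clear -eps01; lra.
Qed.

(** The curvature 40 exceeds the 32 of [depth_lower] by enough to absorb the variation of [speed]. *)
Lemma initial_above_front (x0 x y : R) : `|x0| <= 1 / 4 -> `|x| < 2 ->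
  speed eps x0 * Num.max 0 (y - 64 * x0 ^+ 6 + - 40 * ((x - x0) ^+ 2 + (y - 64 * x0 ^+ 6) ^+ 2)) <=
  Num.max 0 (depth (x, y)) * speed eps x.
Proof.
move=> hx0 hx; set Y := y - 64 * x0 ^+ 6; set X := x - x0.
have [e0 e1] := andP eps01.
have hx01 : `|x0| <= 1 by apply: (le_trans hx0); clear -eps01; lra.
have /andP[a1 a2] := speed_bounds eps01 hx01.
have sx : 0 <= speed eps x.
  have := mulr_ge0 e0 (sqr_ge0 x); move: hx; rewrite ltr_norml /speed => /andP[h1 h2]; move: h1 h2; clear -eps01; lra.
have [d0|d0] := leP (Y + - 40 * (X ^+ 2 + Y ^+ 2)) 0.
  by rewrite mulr0 mulr_ge0// le_max lexx.
have X2 := sqr_ge0 X; have Y2 := sqr_ge0 Y.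
have Y0 : 0 < Y by move: d0 X2 Y2; clear -eps01; lra.
have Y1 : Y < 1 / 40 by nra.
have X1 : X ^+ 2 <= 1 / 1600 by lra.
have {}X1 : `|X| <= 1 / 40.
  by rewrite -(@ler_pXn2r _ 2) ?nnegrE// real_normK ?num_real//; lra.
have D := @depth_lower x0 x y hx0 (le_trans X1 (_ : 1 / 40 <= 1)).
have {}D := D ltac:(lra); rewrite -/X -/Y in D.
have D0 : 0 <= Y - 32 * (X ^+ 2 + Y ^+ 2) by lra.
have S : speed eps x0 - `|X| <= speed eps x.
  have -> : speed eps x = speed eps x0 + X * (1 / 2 + eps * (x + x0)) by rewrite /speed /X; field.
  rewrite lerD2l lerNl; apply: le_trans (ler_norm _) _.
  rewrite normrN normrM ler_piMr// ler_norml.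
  move: hx hx0; rewrite ltr_norml ler_norml => /andP[? ?] /andP[? ?].
  have b1 : `|eps * (x + x0)| <= 1 / 64 * 3.
    rewrite normrM (ger0_norm e0); apply: ler_pM => //.
    by rewrite ler_norml; apply/andP; split; lra.
  by move: b1; rewrite ler_norml; clear -eps01; move=> /andP[? ?]; apply/andP; split; lra.
have S0 : 0 <= speed eps x0 - `|X| by lra.
apply: (@le_trans _ _ ((Y - 32 * (X ^+ 2 + Y ^+ 2)) * (speed eps x0 - `|X|))); last first.
  by apply: ler_pM => //; rewrite le_max D orbT.
have XY : Y * `|X| <= 1 / 2 * (X ^+ 2 + Y ^+ 2).
  by have := sqr_ge0 (`|X| - Y); rewrite sqrrB real_normK ?num_real//; clear -eps01; lra.
have ZX : 0 <= (X ^+ 2 + Y ^+ 2) * `|X| by rewrite mulr_ge0 ?addr_ge0.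
have aZ : 1 / 2 * (X ^+ 2 + Y ^+ 2) <= speed eps x0 * (X ^+ 2 + Y ^+ 2).
  by apply: ler_wpM2r => //; exact: addr_ge0.
by move: XY ZX aZ X2 Y2; clear -eps01; lra.
Qed.

End initial_data.

(** * The support is not convex *)

Section nonconvexity.
Context {R : realType}.

(** 161 exceeds [40 * 2 ^ 2], so that the term quadratic in [z] is absorbed. *)
Lemma front_depth (a C T z : R) : a <= 2 -> 1 / 2 <= a -> 0 <= C -> 0 < T -> (C + 161) * T <= 1 / 2 ->
  z = a * T - (C + 161) * T ^+ 2 ->
  [/\ 0 <= z, z <= 2 * T & z + 40 * z ^+ 2 < a * T - C * T ^+ 2].
Proof.
move=> a2 a1 C0 T0 CT zE.
have h1 : (C + 161) * T ^+ 2 <= a * T.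
  by rewrite expr2 mulrA; apply: ler_wpM2r; [exact: ltW|exact: le_trans a1].
have h2 : 0 <= (C + 161) * T ^+ 2 by rewrite mulr_ge0 ?sqr_ge0// addr_ge0.
have z0 : 0 <= z by rewrite zE subr_ge0.
have aT : a * T <= 2 * T by rewrite ler_wpM2r// ltW.
have z2 : z <= 2 * T by rewrite zE; lra.
split => //; have zz : z ^+ 2 <= 4 * T ^+ 2.
  by rewrite (_ : 4 * T ^+ 2 = (2 * T) ^+ 2); [rewrite lerXn2r ?nnegrE// mulr_ge0// ltW|ring].
have : 0 < T ^+ 2 by rewrite exprn_gt0.
by rewrite zE in zz *; lra.
Qed.

(** The mean of the two speeds is [1 + eps s ^ 2]. By the choice of [K] the gain [eps K t ^ 2] outweighs the
    errors of order [t ^ 2], which are [C4 + 4 C] and a numerical constant, while the lift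
    [64 s ^ 6 = 64 K ^ 3 t ^ 3] is at most [t ^ 2]. *)
Lemma midpoint_below_front (eps C C4 K t s x1 y1 x2 y2 : R) :
  0 <= C -> 0 <= C4 -> eps * K = 15 + C4 + 4 * C -> 0 <= eps <= 1 / 64 -> 0 <= K ->
  0 < t -> t <= 1 / 4 -> K * t <= 1 / 16 -> 64 * K ^+ 3 * t <= 1 -> s ^+ 2 = K * t ->
  let T := t - t ^+ 2 in
  `|x1 - s| < t ^+ 2 -> `|x2 - - s| < t ^+ 2 ->
  `|y1 - (64 * s ^+ 6 - (speed eps s * T - C4 * T ^+ 2))| < t ^+ 2 ->
  `|y2 - (64 * (- s) ^+ 6 - (speed eps (- s) * T - C4 * T ^+ 2))| < t ^+ 2 ->
  let x := (x1 + x2) / 2 in let y := (y1 + y2) / 2 in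
  [/\ `|x| <= 2, `|y| <= 2 &
      y + (x ^+ 2 + y ^+ 2) <= - (t + t ^+ 2) - C * (t + t ^+ 2) ^+ 2].
Proof.
move=> C0 C40 eK /andP[e0 e1] K0 t0 t14 Kt1 K3t sE T.
have tt0 : 0 < t ^+ 2 by rewrite exprn_gt0.
have tt1 : t ^+ 2 <= 1 / 4 * t by rewrite expr2 ler_wpM2r// ltW.
have -> : (- s) ^+ 6 = s ^+ 6 by rewrite (exprM _ 2 3) sqrrN -exprM.
set eta := 64 * s ^+ 6.
have etaE : eta = 64 * K ^+ 3 * t * t ^+ 2 by rewrite /eta (exprM _ 2 3) sE; ring.
have eta0 : 0 <= eta.
  by rewrite etaE; apply: mulr_ge0; [apply: mulr_ge0; [apply: mulr_ge0 => //; exact: exprn_ge0|exact: ltW]|exact: ltW].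
have eta1 : eta <= t ^+ 2 by rewrite etaE -[leRHS]mul1r ler_wpM2r// ltW.
set z1 := speed eps s * T - _; set z2 := speed eps (- s) * T - _.
have zE : (z1 + z2) / 2 = (1 + eps * K * t) * T - C4 * T ^+ 2.
  by rewrite /z1 /z2 /speed sqrrN sE; field.
have eKt : 0 <= eps * K * t <= 1 / 64 * (1 / 16).
  by rewrite -mulrA mulr_ge0 ?mulr_ge0 ?(ltW t0)//= ler_pM ?mulr_ge0 ?(ltW t0).
have T0 : 0 <= T by rewrite /T; lra.
have Tt : T <= t by rewrite /T; lra.
have TT : C4 * T ^+ 2 <= C4 * t ^+ 2 by rewrite ler_wpM2l// lerXn2r ?nnegrE// ltW.
have TT0 : 0 <= C4 * T ^+ 2 by rewrite mulr_ge0// sqr_ge0.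
have zlow : t - 2 * t ^+ 2 + (15 + C4 + 4 * C) * t ^+ 2 - C4 * t ^+ 2 <= (z1 + z2) / 2.
  have : eps * K * t * t ^+ 2 <= 1 * t ^+ 2 by rewrite ler_wpM2r ?(ltW tt0)//; case/andP: eKt => ? ?; lra.
  by rewrite zE -eK /T; move: TT; rewrite /T; lra.
have zup : (z1 + z2) / 2 <= 2 * t.
  have : (1 + eps * K * t) * T <= 2 * t.
    by apply: ler_pM => //; case/andP: eKt => ? ?; lra.
  by rewrite zE; lra.
clear zE; move: z1 z2 zlow zup => z1 z2 zlow zup.
rewrite !ltr_norml => /andP[a1 a2] /andP[b1 b2] /andP[c1 c2] /andP[d1 d2] x y.
have x12 : - (t ^+ 2) <= x <= t ^+ 2 by rewrite /x; move: a1 a2 b1 b2; clear => ? ? ? ?; apply/andP; split; lra.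
have Ct0 : 0 <= C * t ^+ 2 by rewrite mulr_ge0// ltW.
have y1' : y <= - t - (11 + 4 * C) * t ^+ 2 by rewrite /y; lra.
have y2' : - (3 * t) <= y by rewrite /y; lra.
have xx : x ^+ 2 <= t ^+ 2.
  have : x ^+ 2 <= (t ^+ 2) ^+ 2.
    by rewrite -[x ^+ 2]real_normK ?num_real// lerXn2r ?nnegrE ?(ltW tt0)// ler_norml.
  by rewrite [(t ^+ 2) ^+ 2]expr2 => h; apply: (le_trans h); rewrite ler_piMl ?(ltW tt0)//; lra.
have yy : y ^+ 2 <= 9 * t ^+ 2.
  rewrite (_ : 9 * t ^+ 2 = (3 * t) ^+ 2); last by ring.
  rewrite -[y ^+ 2]real_normK ?num_real// lerXn2r ?nnegrE//; first by rewrite mulr_ge0// ltW.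
  by rewrite ler_norml y2' /=; lra.
have tt : C * (t + t ^+ 2) ^+ 2 <= 4 * (C * t ^+ 2).
  have : (t + t ^+ 2) ^+ 2 <= (2 * t) ^+ 2.
    by rewrite lerXn2r ?nnegrE ?addr_ge0 ?mulr_ge0 ?(ltW t0) ?(ltW tt0)//; move: tt1 t14 t0; clear; lra.
  by move=> /(ler_wpM2l C0); lra.
split.
- case/andP: x12 => b1' b2'; rewrite ler_norml; move: b1' b2' tt1 t14; clear => ? ? ? ?.
  by apply/andP; split; lra.
- rewrite ler_norml; move: y1' y2' t14 t0 tt0 Ct0; clear => ? ? ? ? ? ?.
  by apply/andP; split; lra.
- by move: y1' xx yy tt; clear; lra.
Qed.

End nonconvexity.

Section conclusion.
Context {R : realType}.
Notation plane := (R * R)%type.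

Lemma pressure_gt0 (m a : R) : 1 < m -> 0 <= a -> (0 < pressure m a) = (0 < a).
Proof.
move=> m1 a0; rewrite /pressure pmulr_rgt0 ?conjugate_gt0//.
move: a0; rewrite le_eqVlt => /predU1P[<-|a0]; last by rewrite a0 powR_gt0.
by rewrite powR0 ?ltxx// gt_eqF// subr_gt0.
Qed.

Lemma midpoint_convex (A : set plane) (x1 y1 x2 y2 : R) : @convex_set R plane A ->
  A (x1, y1) -> A (x2, y2) -> A ((x1 + x2) / 2, (y1 + y2) / 2).
Proof.
move=> cA A1 A2; have h0 : (0 : R) <= 1 / 2 by rewrite divr_ge0.
have h1 : (1 / 2 : R) <= 1 by rewrite ler_pdivrMr// mul1r ler1n.
have := cA (x1, y1) (x2, y2) (Itv01 h0 h1); rewrite !inE => /(_ A1 A2).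
rewrite conv_plane /= (_ : (_, _) = ((x1 + x2) / 2, (y1 + y2) / 2))//.
by congr pair; field.
Qed.

Lemma small_distance (r z T : R) : 0 <= z -> z <= 2 * T -> 0 <= r -> r <= 1 / 2 -> T <= 1 / 4 ->
  `|r - z| <= 2.
Proof. by move=> ? ? ? ? ?; rewrite ler_norml; apply/andP; split; lra. Qed.

(** Barriers from below at [s] and [- s] give two points of the support, and the barrier from above
    shows that their midpoint is outside. *)
Lemma support_not_convex (m eps : R) (v : plane -> R -> R) : 1 < m -> 0 < eps <= 1 / 64 ->
  pressure_solution m (patch (cst 0) (closure (@cell R)) (initial_pressure eps)) v ->
  exists2 delta : R, 0 < delta &
    forall t, 0 < t -> t < delta -> ~ @convex_set R plane (positivity_set v t).
Proof.
move=> m1 /andP[e0 e1] [u0 [u [v0E usol uc vE]]].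
have e01 : 0 <= eps <= 1 / 64 by rewrite (ltW e0).
have cu0 : continuous u0 := continuous_density m1 (pme_u0_ge0 usol) v0E.
pose w := ubar u.
have cw : continuous w := continuous_ubar uc.
have w0 : forall z, 0 <= w z := ubar_ge0 usol.
have ww : weak_pme m w by move=> k1 k2 th N a b; exact: (weak_form m1 usol uc).
have wi x y : pressure m (w (x, y, 0)) = Num.max 0 (depth (x, y)) * speed eps x.
  by rewrite /w (initial_value usol uc (x, y) cu0) -v0E patch_initial_pressure.
have [C [T0 [C0 T00 low]]] := vanishing_below m1 cw w0 ww
  (fun x y _ _ => eq_ind_r (fun a => a <= _) (initial_below_front e01 x y) (wi x y)).
have k2 : (2 : R) <= 40 by rewrite ler_nat.
have [C' [T0' [C'0 T0'0 high]]] := positivity_above m1 cw w0 ww k2.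
(* [K] is chosen after all constants of the barriers, which do not depend on it. *)
pose C4 := C' + 161; pose K := (15 + C4 + 4 * C) / eps.
have C40 : 0 < C4 by rewrite /C4 addr_gt0.
have K0 : 0 < K by rewrite divr_gt0// /C4; lra.
have eK : eps * K = 15 + C4 + 4 * C by rewrite mulrC divfK// gt_eqF.
have K30 : 0 < 64 * K ^+ 3 by rewrite mulr_gt0// exprn_gt0.
pose D := 4 + 16 * K + 64 * K ^+ 3 + 2 * C4 + 2 / T0 + 1 / T0'.
have i1 : 0 < 2 / T0 by rewrite divr_gt0.
have i2 : 0 < 1 / T0' by rewrite divr_gt0.
have D0 : 0 < D by rewrite /D; lra.
exists D^-1; first by rewrite invr_gt0.
move=> t t0 tD cvx.
have tD1 : t * D < 1 by rewrite -ltr_pdivlMr// mul1r.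
have [t14 [Kt1 [K3t [C4t [tT0 tT0']]]]] : t <= 1 / 4 /\ (K * t <= 1 / 16 /\
    (64 * K ^+ 3 * t <= 1 /\ (C4 * t <= 1 / 2 /\ (2 / T0 * t <= 1 /\ 1 / T0' * t <= 1)))).
  have p1 := mulr_gt0 K0 t0; have p2 := mulr_gt0 K30 t0; have p3 := mulr_gt0 C40 t0.
  have p4 := mulr_gt0 i1 t0; have p5 := mulr_gt0 i2 t0.
  have : t * D = 4 * t + 16 * (K * t) + 64 * K ^+ 3 * t + 2 * (C4 * t) + 2 / T0 * t + 1 / T0' * t.
    by rewrite /D; ring.
  move: t0 p1 p2 p3 p4 p5 tD1; move: (2 / T0 * t) (1 / T0' * t) (64 * K ^+ 3 * t) (t * D) (K * t) (C4 * t).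
  by clear; move=> a b c d e f ? ? ? ? ? ? ? ?; do !split; lra.
(* The barriers from below stop at [T < t], which leaves time for [support_retained]; the one from
   above runs until [t + t ^+ 2], since it gives vanishing before its final time only. *)
pose s := Num.sqrt (K * t); pose T := t - t ^+ 2.
have sE : s ^+ 2 = K * t by rewrite sqr_sqrtr// mulr_ge0// ltW.
have tt0 : 0 < t ^+ 2 by rewrite exprn_gt0.
have tt1 : t ^+ 2 <= 1 / 4 * t by rewrite expr2 ler_wpM2r// ltW.
have s14 : `|s| <= 1 / 4.
  by rewrite -(@ler_pXn2r _ 2) ?nnegrE ?divr_ge0// real_normK ?num_real// sE; move: Kt1; clear; lra.
have T_gt0 : 0 < T by rewrite /T; move: tt1 t0; clear; lra.
have Tt : T < t by rewrite /T ltrBlDr ltrDl.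
have TT0' : 0 < T <= T0'.
  rewrite T_gt0 (le_trans (ltW Tt))//; move: tT0'; rewrite mulrAC ler_pdivrMr// mul1r mul1r.
  exact.
have CT : C4 * T <= 1 / 2 by apply: le_trans C4t; rewrite ler_pM2l// ltW.
have near_front (x0 : R) : `|x0| <= 1 / 4 -> exists x y, [/\ `|x - x0| < t ^+ 2,
    `|y - (64 * x0 ^+ 6 - (speed eps x0 * T - C4 * T ^+ 2))| < t ^+ 2 & 0 < w (x, y, t)].
  move=> hx0; have hx01 : `|x0| <= 1 by apply: (le_trans hx0); clear; lra.
  have /andP[a1 a2] := speed_bounds e01 hx01.
  pose z := speed eps x0 * T - C4 * T ^+ 2.
  have [z0 z2 zT] := front_depth a2 a1 (ltW C'0) T_gt0 CT (erefl z).
  have y0 : 0 <= 64 * x0 ^+ 6 by rewrite mulr_ge0// exprn_even_ge0.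
  have y1 : 64 * x0 ^+ 6 <= 1 / 2.
    have : x0 ^+ 6 <= (1 / 4) ^+ 6.
      by rewrite -[x0 ^+ 6]ger0_norm ?exprn_even_ge0// normrX lerXn2r ?nnegrE ?divr_ge0.
    by clear; lra.
  apply: (high (speed eps x0) x0 (64 * x0 ^+ 6) T z t (t ^+ 2)) => //.
  - by rewrite a1 a2.
  - by apply: (le_trans hx0); clear; lra.
  - by rewrite ger0_norm.
  - by move=> x y xL _; rewrite wi; exact: initial_above_front.
  - exact: small_distance z0 z2 y0 y1 (le_trans (ltW Tt) t14).
have [x1 [y1 [hx1 hy1 w1]]] := near_front s s14.
have [x2 [y2 [hx2 hy2 w2]]] : exists x y, _ := near_front (- s) (eq_ind_r (fun a => a <= _) s14 (normrN s)).
have [mx my mxy] := midpoint_below_front (ltW C0) (ltW C40) eK e01 (ltW K0) t0 t14 Kt1 K3t sE hx1 hx2 hy1 hy2.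
have pos x y : 0 < w (x, y, t) <-> positivity_set v t (x, y).
  rewrite /positivity_set /= (vE _ _ (ltW t0)) pressure_gt0//; last exact: (pme_ge0 usol (x, y) (ltW t0)).
  by rewrite /w (ubarE _ _ (ltW t0)).
have /pos := midpoint_convex cvx ((pos _ _).1 w1) ((pos _ _).1 w2).
have T'0 : 0 < t + t ^+ 2 <= T0.
  rewrite addr_gt0//=; apply: (@le_trans _ _ (2 * t)); first by move: tt1 t0; clear; lra.
  by move: tT0; rewrite mulrAC ler_pdivrMr// mul1r.
have tT' : 0 < t < t + t ^+ 2 by rewrite t0 ltrDl.
by rewrite (low _ _ _ t T'0 mx my mxy tT') ltxx.
Qed.

End conclusion.

Theorem theorem1p2 (R : realType) (m : R) (hm : 1 < m)
    (alpha : R) (halpha0 : 0 <= alpha) (halpha1 : alpha < 1 / 2) :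
  exists (Omega : set (R * R)) (v0 : R * R -> R),
    [/\ bounded_set Omega, open Omega, @convex_set R (R * R)%type Omega &
        has_smooth_boundary Omega] /\
    [/\ smooth_upto_boundary Omega v0,
        forall x, Omega x -> 0 < v0 x &
        forall x, boundary Omega x -> v0 x = 0] /\
    [/\ alpha_concave alpha Omega v0,
        exists2 G : R * R -> R * R, extends_gradient Omega v0 G &
          forall x, boundary Omega x -> G x != 0 &
        forall v : R * R -> R -> R,
          pressure_solution m (patch (cst 0) (closure Omega) v0) v ->
          exists2 delta : R, 0 < delta &
            forall t, 0 < t -> t < delta ->
              ~ @convex_set R (R * R)%type (positivity_set v t) /\
              ~ alpha_concave alpha (positivity_set v t) (v ^~ t)].
Proof.
pose eps : R := (1 - 2 * alpha) / 64.
have eps0 : 0 < eps <= 1 / 64 by rewrite /eps; apply/andP; split; lra.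
have eps01 : 0 <= eps <= 1 / 64 by case/andP: eps0 => h ->; rewrite ltW.
exists (@cell R), (initial_pressure eps); split; [|split].
- split; [exact: bounded_cell|exact: open_cell|exact: convex_cell|exact: smooth_boundary_cell].
- split; first exact: smooth_initial_pressure.
    by move=> x; exact: initial_pressure_gt0.
  by move=> x /boundary_cell x0; rewrite /initial_pressure x0 mul0r.
split; first exact: alpha_concave_initial_pressure.
- exists (gradient (initial_pressure eps)); first exact: extends_gradient_initial_pressure.
  by move=> x /boundary_cell; exact: gradient_initial_pressure_neq0.
move=> v /(support_not_convex hm eps0)[delta d0 H]; exists delta => // t t0 td.
by split; [exact: H|case=> _ [cvx _]; exact: (H t t0 td cvx)].
Qed.
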